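(* Assume the Setting and Assumptions below. Let $\bar c=(c_1,c_2,c_3)$ be new variables and put $$R(\bar c,d,\bar k,t_1,t_2)=\operatorname{Res}_{t_0}\bigl(T_0(\bar k,\bar t_h),\,T(\bar c,d,\bar k,\bar t_h)\bigr),\qquad T=c_1T_1+c_2T_2+c_3T_3 .$$ Then $$m\cdot\delta=\deg_{\{t_1,t_2\}}\Bigl(\operatorname{PP}_{(d,\bar k)}\bigl(\operatorname{Con}_{\bar c}(R)\bigr)\Bigr),$$ where $\operatorname{Con}_{\bar c}$ denotes the content with respect to the variables $\bar c$ (gcd of the coefficients of $R$ viewed as a polynomial in $\bar c$) and $\operatorname{PP}_{(d,\bar k)}$ denotes the primitive part with respect to the variables $(d,k_1,k_2,k_3)$.
   Context: Setting. Let $f\in\mathbb C[y_1,y_2,y_3]$ be irreducible, defining a surface $\Sigma\subset\mathbb C^3$; $f_i=\partial f/\partial y_i$, $h_{\rm imp}=f_1^2+f_2^2+f_3^2$, and assume $h_{\rm imp}$ does not vanish identically on $\Sigma$. The generic offset system in the variables $(d,\bar x,\bar y,u)\in\mathbb C\times\mathbb C^3\times\mathbb C^3\times\mathbb C$ is: $f(\bar y)=0$; $f_i(\bar y)(x_j-y_j)-f_j(\bar y)(x_i-y_i)=0$ for $1\le i<j\le 3$; $\sum_{i=1}^3(x_i-y_i)^2-d^2=0$; $u\,h_{\rm imp}(\bar y)-1=0$. The generic offset $\mathcal O_d(\Sigma)\subset\mathbb C^4$ is the Zariski closure of the projection of its solution set to the coordinates $(d,\bar x)$; for fixed $d^o\neq0$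 the offset $\mathcal O_{d^o}(\Sigma)\subset\mathbb C^3$ is the Zariski closure of the projection to $\bar x$ of the solution set of the same system with $d=d^o$. $\mathcal O_d(\Sigma)$ is a hypersurface; its square-free defining polynomial $g(d,\bar x)$ is the generic offset polynomial and $\delta=\deg_{\bar x}(g)$ (total degree in $x_1,x_2,x_3$). Assume $\Sigma$ is rational and $P(\bar t)=(P_1/P_0,P_2/P_0,P_3/P_0)$, $\bar t=(t_1,t_2)$, $P_i\in\mathbb C[\bar t]$, $\gcd(P_0,\dots,P_3)=1$, is a (not necessarily proper) rational parametrization of $\Sigma$ (image Zariski dense in $\Sigma$); $m$ is its tracing index, i.e. the degree of the map $P:\mathbb C^2\dashrightarrow\Sigma$ (a generic point of $\Sigma$ has exactly $m$ parameter preimages). Let $X,Y,Z,W\in\mathbb C[t_0,t_1,t_2]$ be homogeneous of a common degree with $\gcd(X,Y,Z,W)=1$ and $X(1,\bar t)/W(1,\bar t)=P_1/P_0$, $Y(1,\bar t)/W(1,\bar t)=P_2/P_0$, $Z(1,\bar t)/W(1,\bar t)=P_3/P_0$. Write $\frac{\partial P}{\partial t_1}\wedge\frac{\partial P}{\partial t_2}=(A_1/A_0,A_2/A_0,A_3/A_0)$ with $A_i\in\mathbb C[\bar t]$ ($\wedge$ the cross product) and let $n_i=A_i/\gcd(A_1,A_2,A_3)$. Let $N_1,N_2,N_3\in\mathbb C[t_0,t_1,t_2]$ be homogeneous of a common degree with $\gcd(N_1,N_2,N_3)=1$ and $N_i(1,\bar t)=n_i(\bar t)$; $H=N_1^2+N_2^2+N_3^2$.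 Write $\bar t_h=(t_0,t_1,t_2)$, $\bar k=(k_1,k_2,k_3)$, $d$ variables. Define $Q_0=\gcd(YN_3-ZN_2,\,ZN_1-XN_3,\,XN_2-YN_1)$, $U_1=(YN_3-ZN_2)/Q_0$, $U_2=(ZN_1-XN_3)/Q_0$, $U_3=(XN_2-YN_1)/Q_0$, $T_0=k_1U_1+k_2U_2+k_3U_3$; $Q=\gcd(H,W^2)$, $\tilde H=H/Q$, $\tilde W=W^2/Q$; $M_{h,1}=k_2Z-k_3Y$, $M_{h,2}=k_3X-k_1Z$, $M_{h,3}=k_1Y-k_2X$, $G_{h,1}=k_2N_3-k_3N_2$, $G_{h,2}=k_3N_1-k_1N_3$, $G_{h,3}=k_1N_2-k_2N_1$; $T_i=\tilde H M_{h,i}^2-d^2\tilde W G_{h,i}^2$ for $i=1,2,3$. Assumptions: (1) there is a finite set $\Delta^1\subset\mathbb C$ such that for $d^o\notin\Delta^1$ the origin does not belong to $\mathcal O_{d^o}(\Sigma)$; (2) $\Sigma$ is not a sphere centered at the origin. *)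

(* Defs.v *)
From HB Require Import structures.
From mathcomp Require Import all_boot all_order all_algebra.
From mathcomp Require Import reals.
From mathcomp Require Import complex.
From mathcomp.multinomials Require Import mpoly.

Set Implicit Arguments.
Unset Strict Implicit.
Unset Printing Implicit Defensive.

Import Order.TTheory GRing.Theory Num.Theory.
Local Open Scope ring_scope.

Section OffsetDefs.
Variable F : fieldType.

Definition mdvd n (p q : {mpoly F[n]}) : Prop := exists r, q = p * r.

Definition is_gcd n (s : seq {mpoly F[n]}) (g : {mpoly F[n]}) : Prop :=
  (forall q, q \in s -> mdvd g q) /\
  (forall h, (forall q, q \in s -> mdvd h q) -> mdvd h g).

(* constant polynomials (these are the units together with 0) *)
Definition mconst n (p : {mpoly F[n]}) : bool := (msize p <= 1)%N.

Definition mirreducible n (p : {mpoly F[n]}) : Prop :=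
  ~~ mconst p /\ forall a b, p = a * b -> mconst a \/ mconst b.

Definition msqfree n (p : {mpoly F[n]}) : Prop :=
  forall h, mdvd (h * h) p -> mconst h.

Definition var n (k : nat) : {mpoly F[n.+1]} := 'X_(inord k).

Definition mrestr n (S : pred 'I_n) (m : 'X_{1..n}) : 'X_{1..n} :=
  [multinom (if S i then m i else 0%N) | i < n].

Definition coefs_in n (S : pred 'I_n) (p : {mpoly F[n]}) : seq {mpoly F[n]} :=
  [seq \sum_(m <- msupp p | mrestr S m == m0) p@_m *: 'X_[mrestr (predC S) m]
  | m0 <- [seq mrestr S m | m <- msupp p]].

Definition deg_in n (S : pred 'I_n) (p : {mpoly F[n]}) : nat :=
  \max_(m <- msupp p) (\sum_(i < n | S i) m i)%N.

Definition upoly0 n (p : {mpoly F[n.+1]}) : {poly {mpoly F[n.+1]}} :=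
  \sum_(m <- msupp p)
     (p@_m *: 'X_[mrestr (fun i : 'I_n.+1 => i != ord0) m])%:P * 'X^(m ord0).

Definition zclosure n (S : ('I_n -> F) -> Prop) (z : 'I_n -> F) : Prop :=
  forall q : {mpoly F[n]}, (forall w, S w -> meval w q = 0) -> meval z q = 0.

Definition s1 (i : 'I_3) : 'I_3 := inord ((i + 1) %% 3).
Definition s2 (i : 'I_3) : 'I_3 := inord ((i + 2) %% 3).
Definition cross (A : comPzRingType) (a b : 'I_3 -> A) (i : 'I_3) : A :=
  a (s1 i) * b (s2 i) - a (s2 i) * b (s1 i).

Definition himp (f : {mpoly F[3]}) : {mpoly F[3]} := \sum_(i < 3) (mderiv i f) ^+ 2.

Definition offset_sys (f : {mpoly F[3]}) (d : F) (x y : 'I_3 -> F) (u : F) : Prop :=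
  [/\ meval y f = 0,
      (forall i j : 'I_3, (i < j)%N ->
         meval y (mderiv i f) * (x j - y j) - meval y (mderiv j f) * (x i - y i) = 0),
      \sum_(i < 3) (x i - y i) ^+ 2 - d ^+ 2 = 0
    & u * meval y (himp f) - 1 = 0].

Definition gen_offset (f : {mpoly F[3]}) : ('I_4 -> F) -> Prop :=
  zclosure (fun z => exists y u, offset_sys f (z ord0) (fun i : 'I_3 => z (lift ord0 i)) y u).

Definition offset_at (f : {mpoly F[3]}) (d0 : F) : ('I_3 -> F) -> Prop :=
  zclosure (fun x => exists y u, offset_sys f d0 x y u).

Definition param_at (P0 : {mpoly F[2]}) (Pn : 'I_3 -> {mpoly F[2]}) (t : 'I_2 -> F) : 'I_3 -> F :=
  fun i => meval t (Pn i) / meval t P0.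

Definition preimage (P0 : {mpoly F[2]}) (Pn : 'I_3 -> {mpoly F[2]}) (y : 'I_3 -> F)
    (t : 'I_2 -> F) : Prop :=
  meval t P0 != 0 /\ forall i, param_at P0 Pn t i = y i.

(* m is the tracing index: a generic point of Sigma = V(f) (outside a proper
   algebraic subset V(h) of Sigma) has exactly m parameter preimages *)
Definition tracing_index (f : {mpoly F[3]}) (P0 : {mpoly F[2]}) (Pn : 'I_3 -> {mpoly F[2]})
    (m : nat) : Prop :=
  exists h : {mpoly F[3]},
    (exists y, meval y f = 0 /\ meval y h != 0) /\
    forall y, meval y f = 0 -> meval y h != 0 ->
      exists s : seq {ffun 'I_2 -> F},
        [/\ uniq s, size s = m & forall t : {ffun 'I_2 -> F}, t \in s <-> preimage P0 Pn y t].

(* numerators of the partial derivatives: d(Pn i / P0)/dt_j = D i j / P0^2 *)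
Definition dnum (P0 : {mpoly F[2]}) (Pn : 'I_3 -> {mpoly F[2]}) (i : 'I_3) (j : 'I_2) :
  {mpoly F[2]} := mderiv j (Pn i) * P0 - Pn i * mderiv j P0.

(* dP/dt1 x dP/dt2 = (A 0, A 1, A 2) / P0^4 *)
Definition Acomp (P0 : {mpoly F[2]}) (Pn : 'I_3 -> {mpoly F[2]}) : 'I_3 -> {mpoly F[2]} :=
  cross (dnum P0 Pn ^~ ord0) (dnum P0 Pn ^~ ord_max).

Definition dehom (p : {mpoly F[3]}) : {mpoly F[2]} :=
  p \mPo [tuple 1; 'X_ord0; 'X_ord_max].

(* embedding of F[t0,t1,t2] into F[t0,t1,t2,d,k1,k2,k3,c1,c2,c3]
   (variable indices 0..9 in that order) *)
Definition emb (p : {mpoly F[3]}) : {mpoly F[10]} :=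
  p \mPo [tuple var 9 0; var 9 1; var 9 2].

Definition kvar (i : 'I_3) : {mpoly F[10]} := var 9 (4 + i).
Definition cvar (i : 'I_3) : {mpoly F[10]} := var 9 (7 + i).
Definition dvar : {mpoly F[10]} := var 9 3.

Definition cvars : pred 'I_10 := fun i => (7 <= i)%N.
Definition dkvars : pred 'I_10 := fun i => (3 <= i <= 6)%N.
Definition t12vars : pred 'I_10 := fun i => (1 <= i <= 2)%N.

End OffsetDefs.

Definition mhomog (F : fieldType) n (e : nat) (p : {mpoly F[n]}) : bool :=
  p \is e.-homog.

Definition vec3 (T : Type) (a b c : T) : 'I_3 -> T := fun j => nth a [:: a; b; c] j.

(* Main.v *)
(* Both sides count the same finite set. Fix a generic direction k and a generic distance d.

   The generic offset polynomial is d^j G(d^2, x) with G prime, and on the offset the foot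
   point y is x + G_x / (2 G_D). By Assumption (1) G(d^2, 0) is not zero, so the line spanned by
   k meets the offset in delta distinct points, each with a unique foot point on Sigma; every
   foot point has m parameters t. Hence m * delta is the number of parameters t such that the
   normal line at P(t) meets the line spanned by k at distance d from P(t).

   On T_0 = 0 the vectors k x (X,Y,Z) and k x N are multiples of U, so T_j = U_j^2 (x - d^2 y):
   the parameters above are the solutions of T_0 = T_1 = T_2 = T_3 = 0 outside a fixed curve.
   Cut with a generic plane t2 = ups + eta t1, which meets each line through the origin once.
   There R is a product over the zeros of T_0, so the multiplicity in d of its primitive
   part pp at t is the number of solutions above t; for generic values it equals the
   multiplicity in t, and these add up to the degree of pp in (t1, t2). The cases that could
   lose solutions confine k to a cone over a curve. If T_0 does not involve t0, R is a power of
   T_0 and the solutions are counted directly. Assumption (2) is what makes U nonzero. *)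

(* Genericity is organized by two quantifiers: the direction k avoids a hypersurface ([gen]), then d
   avoids finitely many values that may depend on k ([cof]). The plane is fixed before both: its
   slope [eta] lets pp keep its full degree in (t1, t2) on the line t2 = ups + eta t1, and a general
   intercept [ups] preserves the coprimality conditions on the plane. Every dimension argument
   reduces to two facts. Coprime polynomials admit a Bezout identity whose value is free of one
   variable, so their common zeros miss most lines of a given direction; and n + 1 polynomials in n
   variables are algebraically dependent, so a rational map of n-space to itself sends a
   hypersurface into a hypersurface. The latter turns each cone over a curve into one polynomial
   condition on k. The delicate point is that pp must neither gain nor lose zeros: at the finitely
   many bad t its primitivity in (d, k) makes it nonzero for general (k, d), and the system has no
   solution there either, so these t contribute to neither count. *)
Require Import Defs.
From HB Require Import structures.
From mathcomp Require Import all_boot all_order all_algebra.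
From mathcomp Require Import reals.
From mathcomp Require Import complex.
From mathcomp.multinomials Require Import mpoly.
From mathcomp Require Import boolp.
From mathcomp Require Import ring zify.

Set Implicit Arguments.
Unset Strict Implicit.
Unset Printing Implicit Defensive.

Import Order.TTheory GRing.Theory Num.Theory.
Local Open Scope ring_scope.

(** * Unique factorization *)

Section Ufd.
Variable A : idomainType.

Definition rdvd (a b : A) : Prop := exists r, b = a * r.

Definition rprime (p : A) : Prop :=
  [/\ p != 0, p \isn't a GRing.unit
    & forall a b, rdvd p (a * b) -> rdvd p a \/ rdvd p b].

(** The factors are asked to be prime, not just irreducible: uniqueness is then automatic, and
    irreducible elements turn out to be prime. *)
Definition ufd : Prop := forall a, a != 0 ->
  exists u s, [/\ u \is a GRing.unit, (forall p, p \in s -> rprime p)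
                & a = u * \prod_(p <- s) p].

Lemma rdvd_mulr a b c : rdvd a b -> rdvd a (b * c).
Proof. by case=> r ->; exists (r * c); rewrite mulrA. Qed.

Lemma rdvd_mull a b c : rdvd a b -> rdvd a (c * b).
Proof. by rewrite mulrC; exact: rdvd_mulr. Qed.

Lemma rdvd_add a b c : rdvd a b -> rdvd a c -> rdvd a (b + c).
Proof. by case=> r -> [s ->]; exists (r + s); rewrite mulrDr. Qed.

Lemma rdvd_trans a b c : rdvd a b -> rdvd b c -> rdvd a c.
Proof. by case=> r -> [s ->]; exists (r * s); rewrite mulrA. Qed.

Lemma rdvd0 a : rdvd a 0. Proof. by exists 0; rewrite mulr0. Qed.
Lemma rdvdxx a : rdvd a a. Proof. by exists 1; rewrite mulr1. Qed.
Lemma rdvd1 a : rdvd a 1 -> a \is a GRing.unit.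
Proof. by case=> r /esym ar; apply/unitrPr; exists r. Qed.

Lemma rprime_unit p u : rprime p -> u \is a GRing.unit -> ~ rdvd p u.
Proof.
case=> _ pn _ uu [r ur]; move: uu; rewrite ur unitrM => /andP[pu _].
by rewrite pu in pn.
Qed.

Lemma rprime_prod p s : rprime p -> rdvd p (\prod_(q <- s) q) ->
  exists2 q, q \in s & rdvd p q.
Proof.
move=> pp; elim: s => [|q s IHs].
  by rewrite big_nil => /(rprime_unit pp (unitr1 _)).
rewrite big_cons; case: (pp) => _ _ P /P[pq|/IHs[r rs pr]].
  by exists q; rewrite ?mem_head.
by exists r; rewrite // inE rs orbT.
Qed.

Lemma ufd_irreducible_prime p : ufd -> p != 0 -> p \isn't a GRing.unit ->
  (forall a b, p = a * b -> a \is a GRing.unit \/ b \is a GRing.unit) ->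
  rprime p.
Proof.
move=> U p0 pn irr; have [u [s [uu sp]]] := U p p0.
case: s sp => [|q s] sp pE.
  by move: pn; rewrite pE big_nil mulr1 uu.
have qp : rprime q by apply: sp; rewrite mem_head.
have [q0 qn qP] := qp.
set v := u * \prod_(r <- s) r.
have pq : p = q * v by rewrite pE big_cons mulrCA.
have [qu|vu] := irr _ _ pq; first by rewrite qu in qn.
split=> // a b [r abE].
have [|[c ac]|[c bc]] := qP a b; first by exists (v * r); rewrite mulrA -pq.
- by left; exists (c / v); rewrite pq ac -mulrA [v * _]mulrC divrK.
- by right; exists (c / v); rewrite pq bc -mulrA [v * _]mulrC divrK.
Qed.

End Ufd.

Lemma ufd_field (K : fieldType) : ufd K.
Proof.
move=> a a0; exists a, [::]; split=> //; first by rewrite unitfE.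
by rewrite big_nil mulr1.
Qed.

Section UfdPoly.
Variable A : idomainType.
Implicit Types (f g : {poly A}) (a c p : A).

Lemma rdvdC p f : rdvd p%:P f <-> forall i, rdvd p f`_i.
Proof.
split=> [[r -> i]|]; first by exists r`_i; rewrite coefCM.
elim/poly_ind: f => [|f c IHf] H; first by exists 0; rewrite mulr0.
have [|r ->] := IHf.
  by move=> i; have := H i.+1; rewrite coefD coefMX coefC /= addr0.
have [s] := H 0%N; rewrite coefD coefMX coefC /= add0r => ->.
by exists (r * 'X + s%:P); rewrite mulrDr mulrA polyCM.
Qed.

Lemma rprimeC p : rprime p -> rprime p%:P.
Proof.
move=> [p0 pn pP]; split; rewrite ?polyC_eq0 ?poly_unitE //.
  by rewrite coefC eqxx; apply/negP => /andP[_] h; rewrite h in pn.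
move=> f g; have [n] := ubnP (size f + size g)%N; elim: n => // n IHn in f g *.
rewrite ltnS => sz dfg.
have [f0|f0] := eqVneq f 0; first by left; rewrite f0; exact: rdvd0.
have [g0|g0] := eqVneq g 0; first by right; rewrite g0; exact: rdvd0.
have : rdvd p (lead_coef f * lead_coef g).
  by rewrite -lead_coefM; apply: (rdvdC p (f * g)).1.
have tlE (h : {poly A}) : h = take_poly (size h).-1 h + lead_coef h *: 'X^((size h).-1).
  apply/polyP=> i; rewrite coefD coef_take_poly coefZ coefXn.
  case: ltngtP => hi; rewrite ?mulr0 ?addr0 ?mulr1 ?add0r //; last by rewrite hi.
  by rewrite nth_default //; case: (size h) hi.
have tls (h : {poly A}) : h != 0 -> (size (take_poly (size h).-1 h) < size h)%N.
  move=> h0; apply: leq_ltn_trans (size_take_poly _ _) _.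
  by rewrite -size_poly_gt0 in h0; rewrite prednK.
have dl (h : {poly A}) : rdvd p (lead_coef h) -> rdvd p%:P (lead_coef h *: 'X^((size h).-1)).
  by move=> [r ->]; exists (r *: 'X^((size h).-1)); rewrite -scalerA mul_polyC.
have sub (b d e : {poly A}) : rdvd p%:P (b * d + e) -> rdvd p%:P e -> rdvd p%:P (b * d).
  by move=> [r rE] [t tE]; exists (r - t); rewrite mulrBr -rE -tE addrK.
case/pP => h.
  have [||d|d] := IHn (take_poly (size f).-1 f) g; last by right.
  - by apply: leq_trans sz; rewrite ltn_add2r tls.
  - apply: (@sub _ _ (lead_coef f *: 'X^((size f).-1) * g)); last by apply: rdvd_mulr; exact: dl.
    by rewrite -mulrDl -tlE.
  - by left; rewrite [f]tlE; apply: rdvd_add => //; exact: dl.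
have [||d|d] := IHn f (take_poly (size g).-1 g); last 1 first.
- by right; rewrite [g]tlE; apply: rdvd_add => //; exact: dl.
- by apply: leq_trans sz; rewrite ltn_add2l tls.
- apply: (@sub _ _ (f * (lead_coef g *: 'X^((size g).-1)))); last by apply: rdvd_mull; exact: dl.
  by rewrite -mulrDr -tlE.
- by left.
Qed.

Definition poly_prim f := forall p, rprime p -> ~ rdvd p%:P f.

(** The primes of [c] are cancelled one at a time: each divides [f * w] and, not dividing the
    primitive [f], divides the cofactor [w]. *)
Lemma poly_prim_dvd f g c : ufd A -> poly_prim f -> c != 0 ->
  rdvd f (c%:P * g) -> rdvd f g.
Proof.
move=> U fp c0; have [u [s [uu sp ->]]] := U c c0.
elim: s sp g => [|p s IHs] sp g.
  rewrite big_nil mulr1 => -[w h]; exists (u^-1%:P * w).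
  by rewrite mulrCA -h mulrA -polyCM mulVr // mul1r.
have pp : rprime p by apply: sp; rewrite mem_head.
rewrite big_cons mulrCA polyCM -mulrA => -[w h].
have [_ _ P] := rprimeC pp.
have [||[w' w'E]] := P f w.
- by exists ((u * \prod_(j <- s) j)%:P * g); rewrite -h.
- by move/fp => /(_ pp).
apply: IHs => [q qs|]; first by apply: sp; rewrite inE qs orbT.
exists w'; apply: (@mulfI _ p%:P); first by rewrite polyC_eq0; case: pp.
by rewrite h w'E mulrCA.
Qed.

(** Extracting content primes terminates because each is associated with a prime factor of the
    leading coefficient, and the number of these drops by one. *)
Lemma poly_prim_part f : ufd A -> f != 0 ->
  exists c f0, [/\ c != 0, poly_prim f0 & f = c%:P * f0].
Proof.
move=> U f0; have [|u [s [uu sp]]] := U (lead_coef f); first by rewrite lead_coef_eq0.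
have [n] := ubnP (size s); elim: n => // n IHn in s u f f0 uu sp *.
move=> sz lE; have [fp|] := pselect (poly_prim f).
  by exists 1, f; rewrite oner_neq0 mul1r.
move/existsNP => [p] /not_implyP[pp] /contrapT[g gE].
have g0 : g != 0 by apply: contra_neq f0; rewrite gE => ->; rewrite mulr0.
have [p0 pn pP] := pp.
have lg : lead_coef f = p * lead_coef g by rewrite gE lead_coefM lead_coefC.
have : rdvd p (u * \prod_(j <- s) j) by rewrite -lE lg; exists (lead_coef g).
case/pP => [/(rprime_unit pp uu)//|/(rprime_prod pp)[q qs [r rE]]].
have qp := sp q qs; have [q0 qn qP] := qp.
have ru : r \is a GRing.unit.
  have [|[e eE]|[e eE]] := qP p r; first by rewrite -rE; exact: rdvdxx.
    apply: (@rdvd1 _ r); exists e; apply: (@mulfI _ q) => //.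
    by rewrite mulr1 {1}rE eE -!mulrA [e * r]mulrC.
  move: pn; suff -> : p \is a GRing.unit by [].
  apply: rdvd1; exists e; apply: (@mulfI _ q) => //.
  by rewrite mulr1 {1}rE eE mulrCA.
have [||||c [h [c0 hp hE]]] := IHn (rem q s) (u * r) g g0.
- by rewrite unitrM uu.
- by move=> t /mem_rem; exact: sp.
- by rewrite size_rem //; move: sz; case: (s) qs.
- apply: (@mulfI _ p) => //; rewrite -lg lE (perm_big _ (perm_to_rem qs)) big_cons /=.
  by set t := \prod_(j <- rem q s) j; rewrite rE; ring.
exists (p * c), h; split=> //; first by rewrite mulf_neq0.
by rewrite gE hE polyCM mulrA.
Qed.

Fixpoint ideal (B : comNzRingType) (qs : seq B) (g : B) : Prop :=
  if qs is q :: qs' then exists a h : B, ideal qs' h /\ g = a * q + h else g = 0.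

Lemma ideal0 (B : comNzRingType) (qs : seq B) : ideal qs 0.
Proof.
by elim: qs => //= q qs IHqs; exists 0, 0; rewrite mul0r addr0.
Qed.

Lemma ideal_lin (B : comNzRingType) (qs : seq B) (g h b c : B) :
  ideal qs g -> ideal qs h -> ideal qs (b * g + c * h).
Proof.
elim: qs g h => [|q qs IHqs] g h /=; first by move=> -> ->; rewrite !mulr0 addr0.
move=> [a1 [h1 [I1 ->]]] [a2 [h2 [I2 ->]]].
exists (b * a1 + c * a2), (b * h1 + c * h2); split; first exact: IHqs.
by rewrite !mulrDr !mulrDl !mulrA addrACA.
Qed.

Lemma ideal_mem (B : comNzRingType) (qs : seq B) q : q \in qs -> ideal qs q.
Proof.
elim: qs => // p s IHs; rewrite inE => /predU1P[->|qs] /=.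
  by exists 1, 0; rewrite mul1r addr0; split=> //; exact: ideal0.
by exists 0, q; rewrite mul0r add0r; split=> //; exact: IHs.
Qed.

Lemma ideal_morph (B C : comNzRingType) (phi : {rmorphism B -> C}) qs (g : B) :
  ideal qs g -> (forall q, q \in qs -> phi q = 0) -> phi g = 0.
Proof.
elim: qs g => [|q qs IHqs] g /=; first by move=> ->; rewrite rmorph0.
move=> [a [h [I ->]]] qs0; rewrite rmorphD rmorphM (qs0 q) ?mem_head // mulr0 add0r.
by apply: IHqs => // r rqs; apply: qs0; rewrite inE rqs orbT.
Qed.

Lemma ex_min_size (P : {poly A} -> Prop) : (exists2 f, f != 0 & P f) ->
  exists f, [/\ f != 0, P f & forall g, g != 0 -> P g -> (size f <= size g)%N].
Proof.
move=> [f f0 Pf].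
have ex : exists n, `[< exists f, [/\ f != 0, P f & size f = n] >].
  by exists (size f); apply/asboolP; exists f.
case: (ex_minnP ex) => n /asboolP[g [g0 Pg gn]] nmin; exists g; split=> // h h0 Ph.
by rewrite gn nmin //; apply/asboolP; exists h.
Qed.

(** Euclid's algorithm over the fraction field in disguise: a nonzero element of least degree and
    pseudo-division, with the denominators surviving as the constants [c]. *)
Lemma ideal_generator (qs : seq {poly A}) : (exists2 q, q \in qs & q != 0) ->
  exists g, [/\ g != 0, ideal qs g
    & forall q, q \in qs -> exists2 c, c != 0 & rdvd g (c%:P * q)].
Proof.
move=> [q0 q0s q00].
have [|g [g0 Ig gmin]] := @ex_min_size (ideal qs).
  by exists q0 => //; exact: ideal_mem.
exists g; split=> // q qs_; exists (lead_coef g ^+ scalp q g).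
  by rewrite expf_neq0 // lead_coef_eq0.
have dE := Pdiv.Idomain.divp_eq q g.
have [r0|r0] := eqVneq (modp q g) 0.
  by exists (divp q g); rewrite mul_polyC dE r0 addr0 mulrC.
have : (size g <= size (modp q g))%N.
  apply: gmin => //; rewrite (_ : modp q g = 
    (lead_coef g ^+ scalp q g)%:P * q + - divp q g * g).
    by apply: ideal_lin => //; exact: ideal_mem.
  by rewrite mul_polyC dE mulNr addrAC subrr add0r.
by rewrite leqNgt Pdiv.Idomain.ltn_modp g0.
Qed.

(* A primitive polynomial of least positive degree among the divisors of q over the
   fraction field is prime. *)
Lemma ufd_poly_step f : ufd A -> (1 < size f)%N ->
  exists p g : {poly A}, [/\ rprime p, (1 < size p)%N & f = p * g].
Proof.
move=> U sf; have f0 : f != 0 by rewrite -size_poly_gt0 (leq_trans _ sf).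
have [|p1 [p10 [sp1 [c1 c10 dp1]] pmin]] := @ex_min_size
    (fun p : {poly A} => (1 < size p)%N /\ exists2 c, c != 0 & rdvd p (c%:P * f)).
  by exists f => //; split=> //; exists 1; rewrite ?oner_neq0 // mul1r; exact: rdvdxx.
have [c2 [p [c20 pp pE]]] := poly_prim_part U p10.
have p0 : p != 0 by apply: contra_neq p10; rewrite pE => ->; rewrite mulr0.
have sp : size p = size p1 by rewrite pE mul_polyC size_scale.
have pP : rprime p.
  split=> //; first by rewrite poly_unitE sp; case: eqP sp1 => // ->.
  move=> u v puv.
  have [g [g0 [a [h [[b [h' [-> ->]]] gE]]] gd]] := @ideal_generator [:: p; u]
    (ex_intro2 _ _ p (mem_head _ _) p0).
  rewrite addr0 in gE.
  have [d1 d10 [e1 e1E]] := gd p (mem_head _ _).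
  have [d2 d20 [e2 e2E]] : exists2 c, c != 0 & rdvd g (c%:P * u).
    by apply: gd; rewrite !inE eqxx orbT.
  (* [g] generates (p, u) over the fraction field. If it is constant, the Bezout identity times [v]
     gives p | v; otherwise minimality makes [g] and [p] proportional over the fraction field, and p
     | u. *)
  have [sg|sg] := leqP (size g) 1.
    right; move/size1_polyC: sg => gC.
    apply: (@poly_prim_dvd _ _ g`_0) => //; first by rewrite -polyC_eq0 -gC.
    rewrite -gC gE mulrDl; apply: rdvd_add.
      by rewrite mulrAC; apply: rdvd_mull; exact: rdvdxx.
    by rewrite -mulrA; exact: rdvd_mull.
  left.
  have sg1 : (size p1 <= size g)%N.
    apply: pmin => //; split=> //; exists (c2 * d1 * c1).
      by rewrite !mulf_neq0.
    move: dp1 => [r rE]; exists (e1 * c2%:P * c2%:P * r).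
    transitivity (c2%:P * d1%:P * (c1%:P * f)); first by rewrite !polyCM; ring.
    rewrite rE pE; transitivity (c2%:P * c2%:P * (d1%:P * p) * r); first by ring.
    by rewrite e1E; ring.
  have e10 : e1 != 0.
    by apply: contra_neq p0 => e; move/eqP: e1E; rewrite e mulr0 mulf_eq0 polyC_eq0 (negbTE d10) => /eqP.
  have se1 : (size e1 <= 1)%N.
    have := congr1 (fun q : {poly A} => size q) e1E.
    rewrite mul_polyC size_scale // size_mul // sp => sE.
    by move: sg1 sg; rewrite sE; lia.
  apply: (@poly_prim_dvd _ _ (e1`_0 * d2)) => //.
    by rewrite mulf_neq0 // -polyC_eq0 -(size1_polyC se1).
  exists (d1%:P * e2); rewrite polyCM -(size1_polyC se1) -mulrA e2E.
  transitivity ((g * e1) * e2); first by ring.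
  by rewrite -e1E; ring.
have [r rE] : rdvd p f.
  apply: (@poly_prim_dvd _ _ c1) => //; apply: rdvd_trans dp1.
  by exists c2%:P; rewrite pE mulrC.
by exists p, r; split=> //; rewrite sp.
Qed.

Lemma ufd_poly : ufd A -> ufd {poly A}.
Proof.
move=> U f; have [n] := ubnP (size f); elim: n => // n IHn in f *; move=> sz f0.
have [sf|sf] := leqP (size f) 1.
  have fC := size1_polyC sf.
  have [|u [s [uu sp fE]]] := U f`_0; first by rewrite -polyC_eq0 -fC.
  exists u%:P, (map polyC s); split.
  - have u0 : u != 0 by apply: contraTneq uu => ->; rewrite unitr0.
    by rewrite poly_unitE size_polyC u0 coefC eqxx uu.
  - by move=> p /mapP[q qs ->]; apply: rprimeC; exact: sp.
  - by rewrite fC fE polyCM big_map rmorph_prod.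
have [p [g [pp sp fE]]] := ufd_poly_step U sf.
have g0 : g != 0 by apply: contra_neq f0; rewrite fE => ->; rewrite mulr0.
have p0 : p != 0 by case: pp.
have [||u [s [uu sP gE]]] := IHn g => //.
  by move: sz sp; rewrite fE size_mul //; lia.
exists u, (p :: s); split=> //; last by rewrite big_cons mulrCA -gE.
by move=> q; rewrite inE => /predU1P[->|/sP].
Qed.

End UfdPoly.

(** * Multivariate polynomials *)

Lemma mpoly_ring_ind (A : nzRingType) n (P : {mpoly A[n]} -> Prop) :
  (forall c, P c%:MP) -> (forall i, P 'X_i) ->
  (forall a b, P a -> P b -> P (a + b)) ->
  (forall a b, P a -> P b -> P (a * b)) -> forall p, P p.
Proof.
move=> PC PX PD PM p; rewrite (mpolyE p).
apply: (big_ind P) => [|//|m _]; first by rewrite -mpolyC0; exact: PC.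
rewrite -mul_mpolyC; apply: (PM); first exact: PC.
rewrite mpolyXE_id; apply: (big_ind P); [by rewrite -mpolyC1; exact: PC|exact: PM|].
move=> i _; elim: (m i) => [|k IHk]; first by rewrite expr0 -mpolyC1; exact: PC.
by rewrite exprS; exact: PM.
Qed.

Lemma mpoly_rmorph_eq (A B : nzRingType) n (phi psi : {rmorphism {mpoly A[n]} -> B}) :
  (forall c, phi c%:MP = psi c%:MP) -> (forall i, phi 'X_i = psi 'X_i) -> phi =1 psi.
Proof.
move=> eqC eqX; apply: mpoly_ring_ind => // a b Ha Hb.
  by rewrite !rmorphD Ha Hb.
by rewrite !rmorphM Ha Hb.
Qed.

(** An arbitrary derivation [D] of the target is allowed, so that the same rule serves the
    derivative in an auxiliary variable and the partial derivatives. *)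
Lemma mmap_chain_rule (A : comNzRingType) (B : comNzRingType) n
    (c : {rmorphism A -> B}) (h : 'I_n -> B) (D : {additive B -> B}) q :
  (forall a b, D (a * b) = D a * b + a * D b) -> (forall a, D (c a) = 0) ->
  D (mmap c h q) = \sum_i mmap c h (mderiv i q) * D (h i).
Proof.
move=> DM DC; elim/mpoly_ring_ind: q => [a|i|p q Hp Hq|p q Hp Hq].
- by rewrite mmapC DC big1 // => i _; rewrite mderivC mmap0 mul0r.
- rewrite mmapX mmap1U (bigD1 i) //= mderivX mnm1E eqxx scale1r.
  rewrite (_ : U_(i) - U_(i) = 0)%MM; last by apply/mnmP => j; rewrite mnmBE subnn mnm0E.
  rewrite mpolyX0 rmorph1 mul1r big1 ?addr0 // => j ij.
  by rewrite mderivX mnm1E eq_sym (negbTE ij) scale0r mmap0 mul0r.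
- rewrite rmorphD raddfD Hp Hq -big_split; apply: eq_bigr => i _ /=.
  by rewrite mderivD rmorphD mulrDl.
- rewrite rmorphM DM Hp Hq mulr_suml mulr_sumr -big_split; apply: eq_bigr => i _ /=.
  by rewrite mderivM rmorphD !rmorphM; ring.
Qed.

Lemma mpoly_unitP (F : fieldType) n (p : {mpoly F[n]}) : p != 0 ->
  (p \is a GRing.unit) = mconst p.
Proof.
move=> p0; rewrite /mconst; apply/idP/idP => [pu|sp].
  have := msizeM p0 (_ : p^-1 != 0); rewrite invr_eq0 mulrV // msize1 => /(_ p0).
  have : (msize p^-1 > 0)%N by rewrite lt0n msize_poly_eq0 invr_eq0.
  by move: (msize p) (msize p^-1) => a b; lia.
apply/unitrPr; exists ((p@_0%MM)^-1)%:MP.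
have pC := msize1_polyC sp; rewrite {1}pC -mpolyCM mulfV ?mpolyC1 //.
by apply: contra_neq p0 => c0; rewrite pC c0 mpolyC0.
Qed.

Lemma sum_delta (B : nzRingType) n (i : 'I_n) (f : 'I_n -> B) :
  \sum_j f j * (j == i)%:R = f i.
Proof.
rewrite (bigD1 i) //= eqxx mulr1 big1 ?addr0 // => j ij.
by rewrite (negbTE ij) mulr0.
Qed.

Section ToPoly.
Variables (F : fieldType) (n : nat).
Implicit Types (i : 'I_n.+1) (eta : 'I_n -> F).

(* Isomorphism F[x_0..x_n] -> F[y_1..y_n]['X] singling out the direction
   (1 in position i, eta elsewhere). *)
Definition toP_var i eta (j : 'I_n.+1) : {poly {mpoly F[n]}} :=
  if unlift i j is Some j' then ('X_j')%:P + ((eta j')%:MP)%:P * 'X else 'X.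

Definition toP i eta (p : {mpoly F[n.+1]}) : {poly {mpoly F[n]}} :=
  mmap (polyC \o @mpolyC n F) (toP_var i eta) p.

HB.instance Definition _ i eta := GRing.RMorphism.copy (toP i eta)
  (mmap (polyC \o @mpolyC n F) (toP_var i eta)).

Definition fromC i eta (p : {mpoly F[n]}) : {mpoly F[n.+1]} :=
  mmap (@mpolyC n.+1 F) (fun j => 'X_(lift i j) - (eta j)%:MP * 'X_i) p.

HB.instance Definition _ i eta := GRing.RMorphism.copy (fromC i eta)
  (mmap (@mpolyC n.+1 F) (fun j => 'X_(lift i j) - (eta j)%:MP * 'X_i)).

Definition fromP i eta (q : {poly {mpoly F[n]}}) : {mpoly F[n.+1]} :=
  (horner_eval 'X_i \o map_poly (fromC i eta)) q.

HB.instance Definition _ i eta := GRing.RMorphism.copy (fromP i eta)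
  (horner_eval 'X_i \o map_poly (fromC i eta)).

Lemma fromPX i eta : fromP i eta 'X = 'X_i.
Proof. by rewrite /fromP /= map_polyX /horner_eval hornerX. Qed.

Lemma fromPC i eta c : fromP i eta c%:P = fromC i eta c.
Proof. by rewrite /fromP /= map_polyC /horner_eval hornerC. Qed.

Lemma toPC i eta c : toP i eta c%:MP = (c%:MP)%:P.
Proof. by rewrite /toP mmapC. Qed.

Lemma toPX i eta j : toP i eta 'X_j = toP_var i eta j.
Proof. by rewrite /toP mmapX mmap1U. Qed.

Lemma fromCC i eta c : fromC i eta c%:MP = c%:MP.
Proof. by rewrite /fromC mmapC. Qed.

Lemma fromCX i eta j : fromC i eta 'X_j = 'X_(lift i j) - (eta j)%:MP * 'X_i.
Proof. by rewrite /fromC mmapX mmap1U. Qed.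

Lemma toPK i eta : cancel (toP i eta) (fromP i eta).
Proof.
move=> p; rewrite -[RHS]/(idfun p) -[LHS]/((fromP i eta \o toP i eta) p).
apply: mpoly_rmorph_eq => [c|j] /=.
  by rewrite toPC fromPC fromCC.
rewrite toPX /toP_var; case: unliftP => [k|] ->; last by rewrite fromPX.
by rewrite rmorphD rmorphM /= !fromPC fromPX fromCC fromCX subrK.
Qed.

Lemma fromPK i eta : cancel (fromP i eta) (toP i eta).
Proof.
move=> q.
have CE c : toP i eta (fromC i eta c) = c%:P.
  rewrite -[LHS]/((toP i eta \o fromC i eta) c).
  apply: mpoly_rmorph_eq => [a|j] /=; first by rewrite fromCC toPC.
  rewrite fromCX rmorphB rmorphM /= toPC !toPX /toP_var liftK unlift_none.
  by rewrite addrK.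
elim/poly_ind: q => [|q c IHq]; first by rewrite !rmorph0.
by rewrite !rmorphD !rmorphM /= IHq fromPX fromPC CE toPX /toP_var unlift_none.
Qed.

Lemma toP_eq0 i eta p : (toP i eta p == 0) = (p == 0).
Proof.
apply/eqP/eqP => [p0|->]; last by rewrite rmorph0.
by rewrite -[p](toPK i eta) p0 rmorph0.
Qed.

Definition pt i eta (z : 'I_n -> F) (s : F) (j : 'I_n.+1) : F :=
  if unlift i j is Some j' then z j' + eta j' * s else s.

Definition lineP i eta (z : 'I_n -> F) (p : {mpoly F[n.+1]}) : {poly F} :=
  (map_poly (meval z) \o toP i eta) p.

HB.instance Definition _ i eta z := GRing.RMorphism.copy (lineP i eta z)
  (map_poly (meval z) \o toP i eta).

Lemma horner_lineP i eta z p s : (lineP i eta z p).[s] = meval (pt i eta z s) p.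
Proof.
rewrite -[LHS]/((horner_eval s \o lineP i eta z) p).
apply: mpoly_rmorph_eq => [c|j] /=.
  by rewrite /lineP /= toPC map_polyC /horner_eval hornerC /= !mevalC.
rewrite /lineP /= toPX /toP_var /horner_eval mevalXU /pt.
case: unliftP => [k|] _; last by rewrite map_polyX hornerX.
by rewrite rmorphD rmorphM /= !map_polyC map_polyX !hornerE /= mevalXU mevalC.
Qed.

Lemma toP_deriv i p : (toP i (fun=> 0) p)^`() = toP i (fun=> 0) (mderiv i p).
Proof.
have Dv j : (toP_var i (fun=> 0) j)^`() = (j == i)%:R.
  rewrite /toP_var; case: unliftP => [k|] ->; last by rewrite eqxx derivX.
  by rewrite mpolyC0 mul0r addr0 derivC eq_sym (negbTE (neq_lift _ _)).
rewrite [X in X^`()]/toP (@mmap_chain_rule _ _ _ _ _ (@deriv _)); last 2 first.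
- by move=> a b; exact: derivM.
- by move=> a; exact: derivC.
rewrite (eq_bigr (fun j => toP i (fun=> 0) (mderiv j p) * (j == i)%:R)); last first.
  by move=> j _; congr (_ * _); exact: Dv.
exact: sum_delta.
Qed.

End ToPoly.

Section Iso.
Variables (A B : idomainType) (phi : {rmorphism A -> B}) (psi : {rmorphism B -> A}).
Hypotheses (K1 : cancel phi psi) (K2 : cancel psi phi).

Lemma iso_eq0 a : (phi a == 0) = (a == 0).
Proof.
apply/eqP/eqP => [h|->]; last by rewrite rmorph0.
by rewrite -(K1 a) h rmorph0.
Qed.

Lemma rdvd_iso a c : rdvd (phi a) c <-> rdvd a (psi c).
Proof.
split=> [[r ->]|[r rE]]; first by exists (psi r); rewrite rmorphM K1.
by exists (phi r); rewrite -rmorphM -rE K2.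
Qed.

Lemma unit_iso a : (phi a \is a GRing.unit) = (a \is a GRing.unit).
Proof.
apply/idP/idP => [h|]; last exact: rmorph_unit.
by rewrite -(K1 a); exact: rmorph_unit.
Qed.

Lemma rprime_iso p : rprime p -> rprime (phi p).
Proof.
move=> [p0 pn pP]; split; rewrite ?iso_eq0 ?unit_iso // => a c.
by rewrite !rdvd_iso rmorphM; exact: pP.
Qed.

Lemma ufd_iso : ufd A -> ufd B.
Proof.
move=> U b b0.
have [|u [s [uu sp bE]]] := U (psi b); first by rewrite -iso_eq0 K2.
exists (phi u), (map phi s); split; first by rewrite unit_iso.
  by move=> _ /mapP[p ps ->]; apply: rprime_iso; exact: sp.
by rewrite -(K2 b) bE rmorphM rmorph_prod big_map.
Qed.

End Iso.

(** A generator of the ideal over the fraction field of [A] has degree zero, since a prime factor of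
    positive degree would divide all of [qs]. So the ideal contains a nonzero constant, which dies
    under every morphism that kills [qs]. *)
Lemma elim_iso (A B : idomainType) (phi : {rmorphism B -> {poly A}})
    (psi : {rmorphism {poly A} -> B}) (qs : seq B) :
  ufd A -> cancel phi psi -> cancel psi phi -> (exists2 q, q \in qs & q != 0) ->
  (forall p, rprime p -> (1 < size (phi p))%N -> ~ (forall q, q \in qs -> rdvd p q)) ->
  exists2 c : A, c != 0 &
    forall (C : comNzRingType) (theta : {rmorphism {poly A} -> C}),
      (forall q, q \in qs -> theta (phi q) = 0) -> theta c%:P = 0.
Proof.
move=> U K1 K2 [q0 q0s q00] nocom.
have [|g [g0 Ig gd]] := @ideal_generator _ (map phi qs).
  by exists (phi q0); rewrite ?map_f ?(iso_eq0 K1).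
have [sg|sg] := leqP (size g) 1; last first.
  have [p [h [pp sp gE]]] := ufd_poly_step U sg.
  have [p0 pn pP] := pp.
  have [] := nocom _ (rprime_iso K2 K1 pp); first by rewrite K2.
  move=> q qqs; have [c c0 [t tE]] := gd _ (map_f phi qqs).
  apply/(rdvd_iso K2 K1); have [|[r rE]|//] := pP c%:P (phi q).
    by exists (h * t); rewrite tE gE mulrA.
  have := congr1 (fun u : {poly _} => size u) rE; rewrite size_polyC c0.
  have r0 : r != 0 by apply: contraNneq c0 => r0; rewrite -polyC_eq0 rE r0 mulr0.
  by rewrite size_mul // => e; move: sp; rewrite -size_poly_gt0 in r0; move: r0 e; lia.
have gC := size1_polyC sg.
exists g`_0 => [|C theta H]; first by rewrite -polyC_eq0 -gC.
by rewrite -gC; apply: (ideal_morph Ig) => _ /mapP[q qs_ ->]; exact: H.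
Qed.

Lemma ufd_mpoly (F : fieldType) n : ufd {mpoly F[n]}.
Proof.
elim: n => [|n IHn].
  apply: (@ufd_iso F _ (@mpolyC 0 F) (meval (fun=> 0))) => [c|p|].
  - by rewrite /= mevalC.
  - by rewrite /= [p in LHS]nvar0_mpolyC mevalC -nvar0_mpolyC.
  - exact: ufd_field.
apply: (@ufd_iso {poly {mpoly F[n]}} {mpoly F[n.+1]} (@fromP F n ord0 (fun=> 0)) (@toP F n ord0 (fun=> 0))).
- exact: fromPK.
- exact: toPK.
- exact: ufd_poly.
Qed.

Lemma mirreducible_prime (F : fieldType) n (f : {mpoly F[n]}) :
  mirreducible f -> rprime f.
Proof.
move=> [fn irr].
have f0 : f != 0 by apply: contraNneq fn => ->; rewrite /mconst msize0.
apply: ufd_irreducible_prime => //; first exact: ufd_mpoly.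
  by rewrite mpoly_unitP.
move=> a b fE; have := f0; rewrite fE mulf_eq0 negb_or => /andP[a0 b0].
by rewrite !mpoly_unitP //; exact: irr.
Qed.

(** The eliminated constant does not involve the coordinate along the line, so one condition on [z]
    removes the common zeros from the whole line through [z]. *)
Lemma elim_line (F : fieldType) n (qs : seq {mpoly F[n.+1]}) i (eta : 'I_n -> F) :
  (exists2 q, q \in qs & q != 0) ->
  (forall p, rprime p -> ~ (forall q, q \in qs -> rdvd p q)) ->
  exists2 psi : {mpoly F[n]}, psi != 0 & forall z, meval z psi != 0 -> forall s,
    exists2 q, q \in qs & meval (pt i eta z s) q != 0.
Proof.
move=> ex nocom.
have [c c0 cP] := elim_iso (@ufd_mpoly F n) (toPK i eta) (fromPK i eta) ex (fun p pp _ => nocom p pp).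
exists c => // z zc s; apply: contrapT => H; move/eqP: zc; apply.
have := cP _ (horner_eval s \o map_poly (meval z)).
rewrite /= map_polyC /horner_eval hornerC; apply => q qqs.
have := horner_lineP i eta z q s; rewrite /lineP /= => ->.
by apply: contrapT => /eqP e; apply: H; exists q.
Qed.

Lemma is_gcd1_nocommon (F : fieldType) n (qs : seq {mpoly F[n]}) :
  is_gcd qs 1 -> forall p, rprime p -> ~ (forall q, q \in qs -> rdvd p q).
Proof. by move=> [_ gcd] p [_ pn _] /gcd/rdvd1 pu; rewrite pu in pn. Qed.

Lemma poly_nonroot (F : numFieldType) (p : {poly F}) : p != 0 -> exists x, p.[x] != 0.
Proof.
move=> p0; apply: contrapT => H.
have := @max_poly_roots F p [seq i%:R | i <- iota 0 (size p)] p0.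
rewrite size_map size_iota ltnn => h; suff : false by [].
apply: h.
  apply/allP => _ /mapP[i _ ->]; apply/rootP; apply: contrapT => /eqP e.
  by apply: H; exists i%:R.
by rewrite map_inj_uniq ?iota_uniq // => i j /eqP; rewrite eqr_nat => /eqP.
Qed.

Lemma poly_eq0P (F : numFieldType) (p : {poly F}) : (forall x, p.[x] = 0) -> p = 0.
Proof.
move=> H; apply/eqP; apply: contrapT => /negP /poly_nonroot[x].
by rewrite H eqxx.
Qed.

Lemma mpoly_nonroot (F : numFieldType) n (p : {mpoly F[n]}) :
  p != 0 -> exists z, meval z p != 0.
Proof.
elim: n p => [|n IHn] p p0.
  exists (fun=> 0%R); rewrite [p]nvar0_mpolyC mevalC.
  by apply: contra_neq p0 => h; rewrite [p]nvar0_mpolyC h mpolyC0.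
have q0 : toP ord0 (fun=> 0%R) p != 0 by rewrite toP_eq0.
have [|z zl] := IHn (lead_coef (toP ord0 (fun=> 0%R) p)); first by rewrite lead_coef_eq0.
have [|s sp] := @poly_nonroot _ (lineP ord0 (fun=> 0%R) z p).
  by rewrite -size_poly_eq0 /lineP /= size_map_poly_id0 // size_poly_eq0.
by exists (pt ord0 (fun=> 0%R) z s); rewrite -horner_lineP.
Qed.

Lemma mpoly_eq0P (F : numFieldType) n (p : {mpoly F[n]}) :
  (forall z, meval z p = 0) -> p = 0.
Proof.
move=> H; apply/eqP; apply: contrapT => /negP /mpoly_nonroot[z].
by rewrite H eqxx.
Qed.

Lemma mderiv_eq0_const (F : numFieldType) n (p : {mpoly F[n]}) :
  (forall i, mderiv i p = 0) -> mconst p.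
Proof.
move=> H; rewrite /mconst; suff -> : p = (p@_0%MM)%:MP by rewrite msizeC; case: eqP.
apply/mpolyP => m; rewrite mcoeffC; have [->|m0] := eqVneq m 0%MM; first by rewrite mulr1.
rewrite mulr0; have [i mi] : exists i, m i != 0%N.
  apply: contrapT => h; move: m0 => /eqP; apply; apply/mnmP => i; rewrite mnm0E.
  by apply/eqP; apply: contrapT => /negP e; apply: h; exists i.
have := congr1 (mcoeff (m - U_(i))%MM) (H i).
rewrite mcoeff_deriv mcoeff0 submK; last by rewrite lep1mP.
by move/eqP; rewrite mulrn_eq0 /= => /eqP.
Qed.

(** * The Nullstellensatz for hypersurfaces *)

Section Nullstellensatz.
Variable F : numClosedFieldType.

(** If [f] does not divide [q], the two are coprime. In a direction in which [f] really varies, a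
    line avoiding the zeros of the eliminated constant and of the leading coefficient carries a zero
    of [f] that is not a zero of [q]. *)
Lemma rprime_nullstellensatz n (f q : {mpoly F[n]}) : rprime f ->
  (forall z, meval z f = 0 -> meval z q = 0) -> rdvd f q.
Proof.
move=> fp Z; have [f0 fn fP] := fp.
case: n f q fp Z f0 fn fP => [|n] f q fp Z f0 fn fP.
  suff : false by []; move: fn; rewrite mpoly_unitP // [f]nvar0_mpolyC /mconst msizeC.
  by case: eqP.
apply: contrapT => ndvd.
have [i di] : exists i, mderiv i f != 0.
  apply: contrapT => H; move/negP: fn; apply; rewrite mpoly_unitP //.
  apply: mderiv_eq0_const => i; apply/eqP; apply: contrapT => /negP h; apply: H; by exists i.
have sf : (1 < size (toP i (fun=> 0%R) f))%N.
  rewrite ltnNge; apply/negP => /size1_polyC fC; move: di.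
  by rewrite -(toP_eq0 i (fun=> 0%R)) -toP_deriv fC derivC eqxx.
have [||psi psi0 psiP] := @elim_line F n [:: f; q] i (fun=> 0%R).
- by exists f; rewrite ?mem_head.
- move=> p pp H; have [p0 pn pP] := pp.
  have [r rE] := H f (mem_head _ _).
  have pq : rdvd p q by apply: H; rewrite !inE eqxx orbT.
  have [|[e eE]|[e eE]] := fP p r; first by rewrite -rE; exact: rdvdxx.
    apply: ndvd; have [t ->] := pq; exists (e * t); rewrite mulrA.
    by rewrite -eE.
  move: pn; rewrite (@rdvd1 _ p) //; exists e; apply: (@mulfI _ f) => //.
  by rewrite mulr1 {1}rE eE mulrCA.
have [|z] := @mpoly_nonroot _ _ (psi * lead_coef (toP i (fun=> 0%R) f)).
  by rewrite mulf_neq0 // lead_coef_eq0 -size_poly_gt0 (leq_trans _ sf).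
rewrite mevalM mulf_eq0 negb_or => /andP[zpsi zl].
have [|s /rootP sr] := closed_rootP (lineP i (fun=> 0%R) z f) _.
  by rewrite /lineP /= size_map_poly_id0 //; case: (size _) sf => [|[]].
rewrite horner_lineP in sr.
have [r] := psiP z zpsi s.
by rewrite !inE => /orP[]/eqP->; rewrite ?(Z _ sr) ?sr eqxx.
Qed.

Lemma msqfree_neq0 n (g : {mpoly F[n.+1]}) : msqfree g -> g != 0.
Proof.
move=> sq; apply/eqP => g0.
have : mconst ('X_ord0 : {mpoly F[n.+1]}) by apply: sq; rewrite g0; exists 0; rewrite mulr0.
by rewrite /mconst msizeX mdeg1.
Qed.

Lemma rprime_nconst n (p : {mpoly F[n]}) : rprime p -> ~~ mconst p.
Proof. by move=> [p0 pn _]; rewrite -mpoly_unitP. Qed.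

(** Induction on the prime factors: square-freeness keeps [p] from dividing the product of the
    others, so it divides the remaining cofactor of [q]. *)
Lemma msqfree_nullstellensatz n (g q : {mpoly F[n.+1]}) : msqfree g ->
  (forall z, meval z g = 0 -> meval z q = 0) -> rdvd g q.
Proof.
move=> sq Z; have g0 := msqfree_neq0 sq.
have [u [s [uu sp gE]]] := ufd_mpoly g0.
suff [r rE] : rdvd (\prod_(p <- s) p) q.
  by exists (u^-1 * r); rewrite gE rE mulrACA mulrV // mul1r.
have {}Z p z : p \in s -> meval z p = 0 -> meval z q = 0.
  move=> ps zp; apply: Z; rewrite gE (perm_big _ (perm_to_rem ps)) big_cons /=.
  by rewrite mevalM mevalM zp mul0r mulr0.
have {}sq h : rdvd (h * h) (\prod_(p <- s) p) -> mconst h.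
  by move=> [r rE]; apply: sq; exists (u * r); rewrite gE rE mulrCA.
elim: s sp Z sq {gE} => [|p s IHs] sp Z sq.
  by rewrite big_nil; exists q; rewrite mul1r.
have pp : rprime p by apply: sp; rewrite mem_head.
have [r rE] : rdvd (\prod_(j <- s) j) q.
  apply: IHs => [a As|a z As|h [t tE]].
  - by apply: sp; rewrite inE As orbT.
  - by apply: Z; rewrite inE As orbT.
  - by apply: sq; exists (p * t); rewrite big_cons tE mulrCA.
have [_ _ pP] := pp.
have : rdvd p q by apply: rprime_nullstellensatz => // z; apply: Z; rewrite mem_head.
rewrite rE => /pP[[t tE]|[t tE]].
  have := rprime_nconst pp; rewrite sq //; exists t.
  by rewrite big_cons tE mulrA.
by exists t; rewrite big_cons tE mulrA [_ * p]mulrC.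
Qed.

End Nullstellensatz.

(** At most k ^ n monomials occur, so the coefficient matrix has more rows than columns and a
    nonzero left kernel. *)
Lemma lin_dep (F : fieldType) n k (T : finType) (p : T -> {mpoly F[n]}) :
  (forall t, (msize (p t) <= k)%N) -> (k ^ n < #|T|)%N ->
  exists2 l : T -> F, (exists t, l t != 0) & \sum_t l t *: p t = 0.
Proof.
move=> sz cT.
pose B : finType := 'X_{1..n < k}.
have cB : (#|B| < #|T|)%N.
  apply: leq_ltn_trans cT; rewrite -[X in (X ^ _)%N]card_ord -[X in (_ ^ X)%N]card_ord -card_ffun.
  have lt (m : B) i : (m i < k)%N.
    by apply: leq_ltn_trans (bmdeg m); rewrite mdegE (bigD1 i) //= leq_addr.
  pose e (m : B) := [ffun i => Ordinal (lt m i)].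
  apply: (@leq_card _ _ e) => m1 m2 /ffunP h; apply/val_inj/mnmP => i.
  by have := congr1 val (h i); rewrite !ffunE.
pose M := \matrix_(i < #|T|, j < #|B|) (p (enum_val i))@_(enum_val j).
have K0 : kermx M != 0.
  rewrite -mxrank_eq0 mxrank_ker -lt0n subn_gt0.
  by apply: leq_ltn_trans (rank_leq_col M) cB.
have /rowV0Pn[v vK v0] := K0.
have vM : v *m M = 0 by apply/sub_kermxP.
exists (fun t => v 0 (enum_rank t)).
  apply: contrapT => H; move/eqP: v0; apply; apply/rowP => i; rewrite mxE.
  apply/eqP; apply: contrapT => /negP h; apply: H; exists (enum_val i).
  by rewrite enum_valK.
apply/mpolyP => m; rewrite mcoeff0 raddf_sum /=.
have [mk|mk] := ltnP (mdeg m) k; last first.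
  rewrite big1 // => t _; rewrite mcoeffZ memN_msupp_eq0 ?mulr0 //.
  by apply: msize_mdeg_ge; exact: leq_trans (sz t) mk.
have := congr1 (fun u : 'rV_ _ => u 0 (enum_rank (BMultinom mk))) vM.
rewrite !mxE => h; rewrite -[RHS]h (reindex (@enum_val T predT)) /=.
  by apply: eq_bigr => i _; rewrite mcoeffZ !mxE enum_valK enum_rankK.
exists enum_rank => x _; [exact: enum_valK|exact: enum_rankK].
Qed.

Lemma msize_exp_le (F : fieldType) n (p : {mpoly F[n]}) e k :
  (msize p <= e.+1)%N -> (msize (p ^+ k) <= (k * e).+1)%N.
Proof.
move=> sp; have [->|p0] := eqVneq p 0.
  by case: k => [|k]; rewrite ?expr0 ?msize1 // expr0n /= msize0.
elim: k => [|k IHk]; first by rewrite expr0 msize1.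
by rewrite exprS msizeM ?expf_neq0 //; move: sp IHk; move: (msize _) (msize _) => a b; lia.
Qed.

Lemma msizeM_le' (F : fieldType) n (p q : {mpoly F[n]}) a b :
  (msize p <= a.+1)%N -> (msize q <= b.+1)%N -> (msize (p * q) <= (a + b).+1)%N.
Proof.
move=> sp sq; have [->|p0] := eqVneq p 0; first by rewrite mul0r msize0.
have [->|q0] := eqVneq q 0; first by rewrite mulr0 msize0.
by rewrite msizeM //; move: sp sq; move: (msize _) (msize _) => c d; lia.
Qed.

Lemma msize_prod_le (F : fieldType) n m (p : 'I_m -> {mpoly F[n]}) (a : 'I_m -> nat) :
  (forall i, msize (p i) <= (a i).+1)%N -> (msize (\prod_i p i) <= (\sum_i a i).+1)%N.
Proof.
elim: m p a => [|m IHm] p a H; first by rewrite !big_ord0 msize1.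
by rewrite !big_ord_recl; apply: msizeM_le' => //; apply: IHm => i; exact: H.
Qed.

(* Counting: the products of the a_i/a_0 with exponents < M are M^(n+1) in number, but after
   clearing denominators they live in a space of dimension O(M^n). *)
Lemma alg_dependent (F : numFieldType) n (a : 'I_n.+1 -> {mpoly F[n]}) (a0 : {mpoly F[n]}) :
  exists2 E : {mpoly F[n.+1]}, E != 0 & forall z, meval z a0 != 0 ->
    meval (fun i => meval z (a i) / meval z a0) E = 0.
Proof.
pose e := (msize a0 + \sum_i msize (a i))%N.
have ae i : (msize (a i) <= e.+1)%N by rewrite /e (bigD1 i) //=; lia.
have a0e : (msize a0 <= e.+1)%N by rewrite /e; lia.
(* After clearing denominators the products have size at most [c * M], and (c M)^n < M^(n+1) holds
   as soon as c^n < M. *)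
pose c := (n.+1 * e).+1.
pose M := (c ^ n).+1.
pose T := {ffun 'I_n.+1 -> 'I_M}.
pose K := (n.+1 * M)%N.
have sK (t : T) : (\sum_i t i <= K)%N.
  apply: (@leq_trans (\sum_(i < n.+1) M)); last by rewrite sum_nat_const card_ord.
  by apply: leq_sum => i _; exact: ltnW.
pose p (t : T) := (\prod_i a i ^+ t i) * a0 ^+ (K - \sum_i t i).
have [||l [t0 lt0] lE] := @lin_dep F n (c * M) T p.
- move=> t; have h : (msize (p t) <= (\sum_i t i * e + (K - \sum_i t i) * e).+1)%N.
    apply: msizeM_le'; last exact: msize_exp_le.
    by apply: msize_prod_le => i; exact: msize_exp_le.
  apply: leq_trans h _; rewrite -big_distrl -mulnDl /= subnKC // /K /c.
  by have : (0 < M)%N by []; move: (M) => N; nia.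
- by rewrite card_ffun !card_ord expnMn expnS ltn_pmul2r ?expn_gt0.
exists (\sum_t l t *: 'X_[[multinom (t i : nat) | i < n.+1]]).
  apply/eqP => /(congr1 (mcoeff [multinom (t0 i : nat) | i < n.+1])).
  rewrite mcoeff0 raddf_sum /= (bigD1 t0) //= mcoeffZ mcoeffX eqxx mulr1 big1.
    by rewrite addr0 => h; rewrite h eqxx in lt0.
  move=> t tt; rewrite mcoeffZ mcoeffX; case: eqP => [/mnmP h|_]; last by rewrite mulr0.
  case/eqP: tt; apply/ffunP => i; apply: val_inj.
  by have := h i; rewrite !mnmE.
move=> z z0; rewrite raddf_sum /=; apply: (@mulfI _ (meval z a0 ^+ K)).
  by rewrite expf_neq0.
rewrite mulr0 mulr_sumr -[RHS](meval0 z) -lE raddf_sum /=; apply: eq_bigr => t _.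
rewrite !mevalZ mevalX mulrCA; congr (_ * _).
rewrite /p mevalM rmorph_prod rmorphXn /=.
have -> : meval z a0 ^+ K = meval z a0 ^+ (\sum_i t i) * meval z a0 ^+ (K - \sum_i t i).
  by rewrite -exprD subnKC.
rewrite mulrAC; congr (_ * _); rewrite -prodrXr -big_split /=.
by apply: eq_bigr => i _; rewrite mnmE rmorphXn /= -exprMn mulrC divfK.
Qed.

Lemma poly_val0 (A : idomainType) (q : {poly A}) : q != 0 ->
  exists r (q1 : {poly A}), q1`_0 != 0 /\ q = q1 * 'X^r.
Proof.
move=> q0; have [r [q1 h qE]] := multiplicity_XsubC q 0.
exists r, q1; rewrite -horner_coef0; split; last by rewrite qE subr0.
by move: h; rewrite q0.
Qed.

(** * Rational maps and the images of hypersurfaces *)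

Section RationalFunctions.
Variable F : numFieldType.

Lemma mderiv_exp n (p : {mpoly F[n]}) k l z :
  meval z (mderiv l (p ^+ k)) * meval z p =
  k%:R * meval z p ^+ k * meval z (mderiv l p).
Proof.
elim: k => [|k IHk].
  by rewrite expr0 -mpolyC1 mderivC meval0 !mul0r.
rewrite exprS mderivM mevalD !mevalM rmorphXn /=; move: IHk.
set D := meval z (mderiv l (p ^+ k)); set x := meval z p; set dx := meval z _ => IHk.
transitivity (dx * x ^+ k * x + x * (D * x)); first by ring.
by rewrite IHk exprS -natr1; ring.
Qed.

(** Value and derivatives are cleared together: the second formula is the quotient rule multiplied
    out, and it lets relations between rational functions be differentiated as polynomials. *)
Lemma clear_denom n m (q : {mpoly F[n]}) (a : 'I_n -> {mpoly F[m]}) (a0 : {mpoly F[m]}) :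
  exists N (qh : {mpoly F[m]}), forall z, meval z a0 != 0 ->
    let r := fun i => meval z (a i) / meval z a0 in
    meval z qh = meval z a0 ^+ N * meval r q /\
    forall l, meval z (mderiv l qh) * meval z a0 ^+ 2 =
      N%:R * meval z a0 * meval z (mderiv l a0) * meval z qh
      + meval z a0 ^+ N * \sum_i meval r (mderiv i q) *
         (meval z (mderiv l (a i)) * meval z a0 - meval z (a i) * meval z (mderiv l a0)).
Proof.
elim/mpoly_ring_ind: q => [c|j|p q [N1 [p1 H1]] [N2 [q1 H2]]|p q [N1 [p1 H1]] [N2 [q1 H2]]].
- exists 0%N, c%:MP => z z0; rewrite /= !mevalC expr0 mul1r; split=> // l.
  rewrite mderivC meval0 !mul0r add0r mul1r big1 // => i _.
  by rewrite mderivC meval0 mul0r.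
- exists 1%N, (a j) => z z0 /=; rewrite mevalXU expr1 mulrC divfK //; split=> // l.
  rewrite (bigD1 j) //= mderivX mnm1E eqxx scale1r.
  rewrite (_ : U_(j) - U_(j) = 0)%MM; last by apply/mnmP => i; rewrite mnmBE subnn mnm0E.
  rewrite mpolyX0 meval1 big1 ?addr0 => [|i ij]; first by ring.
  by rewrite mderivX mnm1E eq_sym (negbTE ij) scale0r meval0 mul0r.
- exists (N1 + N2)%N, (a0 ^+ N2 * p1 + a0 ^+ N1 * q1) => z z0 /=.
  have [E1 D1] := H1 z z0; have [E2 D2] := H2 z z0.
  split; first by rewrite !mevalD !mevalM !rmorphXn /= E1 E2 exprD; ring.
  move=> l; have {}D1 := D1 l; have {}D2 := D2 l.
  have e1 := mderiv_exp a0 N1 l z; have e2 := mderiv_exp a0 N2 l z.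
  under eq_bigr => i _ do rewrite mderivD mevalD mulrDl.
  rewrite big_split /=; move: D1 D2; set S1 := \sum_(i < n) _; set S2 := \sum_(i < n) _.
  move=> D1 D2; rewrite !mderivD !mderivM !mevalD !mevalM !rmorphXn /=.
  move: e1 e2 D1 D2; rewrite natrD exprD.
  set x := meval z a0; set dx := meval z (mderiv l a0).
  set A := meval z (mderiv l (a0 ^+ N1)); set B := meval z (mderiv l (a0 ^+ N2)).
  set u := meval z p1; set v := meval z q1; set du := meval z (mderiv l p1).
  set dv := meval z (mderiv l q1).
  move=> e1 e2 D1 D2.
  transitivity ((B * x) * x * u + x ^+ N2 * (du * x ^+ 2) + ((A * x) * x * v + x ^+ N1 * (dv * x ^+ 2))).
    by ring.
  by rewrite e1 e2 D1 D2; ring.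
- exists (N1 + N2)%N, (p1 * q1) => z z0 /=.
  have [E1 D1] := H1 z z0; have [E2 D2] := H2 z z0.
  split; first by rewrite !mevalM E1 E2 exprD; ring.
  move=> l; have {}D1 := D1 l; have {}D2 := D2 l.
  set r := fun i => _ in E1 D1 E2 D2 *.
  under eq_bigr => i _ do rewrite mderivM mevalD !mevalM mulrDl mulrAC -[X in _ + X]mulrA.
  rewrite big_split /= -mulr_suml -mulr_sumr.
  move: D1 D2; set S1 := \sum_(i < n) _; set S2 := \sum_(i < n) _.
  move=> D1 D2; rewrite !mderivM !mevalD !mevalM natrD exprD.
  move: D1 D2; set du := meval z (mderiv l p1); set dv := meval z (mderiv l q1).
  set x := meval z a0 => D1 D2.
  transitivity (du * x ^+ 2 * meval z q1 + meval z p1 * (dv * x ^+ 2)); first by ring.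
  by rewrite D1 D2 E1 E2; ring.
Qed.

Lemma ratfun_cancel n m (q : {mpoly F[n]}) (a : 'I_n -> {mpoly F[m]}) (a0 b : {mpoly F[m]}) :
  a0 != 0 -> b != 0 ->
  (forall z, meval z a0 != 0 -> meval z b != 0 ->
     meval (fun i => meval z (a i) / meval z a0) q = 0) ->
  forall z, meval z a0 != 0 -> meval (fun i => meval z (a i) / meval z a0) q = 0.
Proof.
move=> a00 b0 H; have [N [qh qhE]] := clear_denom q a a0.
have qh0 : qh = 0.
  have : qh * (a0 * b) = 0.
    apply: mpoly_eq0P => z; rewrite !mevalM.
    have [->|z0] := eqVneq (meval z a0) 0; first by rewrite mul0r mulr0.
    have [->|zb] := eqVneq (meval z b) 0; first by rewrite !mulr0.
    by have [-> _] := qhE z z0; rewrite H // mulr0 mul0r.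
  by move/eqP; rewrite !mulf_eq0 (negbTE a00) (negbTE b0) !orbF => /eqP.
move=> z z0; have [] := qhE z z0; rewrite qh0 meval0 => /esym/eqP.
by rewrite mulf_eq0 expf_eq0 (negbTE z0) andbF => /eqP.
Qed.

Lemma ratfun_nonzero n m (q : {mpoly F[n]}) (a : 'I_n -> {mpoly F[m]}) (a0 : {mpoly F[m]}) z :
  meval z a0 != 0 -> meval (fun i => meval z (a i) / meval z a0) q != 0 ->
  exists2 qh : {mpoly F[m]}, qh != 0 & forall z, meval z a0 != 0 -> meval z qh != 0 ->
     meval (fun i => meval z (a i) / meval z a0) q != 0.
Proof.
move=> z0 zq; have [N [qh qhE]] := clear_denom q a a0; exists qh.
  apply: contra_neq zq => qh0; have [] := qhE z z0; rewrite qh0 meval0 => /esym/eqP.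
  by rewrite mulf_eq0 expf_eq0 (negbTE z0) andbF => /eqP.
move=> y y0; have [-> _] := qhE y y0; by rewrite mulf_eq0 negb_or => /andP[].
Qed.

Lemma ratfun_deriv n m (q : {mpoly F[n]}) (a : 'I_n -> {mpoly F[m]}) (a0 : {mpoly F[m]}) :
  (forall z, meval z a0 != 0 -> meval (fun i => meval z (a i) / meval z a0) q = 0) ->
  forall z l, meval z a0 != 0 ->
    \sum_i meval (fun i => meval z (a i) / meval z a0) (mderiv i q) *
      (meval z (mderiv l (a i)) * meval z a0 - meval z (a i) * meval z (mderiv l a0)) = 0.
Proof.
move=> H; have [a00 z l|a00] := eqVneq a0 0; first by rewrite a00 meval0 eqxx.
have [N [qh qhE]] := clear_denom q a a0.
have qh0 : qh = 0.
  have : qh * a0 = 0.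
    apply: mpoly_eq0P => z; rewrite !mevalM.
    have [->|z0] := eqVneq (meval z a0) 0; first by rewrite mulr0.
    by have [-> _] := qhE z z0; rewrite H // mulr0 mul0r.
  by move/eqP; rewrite !mulf_eq0 (negbTE a00) !orbF => /eqP.
move=> z l z0; have [_ /(_ l)] := qhE z z0; rewrite qh0 mderiv0 meval0 mul0r mulr0 add0r.
by move/esym/eqP; rewrite mulf_eq0 expf_eq0 (negbTE z0) andbF => /eqP.
Qed.

(** Adjoin the value of [b] as an extra coordinate: n + 1 functions of n variables satisfy a
    relation. Divided by the highest possible power of that coordinate, the relation still holds by
    density, and it stays nontrivial at b = 0. *)
Lemma thin_image n (a : 'I_n -> {mpoly F[n]}) (a0 b : {mpoly F[n]}) : b != 0 ->
  exists2 E : {mpoly F[n]}, E != 0 & forall z, meval z a0 != 0 -> meval z b = 0 ->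
    meval (fun i => meval z (a i) / meval z a0) E = 0.
Proof.
move=> b0; have [a00|a00] := eqVneq a0 0.
  by exists 1; [exact: oner_neq0|move=> z; rewrite a00 meval0 eqxx].
pose a' (j : 'I_n.+1) := if unlift ord0 j is Some j' then a j' else b * a0.
have [E E0 EP] := alg_dependent a' a0.
pose q := toP ord0 (fun=> 0) E.
have q0 : q != 0 by rewrite toP_eq0.
have [r [q1 [q10 qE]]] := poly_val0 q0.
have ptE z : meval z a0 != 0 -> (fun j => meval z (a' j) / meval z a0) =1
    pt ord0 (fun=> 0) (fun i => meval z (a i) / meval z a0) (meval z b).
  move=> z0 j; rewrite /a' /pt; case: unliftP => [k|] _; first by rewrite mul0r addr0.
  by rewrite mevalM mulfK.
have H z : meval z a0 != 0 -> meval z b != 0 ->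
    meval (fun j => meval z (a' j) / meval z a0) (fromP ord0 (fun=> 0) q1) = 0.
  move=> z0 zb; have := EP z z0; rewrite !(meval_eq _ (ptE z z0)) -!horner_lineP.
  rewrite /lineP /= -/q qE rmorphM rmorphXn /= map_polyX !hornerE fromPK => /eqP.
  by rewrite mulf_eq0 expf_eq0 (negbTE zb) andbF orbF => /eqP.
exists q1`_0 => // z z0 zb; have := ratfun_cancel a00 b0 H z0.
rewrite (meval_eq _ (ptE z z0)) -horner_lineP /lineP /= fromPK zb.
by rewrite horner_coef0 coef_map.
Qed.

End RationalFunctions.

(** * Polynomials in one variable *)

Lemma I3P (P : 'I_3 -> Prop) : P 0 -> P 1 -> P 2 -> forall i, P i.
Proof.
move=> P0 P1 P2 [[|[|[|//]]] hi].
- by rewrite (_ : Ordinal hi = 0) //; exact: val_inj.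
- by rewrite (_ : Ordinal hi = 1) //; exact: val_inj.
- by rewrite (_ : Ordinal hi = 2) //; exact: val_inj.
Qed.

Lemma sum3E (A : nmodType) (f : 'I_3 -> A) : \sum_i f i = f 0 + f 1 + f 2.
Proof.
rewrite !big_ord_recl big_ord0 addr0 addrA; congr (f _ + f _ + f _); exact: val_inj.
Qed.

Lemma crossE (A : comPzRingType) (a b : 'I_3 -> A) :
  [/\ cross a b 0 = a 1 * b 2 - a 2 * b 1,
      cross a b 1 = a 2 * b 0 - a 0 * b 2
    & cross a b 2 = a 0 * b 1 - a 1 * b 0].
Proof.
have s10 : s1 0 = 1 by apply: val_inj; rewrite /s1 /= inordK.
have s11 : s1 1 = 2 by apply: val_inj; rewrite /s1 /= inordK.
have s12 : s1 2 = 0 by apply: val_inj; rewrite /s1 /= inordK.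
have s20 : s2 0 = 2 by apply: val_inj; rewrite /s2 /= inordK.
have s21 : s2 1 = 0 by apply: val_inj; rewrite /s2 /= inordK.
have s22 : s2 2 = 1 by apply: val_inj; rewrite /s2 /= inordK.
by rewrite /cross s10 s11 s12 s20 s21 s22.
Qed.

Lemma cross0_parallel (F : fieldType) (a b : 'I_3 -> F) j : a j != 0 ->
  (forall i, cross a b i = 0) -> forall i, b i = b j / a j * a i.
Proof.
move=> aj H; have [] := crossE a b; rewrite !H.
move=> /esym/eqP; rewrite subr_eq0 => /eqP e0 /esym/eqP; rewrite subr_eq0 => /eqP e1.
move=> /esym/eqP; rewrite subr_eq0 => /eqP e2 i.
suff e : b i * a j = b j * a i by rewrite mulrAC -e mulfK.
clear aj H; move: i j.
by apply: I3P; apply: I3P => //; rewrite mulrC [RHS]mulrC //; exact: esym.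
Qed.

Section Univariate.
Variable F : numClosedFieldType.
Implicit Types p x y : {poly F}.

Lemma simple_roots p : p != 0 -> (forall s, root p s -> ~~ root p^`() s) ->
  exists rs, [/\ uniq rs, size rs = (size p).-1 & forall s, (s \in rs) = root p s].
Proof.
move=> p0 simple; have [rs pE] := closed_field_poly_normal p.
have lp : lead_coef p != 0 by rewrite lead_coef_eq0.
have rE s : (s \in rs) = root p s by rewrite pE rootZ // root_prod_XsubC.
exists rs; split=> //; last by rewrite [in RHS]pE size_scale // size_prod_XsubC.
apply: count_mem_uniq => s; have [srs|srs] := boolP (s \in rs); last first.
  by apply/count_memPn.
have := simple s; rewrite -rE srs => /(_ isT) h.
have : (0 < count_mem s rs)%N by rewrite -has_count has_pred1.
case E: (count_mem s rs) => [|[|k]] //= _; case/negP: h.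
have : ('X - s%:P) ^+ 2 %| p.
  by rewrite -mup_geq // pE -mul_polyC mupMr ?rootC // mu_prod_XsubC E.
case/dvdpP => q ->; rewrite /root derivM deriv_exp derivXsubC mul1r.
by rewrite !hornerE /= subrr expr1 add0r subrr !mulr0 addr0.
Qed.

(** The difference [d] of the two sides satisfies the same equation and vanishes at [s0]. If it were
    nonzero, of order r + 1 there, then d' y - d y' would have order exactly r, by characteristic
    zero and y(s0) != 0. *)
Lemma wronskian0 x y s0 : y.[s0] != 0 -> x^`() * y = x * y^`() ->
  x = (x.[s0] / y.[s0]) *: y.
Proof.
move=> ys; set c := _ / _ => W.
pose d := x - c *: y.
have dW : d^`() * y = d * y^`().
  by rewrite /d derivB derivZ !mulrBl W -!scalerAl [y^`() * y]mulrC.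
have d0 : d.[s0] = 0 by rewrite /d !hornerE /c divfK ?subrr.
suff : d = 0 by move/eqP; rewrite subr_eq0 => /eqP.
apply/eqP; apply: contrapT => /negP dn0.
have [r [q rq dE]] := multiplicity_XsubC d s0.
rewrite dn0 /= in rq.
case: r dE => [|r] dE.
  by move: rq; rewrite /root; move: d0; rewrite dE expr0 mulr1 => ->; rewrite eqxx.
have : ('X - s0%:P) ^+ r * ((q^`() * y - q * y^`()) * ('X - s0%:P) + (q * y) *+ r.+1) = 0.
  move/eqP: dW; rewrite -subr_eq0 dE derivM deriv_exp derivXsubC mul1r => /eqP <-.
  by rewrite exprS /= -mulr_natr; set u := 'X - _; rewrite -[RHS]mulr1; ring.
move/eqP; rewrite mulf_eq0 expf_eq0 polyXsubC_eq0 andbF /= => /eqP/(congr1 (horner^~ s0)).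
rewrite !hornerE subrr mulr0 add0r hornerMn hornerM => /eqP.
by rewrite mulrn_eq0 /= mulf_eq0 (negbTE ys) orbF; move: rq; rewrite /root => /negbTE ->.
Qed.

(** A double root at s is a zero of the Wronskian x' y - x y'; this leaves finitely many s, each
    excluded by one condition on d ^ 2. If the Wronskian is identically zero, [x] and [y] are
    constant. The factor [e1] keeps the leading coefficient alive. *)
Lemma pencil_simple x y : (forall s, ~ (root x s /\ root y s)) ->
  exists2 e : {poly F}, e != 0 & forall d, e.[d] != 0 ->
    let p := x - d ^+ 2 *: y in
    [/\ p != 0, size p = maxn (size x) (size y) &
        forall s, root p s -> ~~ root p^`() s].
Proof.
move=> nc.
have combE (a b d : F) : (a%:P - b *: 'X^2).[d] = a - d ^+ 2 * b.
  by rewrite hornerD hornerN hornerC hornerZ hornerXn mulrC.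
have comb_neq0 (a b : F) : (a != 0) || (b != 0) -> a%:P - b *: 'X^2 != 0.
  apply: contraTneq => h; have := combE a b 0; have := combE a b 1.
  rewrite h !horner0 expr0n mul0r subr0 => + a0; rewrite -a0 expr1n mul1r sub0r => /eqP.
  by rewrite eq_sym oppr_eq0 eqxx /= => /eqP ->; rewrite eqxx.
pose m := maxn (size x) (size y).
have xy : (x != 0) || (y != 0).
  apply/orP; apply: contrapT => h; apply: (nc 0); rewrite /root.
  have [x0 y0] : x = 0 /\ y = 0 by split; apply/eqP; apply: contrapT => /negP e; apply: h; tauto.
  by rewrite x0 y0 !horner0 eqxx.
pose e1 := (x`_m.-1)%:P - (y`_m.-1) *: 'X^2.
have e10 : e1 != 0.
  apply: comb_neq0; rewrite /m /maxn; case: ltnP => h.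
    by rewrite -[y`_(size y).-1]/(lead_coef y) lead_coef_eq0 -[y == 0]negbK -size_poly_gt0 (leq_ltn_trans _ h) ?orbT.
  rewrite -[x`_(size x).-1]/(lead_coef x) lead_coef_eq0; apply/orP; left.
  case/orP: xy => // y0; rewrite -size_poly_gt0 (leq_trans _ h) //.
  by rewrite size_poly_gt0.
have sizeE d : e1.[d] != 0 -> let p := x - d ^+ 2 *: y in p != 0 /\ size p = m.
  rewrite combE /= => ed.
  have cE : (x - d ^+ 2 *: y)`_m.-1 = x`_m.-1 - d ^+ 2 * y`_m.-1 by rewrite coefB coefZ.
  have m0 : (0 < m)%N.
    by rewrite /m leq_max !size_poly_gt0.
  have p0 : x - d ^+ 2 *: y != 0.
    by apply: contra_neq ed => h; rewrite -cE h coef0.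
  split=> //; apply/eqP; rewrite eqn_leq; apply/andP; split.
    apply: leq_trans (size_polyD _ _) _; rewrite size_polyN geq_max leq_maxl /=.
    by apply: leq_trans (size_scale_leq _ _) _; rewrite leq_maxr.
  by rewrite -(prednK m0) ltnNge; apply: contra ed => h; rewrite -cE nth_default.
pose w := x^`() * y - x * y^`().
have [w0|w0] := eqVneq w 0.
  have cst (u v : {poly F}) : (forall s, ~ (root u s /\ root v s)) -> u^`() * v = u * v^`() ->
      (size v <= 1)%N.
    move=> nuv W; rewrite leqNgt; apply/negP => sv.
    have [|s rs] := closed_rootP v _; first by case: (size v) sv => [|[]].
    have us : u.[s] != 0 by apply/negP => /eqP us; apply: (nuv s); split=> //; apply/rootP.
    have W' : v^`() * u = v * u^`() by rewrite mulrC -W mulrC.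
    have := wronskian0 us W'; move/rootP: rs => ->; rewrite mul0r scale0r => v0.
    by rewrite v0 size_poly0 in sv.
  have W : x^`() * y = x * y^`() by apply/eqP; rewrite -subr_eq0; apply/eqP.
  have sy := cst _ _ nc W.
  have sx : (size x <= 1)%N.
    by apply: (cst y x); [move=> s [? ?]; exact: (nc s)|rewrite mulrC -W mulrC].
  exists e1 => // d ed /=; have [p0 sp] := sizeE d ed; split=> //.
  have : (size (x - d ^+ 2 *: y)%R <= 1)%N by rewrite sp geq_max sx.
  move=> /size1_polyC pC s; rewrite pC rootC => /eqP c0; move: p0.
  by rewrite pC c0 eqxx.
have [rs wE] := closed_field_poly_normal w.
exists (e1 * \prod_(s <- rs) ((x.[s])%:P - (y.[s]) *: 'X^2)).
  rewrite mulf_neq0 // prodf_seq_neq0; apply/allP => s _; rewrite comb_neq0 //.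
  apply/orP; apply: contrapT => h; apply: (nc s).
  by split; apply/rootP/eqP; apply: contrapT => /negP e; apply: h; tauto.
move=> d; rewrite hornerM mulf_eq0 negb_or => /andP[ed er] /=.
have [p0 sp] := sizeE d ed; split=> // s /rootP ps; apply/negP => /rootP ps'.
move: ps ps'; rewrite derivB derivZ !hornerE => /eqP; rewrite subr_eq0 => /eqP xs /eqP.
rewrite subr_eq0 => /eqP xs'.
have ws : s \in rs.
  have lw : lead_coef w != 0 by rewrite lead_coef_eq0.
  rewrite -root_prod_XsubC -(@rootZ _ _ (lead_coef w)) // -wE /root !hornerE xs xs'.
  by apply/eqP; ring.
case/negP: er; rewrite horner_prod prodf_seq_eq0; apply/hasP; exists s => //=.
by rewrite combE xs subrr.
Qed.

End Univariate.

Section Thin.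
Variable F : numClosedFieldType.

Lemma meval_map_mpolyC n (v : {poly F}) (q : {mpoly F[n]}) z :
  meval z (map_poly (@mpolyC n F) v).[q] = v.[meval z q].
Proof.
elim/poly_ind: v => [|v c IHv]; first by rewrite rmorph0 !horner0 meval0.
by rewrite rmorphD rmorphM /= map_polyX map_polyC !hornerE mevalD mevalM IHv /= mevalC.
Qed.

Lemma thin_curve (v : 'I_3 -> {poly F}) :
  exists2 E : {mpoly F[3]}, E != 0 &
    forall c s, meval (fun i => c * (v i).[s]) E = 0.
Proof.
pose a i : {mpoly F[3]} := 'X_0 * (map_poly (@mpolyC 3 F) (v i)).['X_1].
(* The cone has only the two parameters (c, s); an idle third variable, set to zero, presents it as
   the image of a plane. *)
have [|E E0 EP] := @thin_image F 3 a 1 'X_2.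
  by rewrite -msize_poly_eq0 msizeX mdeg1.
exists E => // c s; have := EP (vec3 c s 0); rewrite meval1 oner_neq0 mevalXU /= => /(_ isT erefl).
move=> <-; apply: meval_eq => i.
by rewrite /a mevalM mevalXU meval_map_mpolyC mevalXU divr1.
Qed.

Lemma linform_neq0 n (v : 'I_n -> F) i : v i != 0 -> \sum_j v j *: 'X_j != 0 :> {mpoly F[n]}.
Proof.
move=> vi; apply/eqP => /(congr1 (mcoeff U_(i)%MM)); rewrite mcoeff0 raddf_sum /=.
rewrite (bigD1 i) //= mcoeffZ mcoeffX eqxx mulr1 big1 ?addr0 => [h|j ji].
  by rewrite h eqxx in vi.
by rewrite mcoeffZ mcoeffX eq_mnm1 (negbTE ji) mulr0.
Qed.

Lemma meval_linform n (v k : 'I_n -> F) :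
  meval k (\sum_j v j *: 'X_j) = \sum_j v j * k j.
Proof. by rewrite raddf_sum /=; apply: eq_bigr => j _; rewrite mevalZ mevalXU. Qed.

Lemma cross_cross0 (V W k : 'I_3 -> F) : \sum_i k i * V i = 0 -> \sum_i k i * W i = 0 ->
  forall i, cross (cross V W) k i = 0.
Proof.
rewrite !sum3E => e1 e2.
have [c0 c1 c2] := crossE V W; have [d0 d1 d2] := crossE (cross V W) k.
have aux i : cross (cross V W) k i =
    W i * (k 0 * V 0 + k 1 * V 1 + k 2 * V 2) - V i * (k 0 * W 0 + k 1 * W 1 + k 2 * W 2).
  by move: i; apply: I3P; rewrite ?d0 ?d1 ?d2 ?c0 ?c1 ?c2; ring.
by move=> i; rewrite aux e1 e2 !mulr0 subrr.
Qed.

(** A double root at s makes k orthogonal to V(s) and V'(s), hence parallel to their cross product: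
    a cone over a curve. The finitely many s where a chosen component of the product vanishes
    exclude only the planes k.V(s) = 0. *)
Lemma net_simple (V : 'I_3 -> {poly F}) : (forall s, exists i, (V i).[s] != 0) ->
  exists2 E : {mpoly F[3]}, E != 0 & forall k, meval k E != 0 ->
    let p := \sum_i k i *: V i in
    p != 0 /\ forall s, root p s -> ~~ root p^`() s.
Proof.
move=> nc.
pose V' i := (V i)^`().
have pE (k : 'I_3 -> F) s : (\sum_i k i *: V i).[s] = \sum_i k i * (V i).[s].
  by rewrite horner_sum; apply: eq_bigr => i _; rewrite hornerZ.
have pE' (k : 'I_3 -> F) s : (\sum_i k i *: V i)^`().[s] = \sum_i k i * (V' i).[s].
  rewrite raddf_sum horner_sum; apply: eq_bigr => i _; by rewrite /= derivZ hornerZ.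
have [w0|] := pselect (forall i, cross V V' i = 0).
  have W i j : (V i)^`() * V j = V i * (V j)^`().
    have [] := crossE V V'; rewrite !w0 /V' => /esym/eqP; rewrite subr_eq0 => /eqP e0.
    move=> /esym/eqP; rewrite subr_eq0 => /eqP e1 /esym/eqP; rewrite subr_eq0 => /eqP e2.
    rewrite mulrC; move: j i; by apply: I3P; apply: I3P => //; exact: esym.
  have cst j : (size (V j) <= 1)%N.
    rewrite leqNgt; apply/negP => sv.
    have [|s /rootP rs] := closed_rootP (V j) _; first by case: (size _) sv => [|[]].
    have [i vi] := nc s; have := wronskian0 vi (W j i).
    by rewrite rs mul0r scale0r => v0; rewrite v0 size_poly0 in sv.
  have [i vi] := nc 0.
  exists (\sum_j (V j).[0] *: 'X_j); first exact: linform_neq0 vi.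
  move=> k; rewrite meval_linform => kE /=.
  have p1 s : (\sum_i k i *: V i).[s] != 0.
    rewrite pE; apply: contra_neq kE => h; apply: eq_trans h; apply: eq_bigr => j _.
    by rewrite mulrC (size1_polyC (cst j)) !hornerC.
  split; first by apply/eqP => h; have := p1 0; rewrite h horner0 eqxx.
  by move=> s /rootP h; have := p1 s; rewrite h eqxx.
move=> /existsNP[i /eqP wi].
have [rs wE] := closed_field_poly_normal (cross V V' i).
have [E E0 EP] := thin_curve (cross V V').
exists (E * \prod_(s <- rs) \sum_j (V j).[s] *: 'X_j).
  rewrite mulf_neq0 // prodf_seq_neq0; apply/allP => s _ /=.
  by have [j vj] := nc s; exact: linform_neq0 vj.
move=> k; rewrite mevalM mulf_eq0 negb_or => /andP[kE kL] /=.
have key s : ~ ((\sum_i k i *: V i).[s] = 0 /\ (\sum_i k i *: V i)^`().[s] = 0).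
  rewrite pE pE' => -[e1 e2].
  have [srs|srs] := boolP (s \in rs).
    case/negP: kL; rewrite rmorph_prod prodf_seq_eq0; apply/hasP; exists s => //=.
    rewrite meval_linform; apply/eqP; rewrite -[RHS]e1; apply: eq_bigr => j _.
    by rewrite mulrC.
  have wis : (cross V V' i).[s] != 0.
    apply: contra srs => h; rewrite -root_prod_XsubC.
    rewrite -(@rootZ _ _ (lead_coef (cross V V' i))) ?lead_coef_eq0 // -wE.
    by rewrite /root.
  have cE j : (cross V V' j).[s] = cross (fun i => (V i).[s]) (fun i => (V' i).[s]) j.
    by rewrite /cross !hornerE.
  have par := cross_cross0 e1 e2.
  case/eqP: kE; rewrite -[RHS](EP (k i / (cross V V' i).[s]) s); apply: meval_eq => j.
  rewrite !cE; apply: cross0_parallel => //.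
  by rewrite -cE.
split; first by apply/eqP => h; apply: (key 0); rewrite h deriv0 !horner0.
by move=> s /rootP h1; apply/negP => /rootP h2; apply: (key s).
Qed.

Definition pnt (ups eta s t : F) : 'I_3 -> F := vec3 s t (ups + eta * t).

(** The zeros of [h] in the plane form a curve; with the scalar [c] they form a surface in (c, s,
    t)-space, to which [thin_image] applies. *)
Lemma thin_cone (N : 'I_3 -> {mpoly F[3]}) (h : {mpoly F[3]}) (ups eta : F) s0 t0 :
  meval (pnt ups eta s0 t0) h != 0 ->
  exists2 E : {mpoly F[3]}, E != 0 & forall c s t, meval (pnt ups eta s t) h = 0 ->
    meval (fun i => c * meval (pnt ups eta s t) (N i)) E = 0.
Proof.
move=> h0.
pose tp : 3.-tuple {mpoly F[3]} := [tuple 'X_1; 'X_2; ups%:MP + eta *: 'X_2].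
have tpE (q : {mpoly F[3]}) z : meval z (q \mPo tp) = meval (pnt ups eta (z 1) (z 2)) q.
  rewrite comp_mpoly_meval; apply: meval_eq; apply: I3P.
  - by rewrite /tp (tnth_nth 0) /= mevalXU.
  - by rewrite /tp (tnth_nth 0) /= mevalXU.
  - by rewrite /tp (tnth_nth 0) /= mevalD mevalC mevalZ mevalXU.
have [|E E0 EP] := @thin_image F 3 (fun i => 'X_0 * (N i \mPo tp)) 1 (h \mPo tp).
  by apply: contra_neq h0 => h0; have := tpE h (vec3 0 s0 t0); rewrite h0 meval0.
exists E => // c s t hz; have := EP (vec3 c s t); rewrite meval1 oner_neq0 tpE => /(_ isT hz).
by move=> <-; apply: meval_eq => i; rewrite mevalM mevalXU tpE divr1.
Qed.

End Thin.

(** * Multiplicities of a polynomial in two variables *)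

Section Swap.
Variable F : numClosedFieldType.
Implicit Types (f g : {poly {poly F}}) (r e : {poly F}).

Lemma mup_simple (p : {poly F}) x : p != 0 -> root p x -> ~~ root p^`() x -> mup x p = 1%N.
Proof.
move=> p0 rx nr; apply/eqP; rewrite eqn_leq mup_leq // mup_geq // expr1.
rewrite dvdp_XsubCl rx andbT; apply: contra nr => /dvdpP[q ->].
rewrite /root derivM deriv_exp derivXsubC mul1r !hornerE /= subrr expr1 add0r subrr.
by rewrite !mulr0 addr0.
Qed.

Lemma rprime_nocommon (A : idomainType) (f q : A) : rprime f -> ~ rdvd f q ->
  forall p, rprime p -> ~ (forall x, x \in [:: f; q] -> rdvd p x).
Proof.
move=> [f0 fn fP] ndvd p [p0 pn pP] H.
have [r rE] := H f (mem_head _ _).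
have pq : rdvd p q by apply: H; rewrite !inE eqxx orbT.
have [|[e eE]|[e eE]] := fP p r; first by rewrite -rE; exact: rdvdxx.
  by apply: ndvd; have [t ->] := pq; exists (e * t); rewrite mulrA -eE.
move: pn; rewrite (@rdvd1 _ p) //; exists e; apply: (@mulfI _ f) => //.
by rewrite mulr1 {1}rE eE mulrCA.
Qed.

Lemma deriv0_size (A : idomainType) (f : {poly A}) : (forall n, n.+1%:R != 0 :> A) ->
  f^`() = 0 -> (size f <= 1)%N.
Proof.
move=> char0 f0; rewrite leqNgt; apply/negP => s1.
have : lead_coef f != 0 by rewrite lead_coef_eq0 -size_poly_gt0 (leq_trans _ s1).
have := congr1 (fun p : {poly A} => p`_(size f).-2) f0.
rewrite coef_deriv coef0 -mulr_natr; have -> : (size f).-2.+1 = (size f).-1.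
  by case: (size f) s1 => [|[]].
rewrite -[f`_ _]/(lead_coef f) => /eqP; rewrite mulf_eq0 => /orP[-> //|].
by case: (size f) s1 => [|[|k]] //= _; rewrite (negbTE (char0 k)).
Qed.

Definition evin (t : F) f : {poly F} := map_poly (horner_eval t) f.

HB.instance Definition _ t := GRing.RMorphism.copy (evin t) (map_poly (horner_eval t)).

Lemma horner_evin t f d : (evin t f).[d] = f.[d%:P].[t].
Proof.
elim/poly_ind: f => [|f c IHf]; first by rewrite rmorph0 !horner0.
by rewrite rmorphD rmorphM /= /evin map_polyX map_polyC !hornerE /= IHf.
Qed.

Lemma deriv_evin t f : (evin t f)^`() = evin t f^`().
Proof. by rewrite /evin deriv_map. Qed.

Lemma deriv_horner f d : (f.[d%:P])^`() = (map_poly (@deriv F) f).[d%:P].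
Proof.
elim/poly_ind: f => [|f c IHf]; first by rewrite raddf0 !horner0 deriv0.
rewrite [map_poly _ _]raddfD /= !hornerE derivD derivM derivC mulr0 addr0 IHf.
congr (_ + _).
  rewrite (_ : map_poly (@deriv F) (f * 'X) = map_poly (@deriv F) f * 'X) ?hornerE //.
  by apply/polyP => i; rewrite coef_map_id0 ?deriv0 // !coefMX coef_map_id0 ?deriv0 //; case: eqP => // _; rewrite deriv0.
by rewrite map_polyC /= hornerC.
Qed.

(** The outer variable is d, the inner one t. The exceptional sets for t and for d are chosen
    independently, so that d can be general while t runs over all roots outside a finite set fixed
    beforehand. *)
Definition balanced f := exists r e, [/\ r != 0, e != 0 & forall d t,
  r.[t] != 0 -> e.[d] != 0 ->
  [/\ evin t f != 0, f.[d%:P] != 0 & mup d (evin t f) = mup t f.[d%:P]]].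

Lemma balancedM f g : balanced f -> balanced g -> balanced (f * g).
Proof.
move=> [r1 [e1 [r10 e10 H1]]] [r2 [e2 [r20 e20 H2]]].
exists (r1 * r2), (e1 * e2); rewrite !mulf_neq0 //; split=> // d t.
rewrite !hornerM !mulf_eq0 !negb_or => /andP[t1 t2] /andP[d1 d2].
have [a1 b1 m1] := H1 d t t1 d1; have [a2 b2 m2] := H2 d t t2 d2.
by rewrite rmorphM /= b1 b2 !mulf_neq0 // !mupM // m1 m2.
Qed.

Lemma balancedC r : r != 0 -> balanced r%:P.
Proof.
move=> r0; exists r, 1; rewrite oner_neq0; split=> // d t rt _.
rewrite /evin map_polyC /= hornerC; split=> //; first by rewrite polyC_eq0.
by rewrite !mupNroot ?rootC.
Qed.

(** Elimination against [f] shows that, outside finitely many t, neither partial derivative vanishes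
    at a zero of [f]; both multiplicities are then 1. Primes free of d or of t are treated apart. *)
Lemma balanced_prime f : rprime f -> balanced f.
Proof.
move=> fp; have [f0 fn fP] := fp.
have [/size1_polyC fC|sf] := leqP (size f) 1.
  by rewrite fC; apply: balancedC; rewrite -polyC_eq0 -fC.
pose fs := swapXY f; have fs0 : fs != 0 by rewrite swapXY_eq0.
pose ft : {poly {poly F}} := map_poly (@deriv F) f.
have ftE : swapXY ft = fs^`().
  apply/polyP => i; apply/polyP => j; rewrite coef_swapXY coef_map_id0 ?deriv0 //.
  by rewrite coef_deriv coef_deriv coefMn coef_swapXY.
have elim q : ~ rdvd f q -> exists2 c : {poly F}, c != 0 & forall d t,
    f.[d%:P].[t] = 0 -> q.[d%:P].[t] = 0 -> c.[t] = 0.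
  move=> nd; have [|c c0 cP] := @elim_iso {poly F} {poly {poly F}} idfun idfun [:: f; q]
     (ufd_poly (@ufd_field F)) (fun _ => erefl) (fun _ => erefl) _ (fun p pp _ => rprime_nocommon fp nd pp).
    by exists f; rewrite ?mem_head.
  exists c => // d t z1 z2.
  have := cP _ (horner_eval t \o horner_eval d%:P); rewrite /= /horner_eval hornerC; apply=> x.
  by rewrite !inE => /orP[]/eqP->.
have char0 n : n.+1%:R != 0 :> {poly F} by rewrite -polyC_natr polyC_eq0 pnatr_eq0.
have [ft0|ft0] := eqVneq ft 0.
  have fsC : (size fs <= 1)%N.
    by apply: deriv0_size; rewrite ?char0 // -ftE ft0 raddf0.
  pose p0 := fs`_0; have fE : f = map_poly polyC p0.
    by rewrite -[f]swapXYK -/fs (size1_polyC fsC) swapXY_polyC.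
  have p00 : p0 != 0 by apply: contra_neq fs0 => h; rewrite (size1_polyC fsC) -/p0 h.
  exists 1, p0; rewrite oner_neq0; split=> // d t _ dp.
  have e1 : evin t f = p0.
    rewrite fE /evin -map_poly_comp_id0 ?horner0 //=; last by rewrite /horner_eval horner0.
    by rewrite map_poly_id // => x _ /=; rewrite /horner_eval hornerC.
  have e2 : f.[d%:P] = (p0.[d])%:P by rewrite fE horner_map.
  by rewrite e1 e2 polyC_eq0; split=> //; rewrite !mupNroot ?rootC.
have nd1 : ~ rdvd f f^`().
  move=> [h hE]; have h0 : h != 0.
    apply/eqP => h0; move: hE; rewrite h0 mulr0 => /(deriv0_size char0).
    by rewrite leqNgt sf.
  have := lt_size_deriv f0; rewrite hE size_mul //.
  by rewrite -size_poly_gt0 in h0; move: h0; lia.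
have nd2 : ~ rdvd f ft.
  move=> [h hE]; have := congr1 swapXY hE; rewrite ftE rmorphM /= -/fs => hE'.
  have h0 : swapXY h != 0.
    by rewrite swapXY_eq0; apply: contra_neq ft0 => h0; rewrite hE h0 mulr0.
  have := lt_size_deriv fs0; rewrite hE' size_mul //.
  move: h0; rewrite -size_poly_gt0.
  by set a := size (swapXY h); set b := size fs; move: a b => a b; lia.
have [c1 c10 c1P] := elim _ nd1; have [c2 c20 c2P] := elim _ nd2.
exists (c1 * c2 * lead_coef f), (lead_coef fs); split.
- by rewrite !mulf_neq0 ?lead_coef_eq0.
- by rewrite lead_coef_eq0.
move=> d t; rewrite !hornerM !mulf_eq0 !negb_or -andbA => /and3P[t1 t2 tl] dl.
have a0 : evin t f != 0.
  by rewrite -size_poly_eq0 /evin size_map_poly_id0 // size_poly_eq0.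
have b0 : f.[d%:P] != 0.
  by rewrite horner_polyC -/(evin d fs) -size_poly_eq0 /evin size_map_poly_id0 // size_poly_eq0.
split=> //; have [z|z] := eqVneq f.[d%:P].[t] 0; last first.
  by rewrite !mupNroot // /root ?horner_evin.
rewrite !mup_simple //; rewrite /root ?horner_evin ?z //.
  by rewrite deriv_horner; apply: contra t2 => /eqP h; rewrite (c2P d t).
by rewrite deriv_evin horner_evin; apply: contra t1 => /eqP h; rewrite (c1P d t).
Qed.

Lemma balanced_all f : f != 0 -> balanced f.
Proof.
move=> f0; have [u [s [uu sp ->]]] := ufd_poly (ufd_poly (@ufd_field F)) f0.
apply: balancedM.
  move: uu; rewrite poly_unitE => /andP[/eqP su uu].
  rewrite (size1_polyC (p := u)) ?su //; apply: balancedC.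
  by apply: contraTneq uu => ->; rewrite unitr0.
elim: s sp => [|p s IHs] sp; first by rewrite big_nil; apply: balancedC; exact: oner_neq0.
rewrite big_cons; apply: balancedM; first by apply: balanced_prime; apply: sp; rewrite mem_head.
by apply: IHs => q qs; apply: sp; rewrite inE qs orbT.
Qed.

End Swap.

(** * Sylvester determinants with prescribed degrees *)

Section Sylvester.

(** The format is fixed by [dp] and [dq] instead of the actual degrees: specializing the
    coefficients can lower these, while the specialized resultant keeps the old format. *)
Definition sylv (A : nzRingType) (dp dq : nat) (p q : {poly A}) : 'M[A]_(dq + dp) :=
  col_mx (lin1_mx (poly_rV \o p \o* rVpoly)) (lin1_mx (poly_rV \o q \o* rVpoly)).

Lemma resultant_morph (A B : comNzRingType) (phi : {rmorphism A -> B}) (p q : {poly A}) :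
  phi (resultant p q) =
  \det (sylv (size p).-1 (size q).-1 (map_poly phi p) (map_poly phi q)).
Proof.
rewrite /resultant /Sylvester_mx -det_map_mx map_col_mx; congr (\det (col_mx _ _));
  by apply: map_lin1_mx => v; rewrite map_poly_rV rmorphM /= map_rVpoly.
Qed.

(** [p] may have dropped below its formal degree, [q] has its full degree: a kernel vector gives u p
    + v q = 0, so [q] divides u, whose size is too small. *)
Lemma sylv_neq0 (F : fieldType) dp (p q : {poly F}) : p != 0 -> q != 0 ->
  (size p <= dp.+1)%N -> coprimep p q -> \det (sylv dp (size q).-1 p q) != 0.
Proof.
move=> p0 q0 sp cop; apply/det0P => -[uv uv0].
do [rewrite -[uv]hsubmxK -{1}row_mx0 mul_row_col !mul_rV_lin1 /=] in uv0 *.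
set u := rVpoly _; set v := rVpoly _.
have su : (size u <= (size q).-1)%N by exact: size_poly.
have sv : (size v <= dp)%N by exact: size_poly.
have sq : (0 < size q)%N by rewrite size_poly_gt0.
move/(congr1 rVpoly); rewrite -linearD linear0 poly_rV_K; last first.
  rewrite (leq_trans (size_polyD _ _)) // geq_max.
  rewrite !(leq_trans (size_polyMleq _ _)) //.
  - by move: sv sq; case: (size q) => // k; rewrite addnS /= addnC leq_add2l.
  - by move: sp su; case: (size p) => [|k]; rewrite ?addn0 ?addnS /=; [move=> _ su; rewrite (leq_trans (leq_pred _)) // (leq_trans su) // leq_addr|move=> kp su; apply: leq_add].
move=> E.
have u0 : u = 0.
  have : q %| u.
    rewrite -(@Gauss_dvdpl _ u p q); last by rewrite coprimep_sym.
    by rewrite -[u * p](addrK (v * q)) E sub0r dvdpNr dvdp_mull.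
  move/dvdp_leq => h; apply/eqP; apply: contrapT => /negP /h; apply/negP.
  by rewrite -ltnNge; move: su sq; case: (size q).
have v0 : v = 0.
  by move/eqP: E; rewrite u0 mul0r add0r mulf_eq0 (negbTE q0) orbF => /eqP.
case/negP: uv0; apply/eqP; rewrite -[lsubmx uv]rVpolyK -[rsubmx uv]rVpolyK -/u -/v u0 v0.
by rewrite !linear0 row_mx0.
Qed.

Lemma Vandermonde_neq0 (F : fieldType) n (s : seq F) : uniq s -> size s = n ->
  \det (Vandermonde n (\row_(j < n) s`_j)) != 0.
Proof.
move=> us sn; rewrite det_Vandermonde; apply/prodf_neq0 => i _; apply/prodf_neq0 => j ij.
by rewrite !mxE subr_eq0 nth_uniq ?sn // eq_sym; move: ij; case: ltngtP.
Qed.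

Lemma ex_uniq_disjoint (F : numFieldType) (s : seq F) n :
  exists u, [/\ uniq u, size u = n & forall x, x \in u -> x \notin s].
Proof.
elim: n => [|n [u [uu un us]]]; first by exists [::].
have [|x] := @poly_nonroot _ (\prod_(y <- s ++ u) ('X - y%:P)).
  by rewrite monic_neq0 // monic_prod_XsubC.
rewrite -/(root _ x) root_prod_XsubC mem_cat negb_or => /andP[xs xu].
exists (x :: u); split=> /=; rewrite ?xu ?un // => y; rewrite inE => /predU1P[->|/us] //.
Qed.

(* Multiplying the Sylvester matrix by a Vandermonde matrix on the roots of p and
   enough other points makes it block triangular. *)
Lemma sylv_prod (F : numFieldType) dp dq (p : {poly F}) rs :
  p != 0 -> uniq rs -> size rs = dp -> (size p <= dp.+1)%N ->
  (forall s, (s \in rs) = root p s) ->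
  exists2 c, c != 0 & forall q : {poly F}, (size q <= dq.+1)%N ->
    \det (sylv dp dq p q) = c * \prod_(s <- rs) q.[s].
Proof.
move=> p0 urs srs sp rE.
have [us [uus sus dus]] := ex_uniq_disjoint rs dq.
pose V := Vandermonde (dq + dp) (\row_(j < dq + dp) (us ++ rs)`_j).
have V0 : \det V != 0.
  apply: Vandermonde_neq0; last by rewrite size_cat sus srs.
  rewrite cat_uniq uus urs andbT /=; apply/hasPn => x xrs; apply/negP => /dus.
  by rewrite xrs.
have evV (f : {poly F}) j : (size f <= dq + dp)%N ->
    (poly_rV f *m V) 0 j = f.[(us ++ rs)`_j].
  move=> sf; rewrite mxE (horner_coef_wide _ sf); apply: eq_bigr => i _.
  by rewrite !mxE.
have rowE (r : {poly F}) d i j : (size r + d <= (dq + dp).+1)%N ->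
    (lin1_mx ((poly_rV : {poly F} -> 'rV_(dq + dp)) \o r \o* rVpoly) *m V) (i : 'I_d) j =
    ((us ++ rs)`_j) ^+ i * r.[(us ++ rs)`_j].
  move=> sr; have -> : (lin1_mx (poly_rV \o r \o* rVpoly) *m V) i j =
      (poly_rV ('X^i * r) *m V) 0 j.
    rewrite !mxE; apply: eq_bigr => k _; congr (_ * _).
    by rewrite !mxE /= rVpoly_delta.
  rewrite evV ?hornerM ?hornerXn //.
  have [->|r0] := eqVneq r 0; first by rewrite mulr0 size_poly0.
  rewrite size_mul ?expf_neq0 ?polyX_eq0 // size_polyXn.
  by move: (ltn_ord i) sr; move: (size r) (nat_of_ord i) => k l; lia.
pose A := \matrix_(i < dq, j < dq) (us`_j ^+ i * p.[us`_j]).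
have AE : A = Vandermonde dq (\row_(j < dq) us`_j) *m diag_mx (\row_j p.[us`_j]).
  by apply/matrixP => a b; rewrite mul_mx_diag !mxE.
have A0 : \det A != 0.
  rewrite AE det_mulmx mulf_neq0 ?Vandermonde_neq0 // det_diag.
  apply/prodf_neq0 => b _; rewrite mxE; have := dus us`_b.
  by rewrite mem_nth ?sus // => /(_ isT); rewrite rE /root.
pose Vr := Vandermonde dp (\row_(j < dp) rs`_j).
exists (\det A * \det Vr / \det V).
  by rewrite !mulf_neq0 ?invr_eq0 // Vandermonde_neq0.
move=> q sq; apply: (mulIf V0); rewrite mulrAC divfK // -det_mulmx /sylv mul_col_mx.
set B := lin1_mx _ *m V; set C := lin1_mx _ *m V.
(* The rows coming from [p] vanish in the columns that belong to its roots, whence the zero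
   block. *)
have -> : col_mx B C = block_mx A 0 (lsubmx C) (rsubmx C).
  rewrite -[B]hsubmxK -[in LHS](hsubmxK C) -/(block_mx _ _ _ _); congr (block_mx _ _ _ _).
  - apply/matrixP => a b; rewrite [LHS]mxE [RHS]mxE /B rowE; last by move: sp; move: (size p) => k; lia.
    by rewrite nth_cat /= sus ltn_ord.
  - apply/matrixP => a b; rewrite [LHS]mxE [RHS]mxE /B rowE; last by move: sp; move: (size p) => k; lia.
    rewrite nth_cat /= sus ltnNge leq_addr /= addKn.
    have : rs`_b \in rs by rewrite mem_nth // srs.
    by rewrite rE => /rootP ->; rewrite mulr0.
rewrite det_lblock mulrAC -mulrA; congr (_ * _).
have -> : rsubmx C = Vr *m diag_mx (\row_j q.[rs`_j]).
  apply/matrixP => a b; rewrite mul_mx_diag [LHS]mxE ![RHS]mxE /C rowE; last by move: sq; move: (size q) => k; lia.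
  by rewrite nth_cat /= sus ltnNge leq_addr /= addKn !mxE.
rewrite det_mulmx det_diag mulrC; congr (_ * _).
rewrite (big_nth 0) big_mkord srs.
by apply: eq_bigr => b _; rewrite mxE.
Qed.

End Sylvester.

(** * The squared distance variable *)

Section Parity.
Variable A : idomainType.
Implicit Types p q w : {poly A}.

Lemma even_comp p : even_poly (p \Po 'X^2) = p.
Proof.
apply/polyP => i; rewrite coef_even_poly coef_comp_poly_Xn // -muln2 dvdn_mull //.
by rewrite mulnK.
Qed.

Lemma odd_comp p : odd_poly (p \Po 'X^2) = 0.
Proof.
apply/polyP => i; rewrite coef_odd_poly coef_comp_poly_Xn // coef0.
by rewrite dvdn2 /= odd_double.
Qed.

(** In the even part only the half of [w] with the parity of [j] survives; what remains is an
    identity in X^2. *)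
Lemma parity_dvd (j : bool) p q w :
  q \Po 'X^2 = (p \Po 'X^2) * 'X^j * w -> rdvd p q.
Proof.
move=> E; have := congr1 (@even_poly A) E; rewrite even_comp.
rewrite -(poly_even_odd w); set e := even_poly w; set o := odd_poly w => ->.
case: j {E} => /=.
- have -> : (p \Po 'X^2) * 'X^1 * (e \Po 'X^2 + (o \Po 'X^2) * 'X) =
    ((p * e) \Po 'X^2) * 'X + ((p * o) \Po 'X^2) * 'X * 'X.
    by rewrite !comp_polyM expr1; ring.
  rewrite even_polyD !even_polyMX odd_polyMX odd_comp mul0r add0r even_comp.
  by exists (o * 'X); rewrite mulrA.
- have -> : (p \Po 'X^2) * 'X^0 * (e \Po 'X^2 + (o \Po 'X^2) * 'X) =
    ((p * e) \Po 'X^2) + ((p * o) \Po 'X^2) * 'X.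
    by rewrite !comp_polyM expr0; ring.
  rewrite even_polyD !even_polyMX odd_comp mul0r addr0 even_comp.
  by exists e.
Qed.

Lemma parity_split p (c : A) : 2%:R != 0 :> A -> c * c = 1 -> p \Po - 'X = c *: p ->
  exists (j : bool) q, p = (q \Po 'X^2) * 'X^j.
Proof.
move=> n2 cc.
have : (c - 1) * (c + 1) = 0 by rewrite mulrDr mulrBl cc mulr1; ring.
move/eqP; rewrite mulf_eq0 subr_eq0 addr_eq0 => c1.
have inj2 (x : {poly A}) : x + x = 0 -> x = 0.
  by move=> h; apply/eqP; have := h; rewrite -mulr2n -mulr_natl -polyC_natr => /eqP; rewrite mulf_eq0 polyC_eq0 (negbTE n2).
pose e := even_poly p; pose o := odd_poly p.
have pE : p = e \Po 'X^2 + (o \Po 'X^2) * 'X by rewrite poly_even_odd.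
have -> : p \Po - 'X = e \Po 'X^2 - (o \Po 'X^2) * 'X.
  rewrite {1}pE comp_polyD comp_polyM comp_polyX -!comp_polyA.
  by rewrite comp_Xn_poly sqrrN mulrN.
case/orP: c1 => /eqP ->.
- rewrite scale1r => h; exists false, e; rewrite expr0 mulr1 {1}pE.
  suff -> : (o \Po 'X^2) * 'X = 0 by rewrite addr0.
  apply: inj2; move: pE h; set a := e \Po _; set b := _ * 'X => pE h.
  by transitivity ((a + b) - (a - b)); [ring|rewrite h -pE subrr].
- rewrite scaleN1r => h; exists true, o; rewrite expr1 {1}pE.
  suff -> : e \Po 'X^2 = 0 by rewrite add0r.
  apply: inj2; move: pE h; set a := e \Po _; set b := _ * 'X => pE h.
  by transitivity ((a + b) + (a - b)); [ring|rewrite h -pE subrr].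
Qed.

Lemma neg_parity_split p w : 2%:R != 0 :> A -> p != 0 -> p \Po - 'X = p * w ->
  exists (j : bool) q, p = (q \Po 'X^2) * 'X^j.
Proof.
move=> n2 p0 E.
have ww : w * (w \Po - 'X) = 1.
  apply: (mulfI p0); rewrite mulr1 mulrA -E -comp_polyM -E -comp_polyA.
  by rewrite rmorphN /= comp_polyX opprK comp_polyXr.
have [a aE] : exists a, w = a%:P.
  have : w \is a GRing.unit by apply/unitrPr; exists (w \Po - 'X).
  rewrite poly_unitE => /andP[/eqP s1 _]; exists w`_0.
  by apply: size1_polyC; rewrite s1.
apply: (@parity_split p a) => //; last by rewrite E aE mulrC mul_polyC.
move: ww; rewrite aE comp_polyC -polyCM => /(congr1 (fun p : {poly _} => p`_0)).
by rewrite !coefC.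
Qed.

End Parity.

Section EvenSplit.
Variables (F : numClosedFieldType) (n : nat).

Definition onfirst (phi : F -> F) (z : 'I_n.+1 -> F) (j : 'I_n.+1) : F :=
  if j == ord0 then phi (z ord0) else z j.

Lemma pt_split (z : 'I_n.+1 -> F) :
  z =1 pt ord0 (fun=> 0) (fun j => z (lift ord0 j)) (z ord0).
Proof. by move=> j; rewrite /pt; case: unliftP => [k|] ->; rewrite ?mul0r ?addr0. Qed.

Lemma meval_split (z : 'I_n.+1 -> F) p :
  meval z p = (map_poly (meval (fun j => z (lift ord0 j))) (toP ord0 (fun=> 0) p)).[z ord0].
Proof. by rewrite (meval_eq _ (pt_split z)) -horner_lineP. Qed.

Lemma onfirst0 phi z : onfirst phi z ord0 = phi (z ord0).
Proof. by rewrite /onfirst eqxx. Qed.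

Lemma meval_fromP (z : 'I_n.+1 -> F) (q : {poly {mpoly F[n]}}) :
  meval z (fromP ord0 (fun=> 0) q) =
  (map_poly (meval (fun j => z (lift ord0 j))) q).[z ord0].
Proof. by rewrite meval_split fromPK. Qed.

Lemma meval_onfirst (r : {poly F}) (z : 'I_n.+1 -> F) (q : {poly {mpoly F[n]}}) :
  (map_poly (meval (fun j => z (lift ord0 j))) (q \Po map_poly (@mpolyC n F) r)).[z ord0] =
  meval (onfirst (horner r) z) (fromP ord0 (fun=> 0) q).
Proof.
set z' := fun j => z (lift ord0 j).
have rK : map_poly (meval z') (map_poly (@mpolyC n F) r) = r.
  by apply/polyP => i; rewrite !coef_map /= mevalC.
rewrite meval_fromP onfirst0 map_comp_poly horner_comp rK.
by congr (_.[_]); apply: eq_map_poly => p; apply: meval_eq => j.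
Qed.

(** By the Nullstellensatz the square-free [g] divides its image under d -> -d, so it is even or odd
    in d; up to a factor d it is a polynomial in d^2. Comparing even parts turns divisibility by [g]
    into divisibility by [G]. *)
Lemma even_split (g : {mpoly F[n.+1]}) : msqfree g ->
  (forall z, meval z g = 0 -> meval (onfirst -%R z) g = 0) ->
  exists (j : bool) (G : {mpoly F[n.+1]}),
    (forall z, meval z g = meval (onfirst (fun d => d ^+ 2) z) G * z ord0 ^+ j) /\
    forall q, (forall z, meval z g = 0 -> meval (onfirst (fun d => d ^+ 2) z) q = 0) ->
      rdvd G q.
Proof.
move=> sq sym; pose T := @toP F n ord0 (fun=> 0); pose T' := @fromP F n ord0 (fun=> 0).
have g0 := msqfree_neq0 sq.
have negE z p : meval z (T' (T p \Po - 'X)) = meval (onfirst -%R z) p.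
  rewrite meval_fromP; have := meval_onfirst (- 'X) z (T p).
  rewrite rmorphN /= map_polyX => ->; rewrite toPK; apply: meval_eq => j.
  by rewrite /onfirst hornerN hornerX.
have sqE z p : meval z (T' (T p \Po 'X^2)) = meval (onfirst (fun d => d ^+ 2) z) p.
  rewrite meval_fromP; have := meval_onfirst ('X^2) z (T p).
  rewrite rmorphXn /= map_polyX => ->; rewrite toPK; apply: meval_eq => j.
  by rewrite /onfirst hornerXn.
have [c cE] : rdvd g (T' (T g \Po - 'X)).
  by apply: msqfree_nullstellensatz => // z zg; rewrite negE; exact: sym.
have Tc : T g \Po - 'X = T g * T c by rewrite -rmorphM /= -cE fromPK.
have Tg0 : T g != 0 by rewrite toP_eq0.
have [|j [p pE]] := neg_parity_split _ Tg0 Tc.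
  by rewrite -mpolyC1 -mpolyCMn mpolyC_eq0 pnatr_eq0.
exists j, (T' p); split=> [z|q qz].
  have gE : g = T' (p \Po 'X^2) * T' 'X^j.
    by rewrite -[LHS](toPK ord0 (fun=> 0)) -/(T g) pE; exact: rmorphM.
  rewrite [in LHS]gE mevalM -sqE /T fromPK; congr (_ * _).
  have -> : T' 'X^j = 'X_ord0 ^+ j by rewrite -(fromPX ord0 (fun=> 0)); exact: rmorphXn.
  by rewrite rmorphXn /= mevalXU.
have [w wE] : rdvd g (T' (T q \Po 'X^2)).
  by apply: msqfree_nullstellensatz => // z zg; rewrite sqE; exact: qz.
have /parity_dvd[t tE] : T q \Po 'X^2 = (p \Po 'X^2) * 'X^j * T w.
  by rewrite -pE -rmorphM /= -wE fromPK.
by exists (T' t); rewrite -rmorphM /= -tE toPK.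
Qed.

End EvenSplit.

(** * The generic offset *)

Lemma ex_comp_mpoly (F : fieldType) n m (h : 'I_n -> {mpoly F[m]}) q :
  exists q' : {mpoly F[m]}, forall z, meval z q' = meval (fun i => meval z (h i)) q.
Proof.
exists (q \mPo [tuple h i | i < n]) => z; rewrite comp_mpoly_meval.
by apply: meval_eq => i; rewrite tnth_mktuple.
Qed.

Lemma msize_mderiv (F : fieldType) n i (p : {mpoly F[n]}) : mderiv i p != 0 ->
  (msize (mderiv i p) < msize p)%N.
Proof.
move=> d0; have p0 : p != 0 by apply: contra_neq d0 => ->; rewrite mderiv0.
have sp : (0 < msize p)%N by rewrite lt0n msize_poly_eq0.
rewrite -(prednK sp) ltnS msizeE; apply/bigmax_leqP_seq => m; rewrite mcoeff_msupp => md _.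
have : (m + U_(i))%MM \in msupp p.
  by rewrite mcoeff_msupp; apply: contra_neq md; rewrite mcoeff_deriv => ->; rewrite mul0rn.
by move/msize_mdeg_lt; rewrite mdegD mdeg1 addn1; case: (msize p) sp.
Qed.

Lemma rdvd_mderiv0 (F : fieldType) n i (p : {mpoly F[n]}) : rdvd p (mderiv i p) ->
  mderiv i p = 0.
Proof.
move=> [q qE]; apply/eqP; apply: contrapT => /negP d0.
have := msize_mderiv d0; move: d0; rewrite qE mulf_eq0 negb_or => /andP[p0 q0].
rewrite msizeM //; have : (0 < msize q)%N by rewrite lt0n msize_poly_eq0.
by move: (msize p) (msize q) => a b; lia.
Qed.

Section Offset.
Variable F : numClosedFieldType.
Variable f : {mpoly F[3]}.
Hypothesis f_irr : mirreducible f.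
Hypothesis himp_nz : exists y, meval y f = 0 /\ meval y (himp f) != 0.

Let fprime : rprime f := mirreducible_prime f_irr.

(** Irreducibility of the surface: without such a point [a * b] would vanish on V(f), and the prime
    [f] would divide one of the factors. *)
Lemma sigma_dense (a b : {mpoly F[3]}) :
  (exists y, meval y f = 0 /\ meval y a != 0) ->
  (exists y, meval y f = 0 /\ meval y b != 0) ->
  exists y, [/\ meval y f = 0, meval y a != 0 & meval y b != 0].
Proof.
move=> [y1 [f1 a1]] [y2 [f2 b2]]; apply: contrapT => H.
have [_ _ P] := fprime.
have [|[r rE]|[r rE]] := P a b; last first.
- by move: b2; rewrite rE mevalM f2 mul0r eqxx.
- by move: a1; rewrite rE mevalM f1 mul0r eqxx.
apply: rprime_nullstellensatz => // z zf; rewrite mevalM; apply/eqP; rewrite mulf_eq0.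
apply/orP; apply: contrapT => /not_orP[/negP h1 /negP h2].
by apply: H; exists z.
Qed.

Definition fgrad (y : 'I_3 -> F) (i : 'I_3) : F := meval y (mderiv i f).
Definition fhimp (y : 'I_3 -> F) : F := meval y (himp f).

Lemma fhimpE y : fhimp y = \sum_i fgrad y i ^+ 2.
Proof. by rewrite /fhimp /himp raddf_sum /=; apply: eq_bigr => i _; rewrite rmorphXn. Qed.

Lemma fhimp_grad y : fhimp y != 0 -> exists i, fgrad y i != 0.
Proof.
move=> h; apply: contrapT => H; move/eqP: h; apply; rewrite fhimpE big1 // => i _.
apply/eqP; rewrite expf_eq0 /=; apply: contrapT => /negP e; apply: H; by exists i.
Qed.

(** The point of parameter [e] on the normal line at [y], preceded by its squared distance to [y].
    This is polynomial in [y] and [e], whereas the distance itself needs a square root. *)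
Definition phi (y : 'I_3 -> F) (e : F) : 'I_4 -> F :=
  pt ord0 (fun=> 0) (fun i => y i + e * fgrad y i) (e ^+ 2 * fhimp y).

Lemma phi0 y e : phi y e ord0 = e ^+ 2 * fhimp y.
Proof. by rewrite /phi /pt unlift_none. Qed.

Lemma phi_lift y e i : phi y e (lift ord0 i) = y i + e * fgrad y i.
Proof. by rewrite /phi /pt liftK mul0r addr0. Qed.

Lemma phi_poly e (q : {mpoly F[4]}) :
  exists q' : {mpoly F[3]}, forall z, meval z q' = meval (phi z e) q.
Proof.
have [q' q'E] := ex_comp_mpoly (fun j : 'I_4 =>
  if unlift ord0 j is Some i then 'X_i + e *: mderiv i f else e ^+ 2 *: himp f) q.
exists q' => z; rewrite q'E; apply: meval_eq => j; rewrite /phi /pt.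
case: unliftP => [i|] _; first by rewrite mevalD mevalXU mevalZ mul0r addr0.
by rewrite mevalZ.
Qed.

Definition phiX (y : 'I_3 -> F) (j : 'I_4) : {poly F} :=
  if unlift ord0 j is Some i then (y i)%:P + fgrad y i *: 'X else fhimp y *: 'X^2.

Lemma horner_phiX y q s : (mmap polyC (phiX y) q).[s] = meval (phi y s) q.
Proof.
rewrite -[LHS]/((horner_eval s \o mmap polyC (phiX y)) q).
apply: mpoly_rmorph_eq => [c|k] /=; first by rewrite mmapC /horner_eval hornerC mevalC.
rewrite mmapX mmap1U mevalXU /phi /pt /phiX /horner_eval; case: unliftP => [i|] _.
  by rewrite !hornerE mulrC.
by rewrite hornerZ hornerXn mulrC.
Qed.

Lemma offset_sysP d x y u : offset_sys f d x y u ->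
  [/\ meval y f = 0, fhimp y != 0 &
    exists e, d ^+ 2 = e ^+ 2 * fhimp y /\ forall i, x i = y i + e * fgrad y i].
Proof.
move=> [fy cr dist uh].
have h0 : fhimp y != 0.
  apply/eqP => h; move/eqP: uh; rewrite -/(fhimp y) h mulr0 sub0r oppr_eq0.
  by rewrite oner_eq0.
have [j gj] := fhimp_grad h0.
have cr0 i : cross (fgrad y) (fun i => x i - y i) i = 0.
  have [c0 c1 c2] := crossE (fgrad y) (fun i => x i - y i).
  have h01 := cr 0 1 isT; have h02 := cr 0 2 isT; have h12 := cr 1 2 isT.
  move: i; apply: I3P; rewrite ?c0 ?c1 ?c2 //.
  by rewrite -[LHS]opprK opprB h02 oppr0.
have par := cross0_parallel gj cr0.
split=> //; exists ((x j - y j) / fgrad y j); split; last first.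
  by move=> i; rewrite -par addrC subrK.
move/eqP: dist; rewrite subr_eq0 => /eqP <-.
by rewrite fhimpE mulr_sumr; apply: eq_bigr => i _; rewrite par exprMn.
Qed.

Lemma sys_offset d x y e : meval y f = 0 -> fhimp y != 0 -> d ^+ 2 = e ^+ 2 * fhimp y ->
  (forall i, x i = y i + e * fgrad y i) -> offset_sys f d x y (fhimp y)^-1.
Proof.
move=> fy hy dE xE; split=> //.
- by move=> i j _; rewrite !xE -/(fgrad y i) -/(fgrad y j); ring.
- rewrite dE fhimpE mulr_sumr; apply/eqP; rewrite subr_eq0; apply/eqP.
  by apply: eq_bigr => i _; rewrite xE; ring.
- by rewrite -/(fhimp y) mulVf // subrr.
Qed.

Variable g : {mpoly F[4]}.
Hypothesis g_sqfree : msqfree g.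
Hypothesis g_def : forall z, meval z g = 0 <-> gen_offset f z.

Definition vanphi (q : {mpoly F[4]}) : Prop :=
  forall y e, meval y f = 0 -> fhimp y != 0 -> meval (phi y e) q = 0.

Lemma offset_even : exists (j : bool) (G : {mpoly F[4]}),
  [/\ forall z, meval z g = meval (onfirst (fun d => d ^+ 2) z) G * z ord0 ^+ j,
      vanphi G & forall q, vanphi q -> rdvd G q].
Proof.
have sq z y e : z ord0 ^+ 2 = e ^+ 2 * fhimp y ->
    (forall i, z (lift ord0 i) = y i + e * fgrad y i) ->
    onfirst (fun d => d ^+ 2) z =1 phi y e.
  move=> z0 zl j; rewrite /onfirst; case: (unliftP ord0 j) => [i|] ->.
    by rewrite phi_lift eq_sym (negbTE (neq_lift _ _)).
  by rewrite eqxx phi0.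
have [|j [G [GE Gd]]] := even_split g_sqfree.
  move=> z /g_def zO; apply/g_def => q qS.
  pose h (j : 'I_4) : {mpoly F[4]} := if j == ord0 then - 'X_ord0 else 'X_j.
  have hE z' : (fun i => meval z' (h i)) =1 onfirst -%R z'.
    by move=> i; rewrite /h /onfirst; case: eqP => _; rewrite ?mevalN mevalXU.
  have [q' q'E] := ex_comp_mpoly h q.
  rewrite -(meval_eq _ (hE z)) -q'E; apply: zO => w [y [u wyu]].
  rewrite q'E (meval_eq _ (hE w)); apply: qS; exists y, u.
  have [fy cr dist uh] := wyu; split=> //.
  rewrite onfirst0 sqrrN -[RHS]dist; congr (_ - _).
exists j, G; split=> //.
  move=> y e fy hy.
  (* The factor [z ord0 ^+ j] can be cancelled only at nonzero distance; e = 0 is recovered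
     afterwards from the polynomial identity in e. *)
  have key e' : e' != 0 -> meval (phi y e') G = 0.
    move=> e0; pose d := e' * sqrtC (fhimp y).
    have dE : d ^+ 2 = e' ^+ 2 * fhimp y by rewrite exprMn sqrtCK.
    have d0 : d != 0 by rewrite mulf_neq0 // sqrtC_eq0.
    pose z := pt ord0 (fun=> 0) (fun i => y i + e' * fgrad y i) d.
    have z0 : z ord0 = d by rewrite /z /pt unlift_none.
    have zl i : z (lift ord0 i) = y i + e' * fgrad y i by rewrite /z /pt liftK mul0r addr0.
    have zg : meval z g = 0.
      apply/g_def => q; apply; exists y, (fhimp y)^-1; apply: sys_offset => //.
        by rewrite z0.
    move/eqP: zg; rewrite GE mulf_eq0 expf_eq0 z0 (negbTE d0) andbF orbF => /eqP <-.
    by apply: meval_eq => i; rewrite (sq z y e') // z0.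
  have : mmap polyC (phiX y) G * 'X = 0.
    apply: poly_eq0P => s; rewrite hornerM hornerX horner_phiX.
    by have [->|s0] := eqVneq s 0; [rewrite mulr0|rewrite key // mul0r].
  by move/eqP; rewrite mulf_eq0 polyX_eq0 orbF => /eqP h; rewrite -horner_phiX h horner0.
move=> q qv; apply: Gd => z /g_def zO.
pose h (j : 'I_4) : {mpoly F[4]} := if j == ord0 then 'X_ord0 ^+ 2 else 'X_j.
have hE z' : (fun i => meval z' (h i)) =1 onfirst (fun d => d ^+ 2) z'.
  by move=> i; rewrite /h /onfirst; case: eqP => _; rewrite ?rmorphXn /= mevalXU.
have [q' q'E] := ex_comp_mpoly h q.
rewrite -(meval_eq _ (hE z)) -q'E; apply: zO => w [y [u /offset_sysP[fy hy [e [e1 e2]]]]].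
by rewrite q'E (meval_eq _ (hE w)) (meval_eq _ (sq w y e e1 e2)); exact: qv.
Qed.

End Offset.

Section OffsetGradient.
Variable F : numClosedFieldType.
Variable f : {mpoly F[3]}.
Hypothesis f_irr : mirreducible f.
Hypothesis himp_nz : exists y, meval y f = 0 /\ meval y (himp f) != 0.
Variable G : {mpoly F[4]}.
Hypothesis G0 : G != 0.
Hypothesis Gvan : vanphi f G.
Hypothesis Gdvd : forall q, vanphi f q -> rdvd G q.

Let fprime : rprime f := mirreducible_prime f_irr.
Let GD := mderiv ord0 G.
Let Gx (i : 'I_3) := mderiv (lift ord0 i) G.

Lemma sum4E (A : nmodType) (h : 'I_4 -> A) :
  \sum_i h i = h ord0 + \sum_(i < 3) h (lift ord0 i).
Proof. by rewrite big_ord_recl. Qed.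

Lemma offset_grad_eps y : meval y f = 0 -> fhimp f y != 0 ->
  \sum_i mmap polyC (phiX f y) (Gx i) * (fgrad f y i)%:P
   + 'X * mmap polyC (phiX f y) GD * ((fhimp f y)%:P *+ 2) = 0.
Proof.
move=> fy hy.
have G0' : mmap polyC (phiX f y) G = 0.
  by apply: poly_eq0P => s; rewrite horner_phiX Gvan.
have := @mmap_chain_rule F {poly F} 4 polyC (phiX f y) (@deriv F) G
  (fun a b => derivM a b) (fun a => derivC a).
rewrite G0' raddf0 sum4E /= => /esym E; rewrite -[RHS]E addrC; congr (_ + _).
  apply: eq_bigr => i _; congr (_ * _).
  by rewrite /phiX liftK derivD derivC derivZ derivX add0r -mul_polyC mulr1.
have -> : (phiX f y ord0)^`() = (fhimp f y)%:P * 'X *+ 2.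
  by rewrite /phiX unlift_none derivZ derivXn /= expr1 -mul_polyC mulrnAr.
by rewrite -[mderiv ord0 G]/GD; ring.
Qed.

(** For fixed [e], [G] composed with [phi] vanishes on the surface, hence is w f for some polynomial
    w; differentiating in y at a point of the surface leaves w times the gradient of [f]. *)
Lemma offset_grad_y y e : meval y f = 0 -> fhimp f y != 0 ->
  exists w, forall l,
    meval (phi f y e) (Gx l) + e * (\sum_i meval y (mderiv l (mderiv i f)) * meval (phi f y e) (Gx i))
    + e ^+ 2 * meval (phi f y e) GD * (2 * \sum_i fgrad f y i * meval y (mderiv l (mderiv i f)))
    = w * fgrad f y l.
Proof.
move=> fy hy.
pose h (j : 'I_4) : {mpoly F[3]} :=
  if unlift ord0 j is Some i then 'X_i + e *: mderiv i f else e ^+ 2 *: himp f.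
have hE z : (fun j => meval z (h j)) =1 phi f z e.
  move=> j; rewrite /h /phi /pt; case: unliftP => [i|] _.
    by rewrite mevalD mevalXU mevalZ mul0r addr0.
  by rewrite mevalZ.
have mE z q : meval z (mmap (@mpolyC 3 F) h q) = meval (phi f z e) q.
  rewrite -(meval_eq _ (hE z)) -[LHS]/((meval z \o mmap (@mpolyC 3 F) h) q).
  apply: mpoly_rmorph_eq => [c|k] /=; first by rewrite mmapC !mevalC.
  by rewrite mmapX mmap1U mevalXU.
have [w wE] : rdvd f (mmap (@mpolyC 3 F) h G).
  have [_ _ P] := fprime.
  have [|//|[r rE]] := P (mmap (@mpolyC 3 F) h G) (himp f).
    apply: rprime_nullstellensatz => // z zf; rewrite mevalM mE.
    have [->|hz] := eqVneq (meval z (himp f)) 0; first by rewrite mulr0.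
    by rewrite Gvan // mul0r.
  have [y1 [f1 h1]] := himp_nz; move: h1; by rewrite rE mevalM f1 mul0r eqxx.
exists (meval y w) => l.
have := @mmap_chain_rule F {mpoly F[3]} 4 (@mpolyC 3 F) h (mderiv l) G
  (fun a b => mderivM l a b) (fun a => mderivC l a).
move/(congr1 (meval y)); rewrite sum4E /= wE mderivM !mevalD !mevalM fy mul0r addr0.
move=> E; rewrite [X in _ = _ + X]raddf_sum /= mE -/GD in E.
rewrite [RHS]mulrC -[fgrad f y l]/(meval y (mderiv l f)) E.
have h0 : meval y (mderiv l (h ord0)) =
    e ^+ 2 * (2 * \sum_i fgrad f y i * meval y (mderiv l (mderiv i f))).
  rewrite /h unlift_none mderivZ mevalZ; congr (_ * _).
  rewrite /himp [mderiv l _]linear_sum [meval y _]raddf_sum /= mulr_sumr; apply: eq_bigr => i _.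
  by rewrite expr2 mderivM mevalD !mevalM /fgrad; ring.
have hl i : meval y (mderiv l (h (lift ord0 i))) =
    (i == l)%:R + e * meval y (mderiv l (mderiv i f)).
  rewrite /h liftK mderivD mderivZ mevalD mevalZ; congr (_ + _).
  rewrite mderivX mnm1E; case: eqP => [->|_]; last by rewrite scale0r meval0.
  by rewrite scale1r (_ : U_(l) - U_(l) = 0)%MM ?mpolyX0 ?meval1 //; apply/mnmP => j; rewrite mnmBE subnn mnm0E.
rewrite h0; under [in RHS]eq_bigr => i _ do rewrite mevalM mE hl mulrDr.
rewrite big_split /= sum_delta mulr_sumr -/(Gx l).
rewrite [X in _ = _ + (_ + X)](eq_bigr (fun i => e * (meval y (mderiv l (mderiv i f)) * meval (phi f y e) (Gx i)))).
  by ring.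
by move=> i _; rewrite /Gx; ring.
Qed.

(** Let a be the difference of the two sides, a vector of polynomials in e. Differentiating G(phi(y,
    e)) = 0 in e and in y shows that a is orthogonal to the gradient and that (1 + e Hess f) a is
    parallel to it. So, coefficient by coefficient, a is both orthogonal and parallel to a vector of
    nonzero square, hence zero. *)
Lemma offset_grad y e i : meval y f = 0 -> fhimp f y != 0 ->
  meval (phi f y e) (Gx i) = - (2 * e * meval (phi f y e) GD * fgrad f y i).
Proof.
move=> fy hy.
pose cX := mmap polyC (phiX f y).
pose a i : {poly F} := cX (Gx i) + (2 * fgrad f y i) *: ('X * cX GD).
have aE s j : (a j).[s] = meval (phi f y s) (Gx j) + 2 * s * meval (phi f y s) GD * fgrad f y j.
  by rewrite /a hornerD hornerZ hornerM hornerX !horner_phiX; ring.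
suff a0 : forall j, a j = 0.
  by apply/eqP; rewrite -addr_eq0 -aE a0 horner0.
pose hs l i := meval y (mderiv l (mderiv i f)).
have dot : \sum_j fgrad f y j *: a j = 0.
  have := offset_grad_eps fy hy; rewrite -/cX => E; rewrite -[RHS]E {E}.
  rewrite (eq_bigr (fun j => fgrad f y j *: cX (Gx j) +
    (fgrad f y j * (2 * fgrad f y j)) *: ('X * cX GD))); last first.
    by move=> j _; rewrite /a scalerDr scalerA.
  rewrite big_split /=; congr (_ + _).
    by apply: eq_bigr => j _; rewrite mulrC mul_polyC.
  rewrite -scaler_suml (_ : \sum_(j < 3) _ = fhimp f y *+ 2).
    by rewrite -mul_polyC polyCMn mulrC.
  by rewrite fhimpE -sumrMnl; apply: eq_bigr => j _; ring.
pose b l : {poly F} := a l + 'X * \sum_j hs l j *: a j.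
have par l : cross (fun i => (fgrad f y i)%:P) b l = 0.
  apply: poly_eq0P => s; have [w wE] := offset_grad_y s fy hy.
  have bE m : (b m).[s] = (w + 2 * s * meval (phi f y s) GD) * fgrad f y m.
    rewrite mulrDl -wE /b hornerD hornerM hornerX horner_sum aE.
    under eq_bigr => j _ do rewrite hornerZ aE mulrDr.
    rewrite big_split /= mulrDr -/(hs m).
    have -> : \sum_(j < 3) hs m j * (2 * s * meval (phi f y s) GD * fgrad f y j) =
        2 * s * meval (phi f y s) GD * \sum_(j < 3) fgrad f y j * hs m j.
      by rewrite [RHS]mulr_sumr; apply: eq_bigr => j _; ring.
    by rewrite -/(hs m); ring.
  by rewrite /cross hornerD hornerN !hornerM !hornerC !bE; ring.
have key r (prev : 'I_3 -> F) : (forall l, prev l = 0) ->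
    (forall l, (b l)`_r = (a l)`_r + prev l) -> forall j, (a j)`_r = 0.
  move=> p0 bE j; have [m gm] := fhimp_grad hy.
  have cr l : cross (fgrad f y) (fun l => (a l)`_r) l = 0.
    have := congr1 (fun p : {poly F} => p`_r) (par l).
    by rewrite /cross coef0 coefB !coefCM !bE !p0 !addr0.
  have ap := cross0_parallel gm cr.
  have := congr1 (fun p : {poly F} => p`_r) dot; rewrite coef0 coef_sum.
  under eq_bigr => l _ do rewrite coefZ ap mulrCA -expr2.
  rewrite -mulr_sumr -fhimpE => /eqP; rewrite mulf_eq0 (negbTE hy) orbF => /eqP c0.
  by rewrite ap c0 mul0r.
suff H r : forall j, (a j)`_r = 0 by move=> j; apply/polyP => r; rewrite H coef0.
elim: r => [|r IHr]; first by apply: (@key 0%N (fun=> 0)) => // l; rewrite /b coefD coefXM.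
apply: (@key r.+1 (fun l => (\sum_j hs l j *: a j)`_r)) => l.
  by rewrite coef_sum big1 // => j _; rewrite coefZ IHr mulr0.
by rewrite /b coefD coefXM.
Qed.

(** Otherwise [G] divides G_D, which is then zero by degree; all G_x vanish on the offset as a
    consequence, are zero for the same reason, and [G] is constant. *)
Lemma offset_GD : ~ vanphi f GD.
Proof.
move=> H; have GD0 : GD = 0 by apply: rdvd_mderiv0; exact: Gdvd.
have Gc : mconst G.
  apply: mderiv_eq0_const => j; case: (unliftP ord0 j) => [i|] -> //.
  apply: rdvd_mderiv0; apply: Gdvd => y e fy hy.
  by rewrite -/(Gx i) offset_grad // GD0 meval0 mulr0 mul0r oppr0.
have [y [fy hy]] := himp_nz.
have := Gvan 0 fy hy; rewrite (msize1_polyC Gc) mevalC => c0.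
by move: G0; rewrite (msize1_polyC Gc) c0 mpolyC0 eqxx.
Qed.

Lemma phi_nonzero (b : {mpoly F[3]}) : (exists y, meval y f = 0 /\ meval y b != 0) ->
  exists y e, [/\ meval y f = 0, fhimp f y != 0, meval y b != 0 & meval (phi f y e) GD != 0].
Proof.
move=> bnz; have [y1 [e1 [f1 [h1 G1]]]] : exists y e,
    meval y f = 0 /\ fhimp f y != 0 /\ meval (phi f y e) GD != 0.
  apply: contrapT => H; apply: offset_GD => y e fy hy; apply/eqP; apply: contrapT => /negP h.
  by apply: H; exists y, e.
have [q qE] := phi_poly f e1 GD.
have [||y [fy by_ qy]] := sigma_dense f_irr (a := b) (b := q * himp f) => //.
  by exists y1; split=> //; rewrite mevalM mulf_neq0 // qE.
move: qy; rewrite mevalM mulf_eq0 negb_or qE => /andP[qy hy].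
by exists y, e1.
Qed.

(* The foot point on the surface is a rational function of the offset point:
   since G_x = -2 (x - y) G_D on the offset, y = x + G_x / (2 G_D). *)
Definition foot (z : 'I_4 -> F) (i : 'I_3) : F :=
  z (lift ord0 i) + meval z (Gx i) / (2 * meval z GD).

Lemma foot_phi y e : meval y f = 0 -> fhimp f y != 0 -> meval (phi f y e) GD != 0 ->
  foot (phi f y e) =1 y.
Proof.
move=> fy hy g0 i; rewrite /foot phi_lift offset_grad //; field.
by rewrite g0.
Qed.

Lemma clear_foot (p : {mpoly F[3]}) : exists N (ph : {mpoly F[4]}),
  forall z, meval z GD != 0 -> meval z ph = (2 * meval z GD) ^+ N * meval (foot z) p.
Proof.
pose a (i : 'I_3) : {mpoly F[4]} := 'X_(lift ord0 i) * (2 *: GD) + Gx i.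
have [N [ph H]] := clear_denom p a (2 *: GD).
exists N, ph => z z0; have z0' : meval z (2 *: GD) != 0.
  by rewrite mevalZ mulf_neq0 // pnatr_eq0.
have [-> _] := H z z0'; rewrite mevalZ; congr (_ * _); apply: meval_eq => i.
by rewrite /a mevalD mevalM mevalXU mevalZ /foot mulrDl mulfK // mulf_neq0 // pnatr_eq0.
Qed.

(** [q * GD] vanishes on the whole image of [phi], so [G] divides it: identities checked at genuine
    offset points extend to all zeros of [G] off G_D = 0. *)
Lemma offset_identity (q : {mpoly F[4]}) :
  (forall y e, meval y f = 0 -> fhimp f y != 0 -> meval (phi f y e) GD != 0 ->
     meval (phi f y e) q = 0) ->
  forall z, meval z G = 0 -> meval z GD != 0 -> meval z q = 0.
Proof.
move=> H z zG zGD; have [r rE] : rdvd G (q * GD).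
  apply: Gdvd => y e fy hy; rewrite mevalM.
  by have [->|h] := eqVneq (meval (phi f y e) GD) 0; [rewrite mulr0|rewrite H // mul0r].
have := congr1 (meval z) rE; rewrite !mevalM zG mul0r => /eqP.
by rewrite mulf_eq0 (negbTE zGD) orbF => /eqP.
Qed.

(** That [foot z] lies on the surface, with [z] on its normal line and at the right distance, are
    identities on the image of [phi], so they extend to the zeros of [G]. Uniqueness holds because
    [foot] depends on [z] alone. *)
Lemma offset_fiber (b : {mpoly F[3]}) : (exists y, meval y f = 0 /\ meval y b != 0) ->
  exists q : {mpoly F[4]}, ~ rdvd G q /\ forall z, meval z G = 0 -> meval z q != 0 ->
    exists y, [/\ meval y f = 0, fhimp f y != 0, meval y b != 0,
      (exists e, z =1 phi f y e)
      & forall y' e', meval y' f = 0 -> fhimp f y' != 0 -> z =1 phi f y' e' -> y' =1 y].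
Proof.
move=> bnz.
have [|y1 [e1 [f1 h1 b1 G1]]] := phi_nonzero (b := b * himp f).
  have [y [fy by_ hy]] := sigma_dense f_irr bnz himp_nz.
  by exists y; split=> //; rewrite mevalM mulf_neq0.
have [N [ph phE]] := clear_foot (b * himp f).
exists (ph * GD); split.
  move=> [r rE]; have := congr1 (meval (phi f y1 e1)) rE; rewrite !mevalM Gvan // mul0r.
  move/eqP; rewrite mulf_eq0 (negbTE G1) orbF phE // mulf_eq0 expf_eq0 mulf_eq0.
  rewrite (negbTE G1) pnatr_eq0 !andbF /= (meval_eq _ (foot_phi f1 h1 G1)).
  by rewrite (negbTE b1).
move=> z zG; rewrite mevalM mulf_eq0 negb_or => /andP[zph zGD].
have n2 : 2 * meval z GD != 0 by rewrite mulf_neq0 // pnatr_eq0.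
have [bf hf] : meval (foot z) b != 0 /\ fhimp f (foot z) != 0.
  by move: zph; rewrite phE // mulf_eq0 negb_or => /andP[_]; rewrite mevalM mulf_eq0 negb_or => /andP.
have ff : meval (foot z) f = 0.
  have [M [fh fhE]] := clear_foot f.
  have : meval z fh = 0.
    apply: offset_identity zG zGD => y e fy hy g; rewrite fhE //.
    by rewrite (meval_eq _ (foot_phi fy hy g)) fy mulr0.
  by rewrite fhE // => /eqP; rewrite mulf_eq0 expf_eq0 (negbTE n2) andbF => /eqP.
have dE i : z (lift ord0 i) - foot z i = - (meval z (Gx i) / (2 * meval z GD)).
  by rewrite /foot opprD addrA subrr add0r.
have cr i j : fgrad f (foot z) i * meval z (Gx j) = fgrad f (foot z) j * meval z (Gx i).
  have [Mi [fi fiE]] := clear_foot (mderiv i f); have [Mj [fj fjE]] := clear_foot (mderiv j f).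
  have : meval z ((2 *: GD) ^+ Mj * fi * Gx j - (2 *: GD) ^+ Mi * fj * Gx i) = 0.
    apply: offset_identity zG zGD => y e fy hy g.
    rewrite mevalB !mevalM !rmorphXn /= !mevalZ fiE // fjE //.
    rewrite (meval_eq (mderiv i f) (foot_phi fy hy g)) (meval_eq (mderiv j f) (foot_phi fy hy g)).
    rewrite (offset_grad e i fy hy) (offset_grad e j fy hy).
    rewrite -/(fgrad f y i) -/(fgrad f y j).
    by move: (fgrad f y i) (fgrad f y j) (meval _ GD) => u v w; ring.
  rewrite mevalB !mevalM !rmorphXn /= !mevalZ fiE // fjE //.
  rewrite -/(fgrad f (foot z) i) -/(fgrad f (foot z) j) => E.
  apply: (@mulfI _ ((2 * meval z GD) ^+ Mi * (2 * meval z GD) ^+ Mj)).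
    by rewrite mulf_neq0 // expf_neq0.
  by apply/eqP; rewrite -subr_eq0 -[X in _ == X]E; apply/eqP; ring.
have dist : \sum_i (z (lift ord0 i) - foot z i) ^+ 2 = z ord0.
  have : meval z (\sum_i (Gx i) ^+ 2 - (2 *: GD) ^+ 2 * 'X_ord0) = 0.
    apply: offset_identity zG zGD => y e fy hy g.
    rewrite mevalB raddf_sum /= mevalM mevalXU rmorphXn /= mevalZ phi0 fhimpE.
    apply/eqP; rewrite subr_eq0 mulrA mulr_sumr; apply/eqP; apply: eq_bigr => i _.
    by rewrite rmorphXn /= (offset_grad e i fy hy); ring.
  rewrite mevalB raddf_sum /= mevalM mevalXU rmorphXn /= mevalZ => /eqP.
  rewrite subr_eq0 => /eqP E; apply: (@mulfI _ ((2 * meval z GD) ^+ 2)).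
    by rewrite expf_neq0.
  rewrite -E mulr_sumr; apply: eq_bigr => i _; rewrite dE rmorphXn /=.
  by move: (meval z (Gx i)) => u; field.
exists (foot z); split=> //.
  have [j gj] := fhimp_grad hf.
  have par i : z (lift ord0 i) - foot z i =
      (z (lift ord0 j) - foot z j) / fgrad f (foot z) j * fgrad f (foot z) i.
    rewrite !dE; have -> : meval z (Gx i) =
        fgrad f (foot z) i * meval z (Gx j) / fgrad f (foot z) j.
      by rewrite cr mulrAC divff // mul1r.
    move: gj zGD; move: (meval z (Gx j)) (fgrad f (foot z) j) (fgrad f (foot z) i) => u v w.
    by move: (meval z GD) => d v0 d0; field; rewrite v0 d0.
  exists ((z (lift ord0 j) - foot z j) / fgrad f (foot z) j) => k.
  case: (unliftP ord0 k) => [i|] ->.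
    by rewrite phi_lift -par addrC subrK.
  rewrite phi0 -dist fhimpE mulr_sumr; apply: eq_bigr => i _.
  by rewrite par exprMn.
move=> y' e' fy' hy' zE i.
have G' : meval (phi f y' e') GD != 0 by rewrite -(meval_eq _ zE).
rewrite -(foot_phi fy' hy' G') /foot (meval_eq (Gx i) zE) (meval_eq GD zE).
by rewrite zE.
Qed.

End OffsetGradient.

(** * Lines through the origin *)

Section Rays.

(* theta is the substitution x_i -> X x_i; it is invertible up to powers of X, so the
   prime G stays prime after it, except possibly for a factor X. *)
Lemma ray_nocommon (A : idomainType) (theta : {rmorphism {poly A} -> {poly A}}) (G q : A) :
  theta 'X = 'X -> injective theta -> (forall p, exists N p', 'X^N * p = theta p') ->
  rprime G -> ~ rdvd G q -> (theta G%:P)`_0 != 0 ->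
  forall p : {poly A}, rprime p -> (1 < size p)%N ->
    ~ (forall r, r \in [:: theta G%:P; theta q%:P] -> rdvd p r).
Proof.
move=> tX tI tS Gp nGq G0 p pp sp H; have [p0 pn pP] := pp.
have [_ _ GP] := rprimeC Gp.
have [a aE] := H _ (mem_head _ _).
have [b bE] : rdvd p (theta q%:P) by apply: H; rewrite !inE eqxx orbT.
have [N [p' p'E]] := tS p; have [Na [a' a'E]] := tS a; have [Nb [b' b'E]] := tS b.
have tXn k : theta 'X^k = 'X^k by rewrite rmorphXn /= tX.
have e1 : p' * a' = G%:P * 'X^(N + Na).
  by apply: tI; rewrite rmorphM rmorphM /= tXn -p'E -a'E aE exprD; ring.
have e2 : p' * b' = q%:P * 'X^(N + Nb).
  by apply: tI; rewrite rmorphM rmorphM /= tXn -p'E -b'E bE exprD; ring.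
have [|[h hE]|[h hE]] := GP p' a'; first by rewrite e1; apply: rdvd_mulr; exact: rdvdxx.
  apply: nGq; have := (rdvdC G (q%:P * 'X^(N + Nb))).1 _ (N + Nb)%N.
  rewrite coefMXn ltnn subnn coefC eqxx; apply; rewrite -e2 hE -mulrA.
  by apply: rdvd_mulr; exact: rdvdxx.
have G0' : G%:P != 0 by rewrite polyC_eq0; case: Gp.
have e3 : p' * h = 'X^(N + Na).
  by apply: (mulfI G0'); rewrite -e1 hE; ring.
have : rdvd p 'X^(N + Na).
  rewrite -tXn -e3 rmorphM /= -p'E mulrAC; apply: rdvd_mull; exact: rdvdxx.
have : ~ rdvd p 'X.
  move=> [r rE]; move/eqP: G0; apply; rewrite aE coefM big_ord_recl big_ord0 addr0 /=.
  have r0 : r != 0 by apply/eqP => r0; have := polyX_eq0 A; rewrite rE r0 mulr0 eqxx.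
  have := congr1 (fun u : {poly A} => size u) rE; rewrite size_polyX size_mul // => sE.
  have sr : (size r <= 1)%N by move: sp sE r0; rewrite -size_poly_gt0; move: (size p) (size r) => u v; lia.
  have := congr1 (fun u : {poly A} => u`_0) rE.
  rewrite coefX coefM big_ord_recl big_ord0 addr0 /= => /esym/eqP; rewrite mulf_eq0.
  case/orP => [/eqP -> | r00]; first by rewrite mul0r.
  by case/eqP: r0; rewrite (size1_polyC sr) (eqP r00).
move=> npX; elim: (N + Na)%N => [|k IHk]; first by rewrite expr0 => /(rprime_unit pp (unitr1 _)).
by rewrite exprS => /pP[].
Qed.

Variables (F : numClosedFieldType) (n : nat).
Let B := {mpoly F[n.+1]}.

Definition ray (z : 'I_n.+1 -> F) (l : F) (j : 'I_n.+1) : F :=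
  if j == ord0 then z j else l * z j.

Definition rayX (j : 'I_n.+1) : {poly B} :=
  if j == ord0 then ('X_j)%:P else ('X_j)%:P * 'X.

Definition theta0 : B -> {poly B} := mmap (polyC \o @mpolyC n.+1 F) rayX.

HB.instance Definition _ := GRing.RMorphism.copy theta0 (mmap (polyC \o @mpolyC n.+1 F) rayX).

Definition theta : {poly B} -> {poly B} := horner_eval 'X \o map_poly theta0.

HB.instance Definition _ := GRing.RMorphism.copy theta (horner_eval 'X \o map_poly theta0).

Lemma thetaX : theta 'X = 'X.
Proof. by rewrite /theta /= map_polyX /horner_eval hornerX. Qed.

Lemma thetaC p : theta p%:P = theta0 p.
Proof. by rewrite /theta /= map_polyC /horner_eval hornerC. Qed.

Definition rayev (z : 'I_n.+1 -> F) (l : F) : {poly B} -> F := horner_eval l \o map_poly (meval z).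
HB.instance Definition _ z l := GRing.RMorphism.copy (rayev z l) (horner_eval l \o map_poly (meval z)).

Lemma rayevC z l p : rayev z l p%:P = meval z p.
Proof. by rewrite /rayev /= map_polyC /horner_eval hornerC. Qed.

Lemma rayevX z l : rayev z l 'X = l.
Proof. by rewrite /rayev /= map_polyX /horner_eval hornerX. Qed.

Lemma rayev_theta0 z l p : rayev z l (theta0 p) = meval (ray z l) p.
Proof.
rewrite -[LHS]/((rayev z l \o theta0) p); apply: mpoly_rmorph_eq => [c|j].
  by rewrite /= /theta0 mmapC /= rayevC !mevalC.
rewrite /= /theta0 mmapX mmap1U mevalXU /rayX /ray; case: eqP => _.
  by rewrite rayevC mevalXU.
by rewrite rmorphM /= rayevC rayevX mevalXU mulrC.
Qed.

Lemma rayev_theta z l p : rayev z l (theta p) = rayev (ray z l) l p.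
Proof.
elim/poly_ind: p => [|p c IHp]; first by rewrite !rmorph0.
rewrite !rmorphD !rmorphM /= thetaX thetaC IHp !rayevX rayev_theta0.
by rewrite rayevC.
Qed.

Lemma rayev_eq0 p : (forall z l, l != 0 -> rayev z l p = 0) -> p = 0.
Proof.
move=> H; apply/polyP => i; rewrite coef0; apply: mpoly_eq0P => z.
have -> : meval z p`_i = (map_poly (meval z) p)`_i by rewrite coef_map.
suff -> : map_poly (meval z) p = 0 by rewrite coef0.
have : map_poly (meval z) p * 'X = 0.
  apply: poly_eq0P => l; rewrite hornerM hornerX.
  by have [->|l0] := eqVneq l 0; [rewrite mulr0|have := H z l l0; rewrite /rayev /= /horner_eval => ->; rewrite mul0r].
by move/eqP; rewrite mulf_eq0 polyX_eq0 orbF => /eqP.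
Qed.

Lemma ray_inv z l : l != 0 -> exists w, ray w l =1 z.
Proof.
move=> l0; exists (fun j => if j == ord0 then z j else l^-1 * z j) => j.
by rewrite /ray; case: eqP => // _; rewrite mulrA divff // mul1r.
Qed.

Lemma rayev_eq z w l u : w =1 z -> rayev z l u = rayev w l u.
Proof.
move=> wE; elim/poly_ind: u => [|u c IHu]; first by rewrite !rmorph0.
by rewrite !rmorphD !rmorphM /= IHu !rayevX !rayevC (meval_eq _ wE).
Qed.

Lemma theta_eq0 p : theta p = 0 -> p = 0.
Proof.
move=> p0; apply: rayev_eq0 => z l /ray_inv-/(_ z)[w wE].
by rewrite (rayev_eq _ _ wE) -rayev_theta p0 rmorph0.
Qed.

Lemma theta_inj : injective theta.
Proof. exact: raddf_inj theta_eq0. Qed.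

Lemma theta_surj_add (a b : {poly B}) : (exists N p', 'X^N * a = theta p') ->
  (exists N p', 'X^N * b = theta p') -> exists N p', 'X^N * (a + b) = theta p'.
Proof.
move=> [N [p' p'E]] [M [q' q'E]]; exists (N + M)%N, ('X^M * p' + 'X^N * q').
rewrite rmorphD !rmorphM !rmorphXn /= thetaX -p'E -q'E exprD mulrDr.
by rewrite -!mulrA; congr (_ + _); exact: mulrCA.
Qed.

Lemma theta_surj_mul (a b : {poly B}) : (exists N p', 'X^N * a = theta p') ->
  (exists N p', 'X^N * b = theta p') -> exists N p', 'X^N * (a * b) = theta p'.
Proof.
move=> [N [p' p'E]] [M [q' q'E]]; exists (N + M)%N, (p' * q').
by rewrite rmorphM /= -p'E -q'E exprD mulrACA.
Qed.

Lemma theta_surj (p : {poly B}) : exists N p', 'X^N * p = theta p'.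
Proof.
have CP c : exists N p', 'X^N * c%:P = theta p'.
  elim/mpoly_ring_ind: c => [c|j|a b Ha Hb|a b Ha Hb].
  - by exists 0%N, (c%:MP)%:P; rewrite expr0 mul1r thetaC /theta0 mmapC.
  - have [j0|j0] := boolP (j == ord0).
      by exists 0%N, ('X_j)%:P; rewrite expr0 mul1r thetaC /theta0 mmapX mmap1U /rayX j0.
    exists 1%N, ('X_j)%:P; rewrite expr1 thetaC /theta0 mmapX mmap1U /rayX (negbTE j0).
    by rewrite mulrC.
  - by rewrite polyCD; exact: theta_surj_add.
  - by rewrite polyCM; exact: theta_surj_mul.
elim/poly_ind: p => [|p c IHp]; first by exists 0%N, 0; rewrite mulr0 rmorph0.
apply: theta_surj_add; last exact: CP.
apply: theta_surj_mul; first exact: IHp.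
by exists 0%N, 'X; rewrite expr0 mul1r thetaX.
Qed.

(** Rays all pass through the axis x = 0, so they are not general lines; a nonzero value of [G] on
    that axis rules out the factor X that the substitution could introduce. *)
Lemma ray_elim (G q : B) z0 : rprime G -> ~ rdvd G q -> meval (ray z0 0) G != 0 ->
  exists2 Phi : B, Phi != 0 & forall z, meval z Phi != 0 -> forall l,
    ~ (meval (ray z l) G = 0 /\ meval (ray z l) q = 0).
Proof.
move=> Gp nGq G0.
have tG0 : (theta G%:P)`_0 != 0.
  apply: contra_neq G0; rewrite thetaC => h; rewrite -rayev_theta0 /rayev /= /horner_eval.
  by rewrite horner_coef0 coef_map /= h meval0.
have [||c c0 cP] := @elim_iso B {poly B} idfun idfun [:: theta G%:P; theta q%:P]
   (@ufd_mpoly F n.+1) (fun _ => erefl) (fun _ => erefl).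
- by exists (theta G%:P); rewrite ?mem_head //; apply: contra_neq tG0 => ->; rewrite coef0.
- exact: ray_nocommon thetaX theta_inj theta_surj Gp nGq tG0.
exists c => // z zc l [h1 h2]; move/eqP: zc; apply.
have := cP _ (rayev z l); rewrite /= rayevC; apply => r.
by rewrite !inE => /orP[]/eqP->; rewrite /= thetaC rayev_theta0.
Qed.

End Rays.

Section LineTop.
Variables (F : numFieldType) (n : nat) (S : pred 'I_n).
Implicit Type p : {mpoly F[n]}.

Definition sdeg (m : 'X_{1..n}) : nat := (\sum_(i < n | S i) m i)%N.

Definition topS p : {mpoly F[n]} :=
  \sum_(m <- msupp p | sdeg m == deg_in S p) p@_m *: 'X_[m].

Lemma topS_neq0 p : p != 0 -> topS p != 0.
Proof.
move=> p0; have [m mp mE] : exists2 m, m \in msupp p & sdeg m = deg_in S p.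
  have : msupp p != [::] by rewrite msupp_eq0.
  rewrite /deg_in -/sdeg; elim: (msupp p) => // m s IHs _; rewrite big_cons -/(sdeg m).
  have [->|s0] := eqVneq s [::]; first by exists m; rewrite ?mem_head // big_nil maxn0.
  have [m' m's m'E] := IHs s0; rewrite -m'E.
  have [h|h] := leqP (sdeg m') (sdeg m).
    by exists m; rewrite ?mem_head //; rewrite (maxn_idPl h).
  by exists m' => //; rewrite inE m's orbT.
apply/eqP => /(congr1 (mcoeff m)); rewrite mcoeff0 /topS -big_filter raddf_sum /=.
rewrite (bigD1_seq m) ?filter_uniq ?msupp_uniq ?mem_filter ?mE ?eqxx ?mp //=.
rewrite mcoeffZ mcoeffX eqxx mulr1 big1 => [|m' m'm].
  by rewrite addr0 => /eqP; apply/negP; rewrite -mcoeff_msupp.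
by rewrite mcoeffZ mcoeffX (negbTE m'm) mulr0.
Qed.

Definition lineX (a v : 'I_n -> F) (j : 'I_n) : {poly F} :=
  (a j)%:P + (if S j then v j else 0) *: 'X.

Lemma horner_lineX a v p s : (mmap polyC (lineX a v) p).[s] =
  meval (fun j => if S j then a j + v j * s else a j) p.
Proof.
rewrite -[LHS]/((horner_eval s \o mmap polyC (lineX a v)) p).
apply: mpoly_rmorph_eq => [c|j] /=; first by rewrite mmapC /horner_eval hornerC mevalC.
rewrite mmapX mmap1U mevalXU /lineX /horner_eval !hornerE; case: (S j) => //.
by rewrite mul0r addr0.
Qed.

Lemma prod_top (I : Type) (r : seq I) (p : I -> {poly F}) (d : I -> nat) :
  (forall i, size (p i) <= (d i).+1)%N ->
  (size (\prod_(i <- r) p i)%R <= (\sum_(i <- r) d i).+1)%N /\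
  (\prod_(i <- r) p i)`_(\sum_(i <- r) d i)%N = \prod_(i <- r) (p i)`_(d i).
Proof.
move=> H; elim: r => [|i r [IH1 IH2]]; first by rewrite !big_nil size_poly1 coef1.
rewrite !big_cons; set q := \prod_(j <- r) p j; set e := (\sum_(j <- r) d j)%N.
have sz : (size (p i * q)%R <= (d i + e).+1)%N.
  apply: leq_trans (size_polyMleq _ _) _; move: (H i) IH1; rewrite -/q -/e.
  by move: (size (p i)) (size q) => a b; lia.
split=> //; rewrite -IH2 -/q -/e coefM.
have lt : (d i < (d i + e).+1)%N by rewrite ltnS leq_addr.
rewrite (bigD1 (Ordinal lt)) //= addKn big1 ?addr0 // => j /negP ji.
have [jd|jd] := ltnP j (d i).
  rewrite [q`_ _]nth_default ?mulr0 //; apply: leq_trans IH1 _.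
  by move: jd; move: (nat_of_ord j) => k; lia.
rewrite nth_default ?mul0r //; apply: leq_trans (H i) _; rewrite ltn_neqAle jd andbT.
by apply/negP => /eqP h; apply: ji; apply/eqP/val_inj.
Qed.

Lemma line_top a v p (L := mmap polyC (lineX a v) p) :
  (size L <= (deg_in S p).+1)%N /\
  L`_(deg_in S p) = meval (fun j => if S j then v j else a j) (topS p).
Proof.
have mono m : (size (mmap1 (lineX a v) m) <= (sdeg m).+1)%N /\
    (mmap1 (lineX a v) m)`_(sdeg m) = \prod_i (if S i then v i else a i) ^+ m i.
  pose d i := if S i then m i else 0%N.
  have sE : sdeg m = (\sum_i d i)%N by rewrite /sdeg big_mkcond.
  have H i : (size (lineX a v i ^+ m i) <= (d i).+1)%N /\
      (lineX a v i ^+ m i)`_(d i) = (if S i then v i else a i) ^+ m i.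
    rewrite /lineX /d; case: (S i).
      have s2 : (size ((a i)%:P + v i *: 'X)%R <= 2)%N.
        rewrite (leq_trans (size_polyD _ _)) // geq_max (leq_trans (size_polyC_leq1 _)) //.
        by rewrite (leq_trans (size_scale_leq _ _)) // size_polyX.
      have := @prod_top _ (index_enum 'I_(m i)) (fun=> (a i)%:P + v i *: 'X) (fun=> 1%N) (fun=> s2).
      rewrite !prodr_const !sum_nat_const !card_ord muln1 => -[-> ->]; split=> //.
      by rewrite coefD coefC coefZ coefX /= mulr1 add0r.
    by rewrite scale0r addr0 -polyC_exp size_polyC_leq1 coefC.
  have [h1 h2] := @prod_top _ (index_enum 'I_n) _ d (fun i => (H i).1).
  by rewrite sE /mmap1 h1 h2; split=> //; apply: eq_bigr => i _; case: (H i).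
rewrite /L /mmap; split.
  apply: leq_trans (size_sum _ _ _) _; apply/bigmax_leqP_seq => m mp _.
  rewrite mul_polyC; apply: leq_trans (size_scale_leq _ _) _.
  apply: leq_trans (mono m).1 _; rewrite ltnS /deg_in -/sdeg.
  exact: (@leq_bigmax_seq _ (msupp p) xpredT sdeg m).
rewrite coef_sum /topS [in RHS]big_mkcond raddf_sum /=; apply: eq_big_seq => m mp.
rewrite coefCM; case: eqP => [mE|mE].
  by rewrite -mE (mono m).2 mevalZ mevalX.
rewrite nth_default ?mulr0 ?meval0 //; apply: leq_trans (mono m).1 _.
rewrite ltn_neqAle; apply/andP; split; first by apply/eqP.
exact: (@leq_bigmax_seq _ (msupp p) xpredT sdeg m).
Qed.

End LineTop.

Lemma meval_fromC (F : fieldType) n (i : 'I_n.+1) (c : {mpoly F[n]}) z :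
  meval z (fromC i (fun=> 0) c) = meval (fun j => z (lift i j)) c.
Proof.
rewrite -[LHS]/((meval z \o fromC i (fun=> 0)) c); apply: mpoly_rmorph_eq => [a|j] /=.
  by rewrite fromCC !mevalC.
by rewrite fromCX mevalB mevalM mevalC mul0r subr0 !mevalXU.
Qed.

(** Only the coordinate [i] is moved to reach a zero of [p]; when [q] does not involve it, the new
    point lies on p = 0 and off q = 0. *)
Lemma line_root (F : numClosedFieldType) n (p q : {mpoly F[n.+1]}) i :
  q != 0 -> mderiv i p != 0 -> exists x s, meval x q != 0 /\
    meval (pt i (fun=> 0) (fun j => x (lift i j)) s) p = 0.
Proof.
move=> q0 di; pose T := toP i (fun=> 0) p.
have sT : (1 < size T)%N.
  rewrite ltnNge; apply/negP => /size1_polyC TC; move: di.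
  by rewrite -(toP_eq0 i (fun=> 0)) -toP_deriv -/T TC derivC eqxx.
have [|x] := @mpoly_nonroot _ _ (q * fromC i (fun=> 0) (lead_coef T)).
  rewrite mulf_neq0 // -(fromPC i (fun=> 0)) -(toP_eq0 i (fun=> 0)) fromPK polyC_eq0.
  by rewrite lead_coef_eq0 -size_poly_gt0 (leq_trans _ sT).
rewrite mevalM mulf_eq0 negb_or meval_fromC => /andP[xq xl].
have [|s /rootP sr] := closed_rootP (lineP i (fun=> 0) (fun j => x (lift i j)) p) _.
  by rewrite /lineP /= size_map_poly_id0 // -/T; case: (size T) sT => [|[]].
by exists x, s; rewrite -horner_lineP.
Qed.

Lemma rprime_nonconst_deriv (F : numClosedFieldType) n (p : {mpoly F[n]}) :
  rprime p -> exists i, mderiv i p != 0.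
Proof.
move=> pp; apply: contrapT => H; move/negP: (rprime_nconst pp); apply.
apply: mderiv_eq0_const => i; apply/eqP; apply: contrapT => /negP h; apply: H; by exists i.
Qed.

Section OffsetRays.
Variable F : numClosedFieldType.
Variable f : {mpoly F[3]}.
Hypothesis f_irr : mirreducible f.
Hypothesis himp_nz : exists y, meval y f = 0 /\ meval y (himp f) != 0.
Variable G : {mpoly F[4]}.
Hypothesis G0 : G != 0.
Hypothesis Gvan : vanphi f G.
Hypothesis Gdvd : forall q, vanphi f q -> rdvd G q.

Definition at4 (D : F) (x : 'I_3 -> F) : 'I_4 -> F := pt ord0 (fun=> 0) x D.

Lemma at40 D x : at4 D x ord0 = D. Proof. by rewrite /at4 /pt unlift_none. Qed.
Lemma at4l D x i : at4 D x (lift ord0 i) = x i.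
Proof. by rewrite /at4 /pt liftK mul0r addr0. Qed.

Lemma at4_poly D (q : {mpoly F[4]}) :
  exists q' : {mpoly F[3]}, forall x, meval x q' = meval (at4 D x) q.
Proof.
have [q' q'E] := ex_comp_mpoly (fun j : 'I_4 =>
  if unlift ord0 j is Some i then 'X_i else D%:MP) q.
exists q' => z; rewrite q'E; apply: meval_eq => j; rewrite /at4 /pt.
by case: unliftP => [i|] _; rewrite ?mevalXU ?mevalC ?mul0r ?addr0.
Qed.

(** If [G] divides neither [a] nor [b], each is nonzero along [phi] at some e, on a dense part of
    the surface. At a common point y both become nonzero polynomials in e, and so does their
    product. *)
Lemma rprime_G : rprime G.
Proof.
have [y0 [f0 h0]] := himp_nz; split=> //.
  rewrite mpoly_unitP //; apply/negP => Gc; have := Gvan 0 f0 h0.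
  rewrite (msize1_polyC Gc) mevalC => c0; move: G0.
  by rewrite (msize1_polyC Gc) c0 mpolyC0 eqxx.
move=> a b [r rE].
have vab : vanphi f (a * b) by move=> y e fy hy; rewrite rE mevalM Gvan // mul0r.
have nv (q : {mpoly F[4]}) : ~ rdvd G q -> exists e (q' : {mpoly F[3]}),
    (forall z, meval z q' = meval (phi f z e) q) /\ exists y, meval y f = 0 /\ meval y (q' * himp f) != 0.
  move=> nd; have [y [e [fy [hy qy]]]] : exists y e,
      meval y f = 0 /\ fhimp f y != 0 /\ meval (phi f y e) q != 0.
    apply: contrapT => H; apply: nd; apply: Gdvd => y e fy hy; apply/eqP.
    by apply: contrapT => /negP h; apply: H; exists y, e.
  have [q' q'E] := phi_poly f e q; exists e, q'; split=> //.
  by exists y; split=> //; rewrite mevalM mulf_neq0 // q'E.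
apply: contrapT => /not_orP[/nv[e1 [a' [aE an]]] /nv[e2 [b' [bE bn]]]].
have [y [fy ay by_]] := sigma_dense f_irr an bn.
move: ay by_; rewrite !mevalM !mulf_eq0 !negb_or => /andP[ay hy] /andP[by_ _].
have : mmap polyC (phiX f y) a * mmap polyC (phiX f y) b = 0.
  by apply: poly_eq0P => s; rewrite hornerM !horner_phiX -mevalM vab.
move/eqP; rewrite mulf_eq0 => /orP[]/eqP h.
  by move: ay; rewrite aE -horner_phiX h horner0 eqxx.
by move: by_; rewrite bE -horner_phiX h horner0 eqxx.
Qed.

Hypothesis assum1 : exists Delta1 : seq F, forall d0 : F, d0 != 0 -> d0 \notin Delta1 ->
  ~ offset_at f d0 (fun=> 0).

(* Otherwise a component of the offset at a generic distance d0 passes through the origin;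
   as its generic points come from the surface, the origin would lie on offset_at f d0. *)
Lemma G_origin : exists D, meval (at4 D (fun=> 0)) G != 0.
Proof.
apply: contrapT => H.
have {}H D : meval (at4 D (fun=> 0)) G = 0.
  by apply/eqP; apply: contrapT => /negP h; apply: H; exists D.
have [|q' [nGq fib]] := offset_fiber f_irr himp_nz G0 Gvan Gdvd (b := 1).
  by have [y [fy _]] := himp_nz; exists y; rewrite meval1 oner_neq0.
have Gp := rprime_G.
(* One elimination per coordinate: which coordinate the component through the origin depends on is
   known only once the distance is chosen. *)
have elim i := @elim_line F 3 [:: G; q'] (lift ord0 i) (fun=> 0)
  (ex_intro2 _ _ G (mem_head _ _) G0) (rprime_nocommon Gp nGq).
have specD n (p : {mpoly F[n.+1]}) : p != 0 -> exists2 e : {poly F}, e != 0 & forall D,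
    e.[D ^+ 2] != 0 -> exists z, z ord0 = D ^+ 2 /\ meval z p != 0.
  move=> /mpoly_nonroot[z zp].
  pose h (j : 'I_n.+1) : {poly F} := if j == ord0 then 'X else (z j)%:P.
  have hE s : (mmap polyC h p).[s] = meval (fun j => if j == ord0 then s else z j) p.
    rewrite -[LHS]/((horner_eval s \o mmap polyC h) p).
    apply: mpoly_rmorph_eq => [c|k] /=; first by rewrite mmapC /horner_eval hornerC mevalC.
    by rewrite mmapX mmap1U mevalXU /h /horner_eval; case: eqP => _; rewrite !hornerE.
  exists (mmap polyC h p).
    apply: contra_neq zp => h0; have := hE (z ord0); rewrite h0 horner0 => ->.
    by apply: meval_eq => j; case: eqP => [->|].
  move=> D; rewrite hE => Dp.
  by exists (fun j => if j == ord0 then D ^+ 2 else z j); rewrite eqxx.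
have /choice[psi psiP] : forall i : 'I_3, exists psi : {mpoly F[3]}, psi != 0 /\
    forall z, meval z psi != 0 -> forall s,
      exists2 q, q \in [:: G; q'] & meval (pt (lift ord0 i) (fun=> 0) z s) q != 0.
  by move=> i; have [p p0 pP] := elim i; exists p.
have /choice[eps epsP] : forall i : 'I_3, exists eps : {poly F}, eps != 0 /\
    forall D, eps.[D ^+ 2] != 0 -> exists z, z ord0 = D ^+ 2 /\ meval z (psi i) != 0.
  by move=> i; have [e e0 eP] := specD _ _ (psiP i).1; exists e.
have [eG eG0 eGP] := specD _ _ G0.
have [Delta DeltaP] := assum1.
have cX2 (e : {poly F}) : e != 0 -> e \Po 'X^2 != 0.
  by move=> e0; rewrite comp_poly_eq0 // size_polyXn.
have [|d0] := @poly_nonroot _ ('X * (\prod_(d <- Delta) ('X - d%:P)) *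
    (eG \Po 'X^2) * \prod_i (eps i \Po 'X^2)).
  rewrite !mulf_neq0 ?polyX_eq0 ?cX2 //.
    by rewrite monic_neq0 // monic_prod_XsubC.
  by apply/prodf_neq0 => i _; rewrite cX2 //; case: (epsP i).
rewrite !hornerM !mulf_eq0 !negb_or hornerX horner_comp hornerXn -!andbA.
move=> /and4P[d00 dD dG]; rewrite horner_prod => /prodf_neq0 de.
have {}dD : d0 \notin Delta by rewrite -root_prod_XsubC.
have /existsNP[q0] := DeltaP d0 d00 dD.
move=> /not_implyP[q0S /eqP q00].
pose D0 := d0 ^+ 2.
have [gam gamE] := at4_poly D0 G; have [qd qdE] := at4_poly D0 q'.
have gam0 : gam != 0.
  have [z [z0 zG]] := eGP d0 dG; apply: contra_neq zG => g0.
  rewrite -[RHS](meval0 (fun i => z (lift ord0 i))) -g0 gamE; apply: meval_eq => j.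
  by case: (unliftP ord0 j) => [i|] ->; rewrite ?at4l ?at40.
have [u [s [uu sp gE]]] := ufd_mpoly gam0.
have [p ps p00] : exists2 p, p \in s & meval (fun=> 0) p = 0.
  have := H D0; rewrite -gamE gE mevalM => /eqP; rewrite mulf_eq0.
  have /negbTE -> : meval (fun=> 0) u != 0 by rewrite -unitfE rmorph_unit.
  by rewrite rmorph_prod prodf_seq_eq0 => /hasP[p ps /eqP]; exists p.
have pp := sp p ps; have [_ _ pP] := pp.
have pgam z : meval z p = 0 -> meval z gam = 0.
  by move=> zp; rewrite gE (perm_big _ (perm_to_rem ps)) big_cons /= !mevalM zp mul0r mulr0.
(* Zeros of [p] off [qd] are genuine offset points at distance [d0], where [q0] vanishes; so [p]
   divides [q0 * qd]. It cannot divide [q0], which is nonzero at the origin. *)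
have [|[r rE]|pqd] := pP q0 qd.
- apply: rprime_nullstellensatz => // z zp; rewrite mevalM.
  have [->|zq] := eqVneq (meval z qd) 0; first by rewrite mulr0.
  have [||y [fy hy _ [e ze] _]] := fib (at4 D0 z); first by rewrite -gamE pgam.
    by rewrite -qdE.
  rewrite q0S ?mul0r //; exists y, (fhimp f y)^-1; apply: (sys_offset (e := e)) => //.
    by have := ze ord0; rewrite at40 phi0.
  by move=> i; have := ze (lift ord0 i); rewrite at4l phi_lift.
- by case/eqP: q00; rewrite rE mevalM p00 mul0r.
have [i di] := rprime_nonconst_deriv pp.
have [Psi PsiE] := ex_comp_mpoly (fun j : 'I_3 =>
  (if unlift ord0 (lift (lift ord0 i) j) is Some l then 'X_l else D0%:MP) : {mpoly F[3]}) (psi i).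
have {}PsiE x : meval x Psi = meval (fun j => at4 D0 x (lift (lift ord0 i) j)) (psi i).
  rewrite PsiE; apply: meval_eq => j; rewrite /at4 /pt.
  by case: unliftP => [l|] _; rewrite ?mevalXU ?mevalC ?mul0r ?addr0.
have Psi0 : Psi != 0.
  have [|z [z0 zp]] := (epsP i).2 d0; first by have := de i isT; rewrite horner_comp hornerXn.
  pose x l := if unlift (lift ord0 i) (lift ord0 l) is Some j then z j else 0.
  apply: contra_neq zp => P0; have := PsiE x; rewrite P0 meval0 => ->; apply: meval_eq => j.
  case: (unliftP ord0 (lift (lift ord0 i) j)) => [l|] e.
    by rewrite e at4l /x -e liftK.
  by rewrite e at40 -[RHS]/(d0 ^+ 2) -z0; congr z; apply: (@lift_inj _ (lift ord0 i)); rewrite e; apply: val_inj.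
have [x [t [xP xp]]] := line_root Psi0 di.
have ptE : pt (lift ord0 i) (fun=> 0) (fun j => at4 D0 x (lift (lift ord0 i) j)) t =1
    at4 D0 (pt i (fun=> 0) (fun j => x (lift i j)) t).
  move=> k; rewrite {1}/pt; case: unliftP => [j|] ->.
    rewrite mul0r addr0; case: (unliftP ord0 (lift (lift ord0 i) j)) => [l|] e.
      rewrite e !at4l /pt; case: unliftP => [l'|] lE; first by rewrite mul0r addr0 -lE.
      by move: (neq_lift (lift ord0 i) j); rewrite e lE eqxx.
    by rewrite e !at40.
  by rewrite at4l /pt unlift_none.
rewrite PsiE in xP; have [q] := (psiP i).2 _ xP t.
rewrite !inE (meval_eq _ ptE) => /orP[]/eqP->.
  by rewrite -gamE pgam ?eqxx.
by rewrite -qdE; have [r ->] := pqd; rewrite mevalM xp mul0r eqxx.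
Qed.

End OffsetRays.

Section OffsetCount.
Variable F : numClosedFieldType.
Variable f : {mpoly F[3]}.
Hypothesis f_irr : mirreducible f.
Hypothesis himp_nz : exists y, meval y f = 0 /\ meval y (himp f) != 0.
Variable g : {mpoly F[4]}.
Hypothesis g_sqfree : msqfree g.
Hypothesis g_def : forall z, meval z g = 0 <-> gen_offset f z.
Hypothesis assum1 : exists Delta1 : seq F, forall d0 : F, d0 != 0 -> d0 \notin Delta1 ->
  ~ offset_at f d0 (fun=> 0).

Let xvars : pred 'I_4 := fun j => j != ord0.

(** On a ray this is l times the derivative in l, so multiple roots of [G] on a ray are common zeros
    of [G] and [euler G]. *)
Definition euler (G : {mpoly F[4]}) : {mpoly F[4]} :=
  \sum_(i < 3) 'X_(lift ord0 i) * mderiv (lift ord0 i) G.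

Definition rayL (D : F) (k : 'I_3 -> F) (q : {mpoly F[4]}) : {poly F} :=
  mmap polyC (lineX xvars (at4 D (fun=> 0)) (at4 0 k)) q.

Lemma horner_rayL D k q l : (rayL D k q).[l] = meval (at4 D (fun i => l * k i)) q.
Proof.
rewrite /rayL horner_lineX; apply: meval_eq => j; rewrite /xvars.
case: (unliftP ord0 j) => [i|] ->; rewrite ?eqxx ?at40 //=.
by rewrite !at4l add0r mulrC.
Qed.

Lemma deriv_rayL D k G : 'X * (rayL D k G)^`() = rayL D k (euler G).
Proof.
have := @mmap_chain_rule F {poly F} 4 polyC (lineX xvars (at4 D (fun=> 0)) (at4 0 k)) (@deriv F) G
  (fun a b => derivM a b) (fun a => derivC a).
rewrite /rayL /= => ->; rewrite sum4E.
have -> : (lineX xvars (at4 D (fun=> 0)) (at4 0 k) ord0)^`() = 0.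
  by rewrite /lineX /xvars eqxx /= scale0r addr0 derivC.
rewrite mulr0 add0r /euler raddf_sum /= mulr_sumr; apply: eq_bigr => i _.
rewrite rmorphM /= mmapX mmap1U mulrCA [RHS]mulrC; congr (_ * _).
rewrite /lineX /xvars /= !at4l add0r derivZ derivX.
by rewrite -mul_polyC mulr1 -mul_polyC mulrC.
Qed.

(** By degree the quotient is constant, and it is zero because at (D, 0) the Euler derivative
    vanishes but [G] does not. Then [G] is constant on rays, against the existence of an offset
    point of squared distance D. *)
Lemma euler_ndvd (G : {mpoly F[4]}) : G != 0 -> vanphi f G ->
  (exists D, meval (at4 D (fun=> 0)) G != 0) -> ~ rdvd G (euler G).
Proof.
move=> G0 Gvan [D GD] [h hE].
have E0 x : meval (at4 x (fun=> 0)) (euler G) = 0.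
  by rewrite /euler raddf_sum /= big1 // => i _; rewrite mevalM mevalXU at4l mul0r.
have e0 : euler G = 0.
  apply/eqP; apply: contrapT => /negP en0.
  have h0 : h != 0 by apply: contra_neq en0; rewrite hE => ->; rewrite mulr0.
  have : (msize (euler G) <= msize G)%N.
    rewrite /euler; apply: leq_trans (msize_sum _ _ _) _; apply/bigmax_leqP => i _.
    have [->|d0] := eqVneq (mderiv (lift ord0 i) G) 0; first by rewrite mulr0 msize0.
    rewrite msizeM //; last by rewrite -msize_poly_eq0 msizeX mdeg1.
    by rewrite msizeX mdeg1 /= msize_mderiv.
  rewrite hE msizeM //.
  have : (0 < msize G)%N by rewrite lt0n msize_poly_eq0.
  move=> sG sh; have hc : (msize h <= 1)%N by move: sG sh; move: (msize G) (msize h) => a b; lia.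
  have := E0 D; rewrite hE mevalM (msize1_polyC hc) mevalC => /eqP.
  rewrite mulf_eq0 (negbTE GD) /= => /eqP c0.
  by case/eqP: h0; rewrite (msize1_polyC hc) c0 mpolyC0.
have cst E k : meval (at4 E k) G = meval (at4 E (fun=> 0)) G.
  have : (rayL E k G)^`() = 0.
    have := deriv_rayL E k G; rewrite e0 /rayL mmap0 => /eqP.
    by rewrite mulf_eq0 polyX_eq0 => /eqP.
  move/(deriv0_size (fun n => _))/size1_polyC => LC.
  have e1 : meval (at4 E k) G = (rayL E k G).[1].
    by rewrite horner_rayL; apply: meval_eq => j; case: (unliftP ord0 j) => [i|] ->; rewrite ?at40 ?at4l ?mul1r.
  have e2 : meval (at4 E (fun=> 0)) G = (rayL E k G).[0].
    by rewrite horner_rayL; apply: meval_eq => j; case: (unliftP ord0 j) => [i|] ->; rewrite ?at40 ?at4l ?mul0r.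
  by rewrite e1 e2 LC ?hornerC // => n; rewrite pnatr_eq0.
have [y [fy hy]] := himp_nz.
move/eqP: GD; apply; rewrite -(cst D (fun i => y i + sqrtC (D / fhimp f y) * fgrad f y i)).
rewrite -[RHS](Gvan y (sqrtC (D / fhimp f y)) fy hy); apply: meval_eq => j.
by rewrite /phi sqrtCK divfK.
Qed.

Lemma sq4_poly (p : {mpoly F[4]}) : p != 0 -> exists2 q : {mpoly F[4]}, q != 0 &
  forall d k, meval (at4 d k) q = meval (at4 (d ^+ 2) k) p.
Proof.
move=> p0; have [q qE] := ex_comp_mpoly (fun j : 'I_4 =>
  (if unlift ord0 j is Some i then 'X_j else 'X_ord0 ^+ 2) : {mpoly F[4]}) p.
have {}qE d k : meval (at4 d k) q = meval (at4 (d ^+ 2) k) p.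
  rewrite qE; apply: meval_eq => j; case: (unliftP ord0 j) => [i|] ->.
    by rewrite mevalXU !at4l.
  by rewrite rmorphXn /= mevalXU !at40.
exists q => //; have [z zp] := mpoly_nonroot p0; apply: contra_neq zp => q0.
have := qE (sqrtC (z ord0)) (fun i => z (lift ord0 i)); rewrite q0 meval0 sqrtCK => ->.
by apply: meval_eq => j; case: (unliftP ord0 j) => [i|] ->; rewrite ?at40 ?at4l.
Qed.

(** G(d^2, l k) has degree delta in l as the top form of [g] is nonzero at (d, k), simple roots as
    it shares none with [euler G], and unique foot points as it shares none with the exceptional
    [q]. *)
Lemma offset_rays (b : {mpoly F[3]}) : (exists y, meval y f = 0 /\ meval y b != 0) ->
  exists2 Phi : {mpoly F[4]}, Phi != 0 & forall d k, meval (at4 d k) Phi != 0 ->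
    exists ls, [/\ uniq ls, size ls = deg_in xvars g,
      (forall l y e, meval y f = 0 -> fhimp f y != 0 ->
         at4 (d ^+ 2) (fun i => l * k i) =1 phi f y e -> l \in ls)
    & forall l, l \in ls ->
      exists y, [/\ meval y f = 0, fhimp f y != 0, meval y b != 0,
        (exists e, at4 (d ^+ 2) (fun i => l * k i) =1 phi f y e)
      & forall y' e', meval y' f = 0 -> fhimp f y' != 0 ->
          at4 (d ^+ 2) (fun i => l * k i) =1 phi f y' e' -> y' =1 y]].
Proof.
move=> bnz; have [j [G [GE Gvan Gdvd]]] := offset_even g_sqfree g_def.
have g0 := msqfree_neq0 g_sqfree.
have G0 : G != 0.
  apply: contra_neq g0 => h; apply: mpoly_eq0P => z; by rewrite GE h meval0 mul0r.
have Gp := rprime_G f_irr himp_nz G0 Gvan Gdvd.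
have [D1 GD1] := G_origin f_irr himp_nz G0 Gvan Gdvd assum1.
have [q [nGq fib]] := offset_fiber f_irr himp_nz G0 Gvan Gdvd bnz.
have nGe : ~ rdvd G (euler G) by apply: euler_ndvd => //; exists D1.
have ray0 : meval (ray (at4 D1 (fun=> 0)) 0) G != 0.
  rewrite (meval_eq _ (_ : _ =1 at4 D1 (fun=> 0))) // => i.
  by rewrite /ray; case: (unliftP ord0 i) => [l|] ->; rewrite ?eqxx /= ?at4l ?at40 ?mul0r.
have rayE (D : F) k l : ray (at4 D k) l =1 at4 D (fun i => l * k i).
  by move=> i; rewrite /ray; case: (unliftP ord0 i) => [l'|] ->; rewrite ?eqxx /= ?at4l ?at40.
have [Q1 Q10 Q1P] := ray_elim Gp nGq ray0.
have [Q2 Q20 Q2P] := ray_elim Gp nGe ray0.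
have [R1 R10 R1E] := sq4_poly Q10.
have [R2 R20 R2E] := sq4_poly Q20.
have tg0 : topS xvars g != 0 by apply: topS_neq0.
exists ('X_ord0 * topS xvars g * R1 * R2).
  by rewrite !mulf_neq0 // -msize_poly_eq0 msizeX mdeg1.
move=> d k; rewrite !mevalM !mulf_eq0 mevalXU at40 R1E R2E !negb_or => /andP[/andP[/andP[d0 tg]]] q1 q2.
pose L := rayL (d ^+ 2) k G.
have LE : rayL d k g = d ^+ j *: L.
  apply/eqP; rewrite -subr_eq0; apply/eqP/poly_eq0P => l.
  rewrite hornerD hornerN hornerZ !horner_rayL GE at40 mulrC; apply/eqP; rewrite subr_eq0; apply/eqP; congr (_ * _).
  by apply: meval_eq => i; rewrite /onfirst; case: (unliftP ord0 i) => [l'|] ->; rewrite ?eqxx /= ?at4l ?at40.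
have dj : d ^+ j != 0 by rewrite expf_neq0.
have [sL cL] := line_top xvars (at4 d (fun=> 0)) (at4 0 k) g.
have szL : size L = (deg_in xvars g).+1.
  rewrite -(size_scale L dj) -LE; apply/eqP; rewrite eqn_leq sL /= ltnNge; apply/negP => h.
  move/eqP: tg; apply; rewrite -[RHS](_ : (rayL d k g)`_(deg_in xvars g) = 0); last by apply: nth_default.
  rewrite /rayL cL; apply: meval_eq => i; rewrite /xvars.
  by case: (unliftP ord0 i) => [l'|] ->; rewrite ?eqxx /= ?at4l ?at40.
have [||ls [uls sls lsE]] := @simple_roots F L.
- by rewrite -size_poly_eq0 szL.
- move=> s; rewrite /root => /eqP rs; apply/negP => /eqP ds; apply: (Q2P _ q2 s).
  rewrite !(meval_eq _ (rayE _ _ _)) -horner_rayL -/L rs; split=> //.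
  by rewrite -horner_rayL -deriv_rayL hornerM ds mulr0.
exists ls; split=> //; first by rewrite sls szL.
- move=> l y e fy hy E; rewrite lsE /root horner_rayL (meval_eq _ E); apply/eqP; exact: Gvan.
move=> l; rewrite lsE /root horner_rayL => /eqP rl; apply: fib => //; apply/eqP => ql.
by apply: (Q1P _ q1 l); rewrite !(meval_eq _ (rayE _ _ _)).
Qed.
End OffsetCount.

(** * Generic points and the count of parameters *)

Section Generic.
Variable F : numClosedFieldType.

Definition gen n (P : ('I_n -> F) -> Prop) : Prop :=
  exists2 E : {mpoly F[n]}, E != 0 & forall z, meval z E != 0 -> P z.

Definition cof (P : F -> Prop) : Prop :=
  exists2 e : {poly F}, e != 0 & forall d, e.[d] != 0 -> P d.

Lemma gen_sub n (P Q : ('I_n -> F) -> Prop) : gen P -> (forall z, P z -> Q z) -> gen Q.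
Proof. by move=> [E E0 H] PQ; exists E => // z /H/PQ. Qed.

Lemma gen_all n (P : ('I_n -> F) -> Prop) : (forall z, P z) -> gen P.
Proof. by move=> H; exists 1; rewrite ?oner_neq0. Qed.

Lemma gen_and n (P Q : ('I_n -> F) -> Prop) : gen P -> gen Q -> gen (fun z => P z /\ Q z).
Proof.
move=> [E1 n1 H1] [E2 n2 H2]; exists (E1 * E2); first by rewrite mulf_neq0.
by move=> z; rewrite mevalM mulf_eq0 negb_or => /andP[/H1 ? /H2 ?].
Qed.

Lemma gen_seq n (T : eqType) (s : seq T) (P : T -> ('I_n -> F) -> Prop) :
  (forall x, x \in s -> gen (P x)) -> gen (fun z => forall x, x \in s -> P x z).
Proof.
elim: s => [|x s IHs] H; first exact: gen_all.
apply: gen_sub (gen_and (H x (mem_head x s)) (IHs _)) _.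
  by move=> y ys; apply: H; rewrite inE ys orbT.
by move=> z [Px Ps] y; rewrite inE => /orP[/eqP->|/Ps].
Qed.

Lemma gen_ex n (P : ('I_n -> F) -> Prop) : gen P -> exists z, P z.
Proof. by move=> [E /mpoly_nonroot[z Ez] H]; exists z; apply: H. Qed.

Lemma gen_neq0 n (p : {mpoly F[n]}) : p != 0 -> gen (fun z => meval z p != 0).
Proof. by exists p. Qed.

Lemma cof_sub (P Q : F -> Prop) : cof P -> (forall z, P z -> Q z) -> cof Q.
Proof. by move=> [E E0 H] PQ; exists E => // z /H/PQ. Qed.

Lemma cof_all (P : F -> Prop) : (forall z, P z) -> cof P.
Proof. by move=> H; exists 1; rewrite ?oner_neq0. Qed.

Lemma cof_and (P Q : F -> Prop) : cof P -> cof Q -> cof (fun z => P z /\ Q z).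
Proof.
move=> [E1 n1 H1] [E2 n2 H2]; exists (E1 * E2); first by rewrite mulf_neq0.
by move=> z; rewrite hornerM mulf_eq0 negb_or => /andP[/H1 ? /H2 ?].
Qed.

Lemma cof_seq (T : eqType) (s : seq T) (P : T -> F -> Prop) :
  (forall x, x \in s -> cof (P x)) -> cof (fun z => forall x, x \in s -> P x z).
Proof.
elim: s => [|x s IHs] H; first exact: cof_all.
apply: cof_sub (cof_and (H x (mem_head x s)) (IHs _)) _.
  by move=> y ys; apply: H; rewrite inE ys orbT.
by move=> z [Px Ps] y; rewrite inE => /orP[/eqP->|/Ps].
Qed.

Lemma cof_ex (P : F -> Prop) : cof P -> exists z, P z.
Proof. by move=> [E /poly_nonroot[z Ez] H]; exists z; apply: H. Qed.

Lemma cof_neq0 (p : {poly F}) : p != 0 -> cof (fun d => p.[d] != 0).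
Proof. by exists p. Qed.

Lemma cof_notin (s : seq F) : cof (fun d => d \notin s).
Proof.
exists (\prod_(x <- s) ('X - x%:P)); first by rewrite monic_neq0 // monic_prod_XsubC.
by move=> d; rewrite -[_ == 0]/(root _ d) root_prod_XsubC.
Qed.

Lemma gen_cof n (i : 'I_n.+1) (P : ('I_n.+1 -> F) -> Prop) : gen P ->
  gen (fun z : 'I_n -> F => cof (fun s => P (pt i (fun=> 0) z s))).
Proof.
move=> [E E0 H]; have TE : toP i (fun=> 0) E != 0 by rewrite toP_eq0.
exists (lead_coef (toP i (fun=> 0) E)); first by rewrite lead_coef_eq0.
move=> z Lz; exists (lineP i (fun=> 0) z E); last first.
  by move=> s; rewrite horner_lineP => /H.
apply: contraNneq Lz => h; rewrite lead_coefE -(coef_map (meval z)).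
have -> : map_poly (meval z) (toP i (fun=> 0) E) = 0 by exact: h.
by rewrite coef0.
Qed.

Lemma gen_at4 (P : ('I_4 -> F) -> Prop) : gen P ->
  gen (fun k : 'I_3 -> F => cof (fun d => P (at4 d k))).
Proof. exact: gen_cof. Qed.

End Generic.

Section ParamCount.
Variable F : numClosedFieldType.
Variable f : {mpoly F[3]}.
Hypothesis f_irr : mirreducible f.
Hypothesis himp_nz : exists y, meval y f = 0 /\ meval y (himp f) != 0.
Variable g : {mpoly F[4]}.
Hypothesis g_sqfree : msqfree g.
Hypothesis g_def : forall z, meval z g = 0 <-> gen_offset f z.
Hypothesis assum1 : exists Delta1 : seq F, forall d0 : F, d0 != 0 -> d0 \notin Delta1 ->
  ~ offset_at f d0 (fun=> 0).
Variables (P0 : {mpoly F[2]}) (Pn : 'I_3 -> {mpoly F[2]}).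
Hypothesis P0_nz : P0 != 0.
Hypothesis P_in : forall t, meval t P0 != 0 -> meval (param_at P0 Pn t) f = 0.
Variable m : nat.
Hypothesis m_ti : tracing_index f P0 Pn m.

(** Forget a coordinate l on which [f] depends: the curve b = 0 maps into a curve of the remaining
    coordinate plane, and the cylinder over that curve does not contain the surface. *)
Lemma param_thin (b : {mpoly F[2]}) : b != 0 -> exists b' : {mpoly F[3]},
  (exists y, meval y f = 0 /\ meval y b' != 0) /\
  forall t, meval t P0 != 0 -> meval t b = 0 -> meval (param_at P0 Pn t) b' = 0.
Proof.
move=> b0; have [l fl] := rprime_nonconst_deriv (mirreducible_prime f_irr).
have [E E0 EP] := thin_image (fun i => Pn (lift l i)) P0 b0.
have [b' b'E] := ex_comp_mpoly (fun i : 'I_2 => 'X_(lift l i) : {mpoly F[3]}) E.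
have b'0 : b' != 0.
  have [z zE] := mpoly_nonroot E0; apply: contra_neq zE => h.
  have := b'E (pt l (fun=> 0) z 0); rewrite h meval0 => ->; apply: meval_eq => i.
  by rewrite mevalXU /pt liftK mul0r addr0.
exists b'; split.
  have [x [s [qx fx]]] := line_root b'0 fl.
  exists (pt l (fun=> 0) (fun j => x (lift l j)) s); split=> //.
  apply: contra_neq qx => <-; rewrite !b'E; apply: meval_eq => i.
  by rewrite !mevalXU /pt liftK mul0r addr0.
move=> t t0 bt; rewrite b'E -[RHS](EP t t0 bt); apply: meval_eq => i.
by rewrite mevalXU.
Qed.

Variable n : 'I_3 -> {mpoly F[2]}.
Variable b : {mpoly F[2]}.
Hypothesis b0 : b != 0.
Hypothesis bP0 : forall t, meval t b != 0 -> meval t P0 != 0.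
Hypothesis bh : forall t, meval t b != 0 -> fhimp f (param_at P0 Pn t) != 0.
Hypothesis bn : forall t, meval t b != 0 -> exists2 nu, nu != 0 &
  forall i, meval t (n i) = nu * fgrad f (param_at P0 Pn t) i.
Hypothesis bU : forall t, meval t b != 0 ->
  exists i, cross (param_at P0 Pn t) (fun j => meval t (n j)) i != 0.

Definition on_ray (k : 'I_3 -> F) (d : F) (x v : 'I_3 -> F) : Prop :=
  exists e l, (forall i, x i + e * v i = l * k i) /\ e ^+ 2 * \sum_i v i ^+ 2 = d ^+ 2.

Lemma ray_unique (x v k : 'I_3 -> F) e l e' l' :
  (exists i, cross x v i != 0) -> (forall i, x i + e * v i = l * k i) ->
  (forall i, x i + e' * v i = l' * k i) -> l = l'.
Proof.
move=> [j xv] E E'; apply/eqP; rewrite -subr_eq0; apply: contraNT xv => ll.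
have kE i : k i = (e - e') / (l - l') * v i.
  apply: (mulfI ll); rewrite mulrA mulrCA divff // mulr1 !mulrBl -E -E'; ring.
have xE i : x i = (l * ((e - e') / (l - l')) - e) * v i.
  by apply: (addIr (e * v i)); rewrite E kE; ring.
by rewrite /cross !xE; apply/eqP; ring.
Qed.

(** Each of the delta points of the ray has one foot point, with m parameters; [b'] nonzero there
    keeps all m off b = 0. Lists for different points are disjoint: position and normal are not
    parallel, so t determines l. *)
Lemma count_params : gen (fun k => cof (fun d => exists s : seq {ffun 'I_2 -> F},
  [/\ uniq s, size s = (m * deg_in (fun j : 'I_4 => j != ord0) g)%N &
     forall t : {ffun 'I_2 -> F}, t \in s <-> meval t b != 0 /\
       on_ray k d (param_at P0 Pn t) (fun i => meval t (n i))])).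
Proof.
have [h [hnz hP]] := m_ti; have [b' [b'nz b'P]] := param_thin b0.
have [y0 [fy0 hy0 by0]] := sigma_dense f_irr hnz b'nz.
have [|Phi Phi0 PhiP] := offset_rays f_irr himp_nz g_sqfree g_def assum1 (b := h * b').
  by exists y0; rewrite mevalM mulf_neq0.
apply: gen_sub (gen_at4 (gen_neq0 Phi0)) _ => k /cof_sub; apply=> d /PhiP[ls [uls sls lsP lsR]].
have /choice[S SP] : forall l, exists s : seq {ffun 'I_2 -> F}, l \in ls ->
    [/\ uniq s, size s = m & forall t : {ffun 'I_2 -> F}, t \in s <->
      [/\ meval t P0 != 0, meval t b != 0 & exists e, at4 (d ^+ 2) (fun i => l * k i) =1 phi f (param_at P0 Pn t) e]].
  move=> l; have [lls|] := boolP (l \in ls); last by exists [::].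
  have [y [fy hy]] := lsR l lls; rewrite mevalM mulf_eq0 negb_or => /andP[hhy by_] [e E] uy.
  have [s [us ss sP]] := hP y fy hhy; exists s => _; split=> // t; split.
    move/sP=> [t0 ty]; split=> //.
      apply: contraNneq by_ => bt; apply/eqP; rewrite -[RHS](b'P t t0 bt).
      by apply: meval_eq => i; rewrite ty.
    exists e => j; rewrite E /phi /pt; case: unliftP => [i|] _.
      by rewrite !mul0r ty /fgrad (meval_eq _ ty).
    by rewrite /fhimp (meval_eq _ ty).
  move=> [t0 bt [e' E']]; apply/sP; split=> //; apply: (uy _ e') => //; first exact: P_in.
  exact: bh.
exists (flatten [seq S l | l <- ls]).
have raysol l t e : meval t b != 0 -> at4 (d ^+ 2) (fun i => l * k i) =1 phi f (param_at P0 Pn t) e ->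
   exists2 e', (forall i, param_at P0 Pn t i + e' * meval t (n i) = l * k i) &
     e' ^+ 2 * \sum_i meval t (n i) ^+ 2 = d ^+ 2.
  move=> bt E; have [nu nu0 nuE] := bn bt; exists (e / nu) => [i|].
    by have := E (lift ord0 i); rewrite at4l phi_lift => ->; rewrite nuE mulrA divfK.
  have := E ord0; rewrite at40 phi0 fhimpE => ->; rewrite !mulr_sumr; apply: eq_bigr => i _.
  by rewrite nuE !exprMn exprVn; field.
split.
- elim: ls uls {sls lsP lsR} SP => //= l ls IH /andP[lls uls] SP.
  have [ul _ lE] := SP l (mem_head _ _); rewrite cat_uniq ul /= IH //; last first.
    by move=> l' h'; apply: SP; rewrite inE h' orbT.
  rewrite andbT; apply/hasPn => t /flatten_mapP[l' l'ls tl']; apply/negP => /lE[_ bt [e E]].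
  have [|_ _ l'E] := SP l'; first by rewrite inE l'ls orbT.
  move/l'E: tl' => [_ _ [e' E']].
  have [e1 e1E _] := raysol _ _ _ bt E; have [e2 e2E _] := raysol _ _ _ bt E'.
  by move: lls; rewrite (ray_unique (bU bt) e1E e2E) l'ls.
- rewrite size_flatten /shape -map_comp -sls; elim: ls {uls sls lsP lsR} SP => [|l ls IH] SP; first by rewrite muln0.
  rewrite /= mulnS IH; last by move=> l' h'; apply: SP; rewrite inE h' orbT.
  by have [_ -> _] := SP l (mem_head _ _).
- move=> t; split.
    move=> /flatten_mapP[l lls]; have [_ _ lE] := SP l lls; move=> /lE[_ bt [e E]]; split=> //.
    by have [e' E1 E2] := raysol _ _ _ bt E; exists e', l.
  move=> [bt [e [l [E1 E2]]]]; have [nu nu0 nuE] := bn bt.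
  have E : at4 (d ^+ 2) (fun i => l * k i) =1 phi f (param_at P0 Pn t) (e * nu).
    move=> j; case: (unliftP ord0 j) => [i|] ->.
      by rewrite at4l phi_lift -E1 nuE mulrA.
    rewrite at40 phi0 fhimpE -E2 !mulr_sumr; apply: eq_bigr => i _.
    by rewrite nuE; ring.
  have lls : l \in ls by apply: lsP E; [apply: P_in; apply: bP0|apply: bh].
  apply/flatten_mapP; exists l => //; have [_ _ lE] := SP l lls; apply/lE; split=> //.
    exact: bP0.
  by exists (e * nu).
Qed.
End ParamCount.

Lemma is_gcd_cancel (F : fieldType) n (a : {mpoly F[n]}) qs : a != 0 ->
  is_gcd [seq a * q | q <- qs] a -> is_gcd qs 1.
Proof.
move=> a0 [_ H]; split=> [q _|h hq]; first by exists q; rewrite mul1r.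
have [r rE] : mdvd (a * h) a.
  apply: H => _ /mapP[q /hq[r ->] ->]; exists r; exact: mulrA.
by exists r; apply: (mulfI a0); rewrite mulr1 {1}rE -mulrA.
Qed.

Lemma cross_all (A : comPzRingType) (a b : 'I_3 -> A) :
  (forall i, cross a b i = 0) -> forall i j, a i * b j = a j * b i.
Proof.
move=> H; have [e0 e1 e2] := crossE a b; have := H 0; have := H 1; have := H 2.
rewrite e0 e1 e2 => /eqP; rewrite subr_eq0 => /eqP h2 /eqP; rewrite subr_eq0 => /eqP h1.
by move=> /eqP; rewrite subr_eq0 => /eqP h0; apply: I3P; apply: I3P.
Qed.

Lemma mnm_subxx n (m : 'X_{1..n}) : (m - m = 0)%MM.
Proof. by apply/mnmP => i; rewrite mnmBE mnm0E subnn. Qed.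

(** * Position and normal vector of the parametrization *)

Section SphereFactor.
Variable F : numClosedFieldType.

Lemma affine_mderiv2 n (p : {mpoly F[n]}) i j : (msize p <= 2)%N -> mderiv i (mderiv j p) = 0.
Proof.
move=> sp; apply/eqP; apply: contrapT => /negP h1.
have h2 : mderiv j p != 0 by apply: contra_neq h1 => ->; rewrite raddf0.
have := msize_mderiv h1; have := msize_mderiv h2.
have : msize (mderiv i (mderiv j p)) != 0%N by rewrite msize_poly_eq0.
move: sp; move: (msize p) (msize (mderiv j p)) (msize (mderiv i (mderiv j p))) => a b c; lia.
Qed.

(** Otherwise both factors are affine, with linear parts a and b, and the matrix a_i b_j + a_j b_i
    of rank at most 2 equals twice the identity of size 3. The contradiction is read off from a_i
    b_i = 1 and (a_i b_j)^2 = -1 for i != j. *)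
Lemma sphere_factor (f r : {mpoly F[3]}) c :
  \sum_i 'X_i ^+ 2 - c%:MP = f * r -> ~~ mconst f -> mconst r.
Proof.
move=> E; rewrite /mconst => nf; rewrite leqNgt; apply/negP => nr.
have sq i : (msize ('X_i ^+ 2 : {mpoly F[3]}) <= 3)%N.
  by rewrite mpolyXn msizeX mdegMn mdeg1.
have s3 : (msize (f * r) <= 3)%N.
  rewrite -E; apply: leq_trans (msizeD_le _ _) _; rewrite msizeN geq_max msizeC.
  apply/andP; split; last by case: (c != 0).
  by apply: leq_trans (msize_sum _ _ _) _; apply/bigmax_leqP => i _.
have f0 : f != 0 by apply: contraNneq nf => ->; rewrite msize0.
have r0 : r != 0 by apply: contraTneq nr => ->; rewrite msize0.
have [sf sr] : (msize f <= 2)%N /\ (msize r <= 2)%N.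
  move: s3 nf nr; rewrite msizeM //; move: (msize f) (msize r) => a b; rewrite -ltnNge; lia.
pose a i := meval (fun=> 0) (mderiv i f); pose b i := meval (fun=> 0) (mderiv i r).
have D i j : (2 * (i == j))%:R = a i * b j + a j * b i.
  have : meval (fun=> 0) (mderiv i (mderiv j (f * r))) = a i * b j + a j * b i.
    rewrite !mderivM mderivD !mderivM !affine_mderiv2 // mulr0 mul0r add0r addr0.
    by rewrite mevalD !mevalM /a /b addrC [X in X + _]mulrC [X in _ + X]mulrC addrC mulrC [X in _ + X]mulrC.
  rewrite -E mderivB mderivC subr0 => <-.
  have -> : mderiv j (\sum_l 'X_l ^+ 2) = 'X_j *+ 2 :> {mpoly F[3]}.
    have dX (l : 'I_3) : mderiv j 'X_l = (j == l)%:R :> {mpoly F[3]}.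
      by rewrite mderivX mnm1E; have [->|] := eqVneq l j; rewrite ?mnm_subxx ?mpolyX0 ?scale1r ?scale0r.
    rewrite (big_morph (mderiv j) (mderivD j) (raddf0 (mderiv j))) (bigD1 j) //= big1 ?addr0.
      by rewrite expr2 mderivM dX eqxx mul1r mulr1 mulr2n.
    by move=> l lj; rewrite expr2 mderivM dX eq_sym (negbTE lj) mul0r mulr0 addr0.
  rewrite mderivMn mevalMn mderivX mnm1E; have [->|_] := eqVneq j i.
    by rewrite scale1r mnm_subxx mpolyX0 meval1 muln1.
  by rewrite scale0r meval0 mul0rn muln0.
have two : 2%:R != 0 :> F by rewrite pnatr_eq0.
have ab i : a i * b i = 1.
  have h := D i i; rewrite eqxx muln1 in h.
  by apply: (mulfI two); rewrite mulr1 [RHS]h mulr_natl mulr2n.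
have anti i j : i != j -> a i * b j = - (a j * b i).
  by move=> ij; apply/eqP; rewrite -addr_eq0 -D (negbTE ij) muln0.
have sqr i j : i != j -> (a i * b j) ^+ 2 = -1.
  move=> ij; rewrite expr2 {1}anti // mulNr -(mulr1 1) -{1}(ab i) -(ab j); ring.
have h02 := sqr 0 2 isT; have h01 := sqr 0 1 isT; have h12 := sqr 1 2 isT.
have : (a 0 * b 2) ^+ 2 = 1.
  rewrite -[_ * _]mul1r -(ab 1) (_ : _ * _ * _ = (a 0 * b 1) * (a 1 * b 2)); last by ring.
  by rewrite exprMn h01 h12 mulrNN mulr1.
rewrite h02 => /eqP; rewrite -subr_eq0 -opprD oppr_eq0 => h.
by move: two; rewrite (_ : 2%:R = 1 + 1 :> F) // h.
Qed.

End SphereFactor.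

Section Jacobian.
Variable F : numClosedFieldType.
Variables (P0 : {mpoly F[2]}) (p : 'I_2 -> {mpoly F[2]}).
Hypothesis P0_nz : P0 != 0.
Hypothesis indep : forall E : {mpoly F[2]}, E != 0 -> exists t, meval t P0 != 0 /\
  meval (fun i => meval t (p i) / meval t P0) E != 0.

Let dn i l : {mpoly F[2]} := mderiv l (p i) * P0 - p i * mderiv l P0.

(* A relation between p_0/P0, p_1/P0 and t_l of minimal degree in t_l has a nonvanishing
   derivative with respect to t_l. *)
Lemma param_relation (l : 'I_2) : exists c : {mpoly F[2]}, c != 0 /\
  forall t, meval t P0 != 0 -> meval t c != 0 -> exists (a : 'I_2 -> F) e, e != 0 /\
    forall r, \sum_i a i * meval t (dn i r) = e * (r == l)%:R.
Proof.
pose a (j : 'I_3) : {mpoly F[2]} := if unlift ord0 j is Some i then p i else 'X_l * P0.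
have aE0 : a ord0 = 'X_l * P0 by rewrite /a unlift_none.
have aEl i : a (lift ord0 i) = p i by rewrite /a liftK.
pose rho t (j : 'I_3) := meval t (a j) / meval t P0.
pose Rel (q : {mpoly F[3]}) := forall t, meval t P0 != 0 -> meval (rho t) q = 0.
have [E0 E00 E0P] := alg_dependent a P0.
have [|q [q0 qP qmin]] := @ex_min_size _ (fun q => Rel (fromP ord0 (fun=> 0) q)).
  exists (toP ord0 (fun=> 0) E0); first by rewrite toP_eq0.
  by rewrite toPK.
set E := fromP ord0 (fun=> 0) q in qP.
have [t1 [t10 t1E]] : exists t, meval t P0 != 0 /\ meval (rho t) (mderiv ord0 E) != 0.
  apply: contrapT => H.
  have {}H : Rel (mderiv ord0 E).
    by move=> t t0; apply/eqP; apply: contrapT => /negP h; apply: H; exists t.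
  have dE : toP ord0 (fun=> 0) (mderiv ord0 E) = q^`() by rewrite -toP_deriv fromPK.
  have [d0|d0] := eqVneq q^`() 0; last first.
    have := qmin _ d0; rewrite -dE toPK => /(_ H).
    by rewrite dE leqNgt lt_size_deriv.
  have /size1_polyC qC : (size q <= 1)%N.
    apply: (deriv0_size _ d0) => k; rewrite -(rmorph_nat (@mpolyC _ F)) mpolyC_eq0.
    by rewrite pnatr_eq0.
  have c0 : q`_0 != 0 by apply: contra_neq q0 => h; rewrite qC h polyC0.
  have [t [t0 /eqP]] := indep c0; apply; rewrite -[RHS](qP t t0).
  have -> : E = fromC ord0 (fun=> 0) q`_0 by rewrite /E {1}qC fromPC.
  rewrite meval_fromC.
  by apply: meval_eq => i; rewrite /rho aEl.
have [c c0 cP] := ratfun_nonzero t10 t1E.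
exists c; split=> // t t0 /(cP t t0) d0.
have := ratfun_deriv qP; move=> /(_ t _ t0) R.
exists (fun i => meval (rho t) (mderiv (lift ord0 i) E)).
exists (- (meval (rho t) (mderiv ord0 E) * meval t P0 ^+ 2)); split.
  by rewrite oppr_eq0 mulf_neq0 // expf_neq0.
move=> r; have := R r; rewrite big_ord_recl => /eqP; rewrite addrC addr_eq0 => /eqP h.
rewrite mulNr -mulrA (_ : meval t P0 ^+ 2 * (r == l)%:R =
  meval t (mderiv r (a ord0)) * meval t P0 - meval t (a ord0) * meval t (mderiv r P0)); last first.
  rewrite aE0 mderivM mevalD !mevalM mevalXU mderivX mnm1E eq_sym.
  case: (eqVneq l r) => [->|lr]; first by rewrite scale1r mnm_subxx mpolyX0 meval1 /=; ring.
  by rewrite scale0r meval0 /=; ring.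
rewrite -h; apply: eq_bigr => i _; rewrite aEl /dn mevalB !mevalM //.
Qed.

(** At a general point the relations for the two parameters give combinations of the rows of the
    Jacobian matrix equal to nonzero multiples of the two unit vectors. *)
Lemma jacobian_neq0 : dn 0 ord0 * dn 1 ord_max != dn 1 ord0 * dn 0 ord_max.
Proof.
have [c [c0 cP]] := param_relation ord0; have [c' [c'0 c'P]] := param_relation ord_max.
have [|t] := @mpoly_nonroot _ _ (P0 * c * c'); first by rewrite !mulf_neq0.
rewrite !mevalM !mulf_eq0 !negb_or -andbA => /and3P[t0 ct c't].
have [a [e [e0 aE]]] := cP t t0 ct; have [b [e' [e'0 bE]]] := c'P t t0 c't.
apply/eqP => /(congr1 (meval t)); rewrite !mevalM => J.
have := aE ord0; have := aE ord_max; have := bE ord0; have := bE ord_max.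
rewrite !big_ord_recl !big_ord0 !addr0 /= !mulr1 !mulr0.
rewrite (_ : lift ord0 ord0 = 1); last exact: val_inj.
set u := meval t (dn 0 ord0) in J *; set v := meval t (dn 1 ord0) in J *.
set w := meval t (dn 0 ord_max) in J *; set x := meval t (dn 1 ord_max) in J *.
move=> h1 h2 h3 h4.
have : e * e' = 0.
  rewrite -h4 -h1.
  have -> : (a ord0 * u + a 1 * v) * (b ord0 * w + b 1 * x) =
     (a ord0 * w + a 1 * x) * (b ord0 * u + b 1 * v) + (a ord0 * b 1 - a 1 * b ord0) * (u * x - v * w) by ring.
  by rewrite h3 J subrr mulr0 mul0r addr0.
by move/eqP; rewrite mulf_eq0 (negbTE e0) (negbTE e'0).
Qed.
End Jacobian.

Lemma wronskian_mpoly (F : numClosedFieldType) n (u v : {mpoly F[n]}) t0 :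
  (forall r, mderiv r u * v = u * mderiv r v) -> meval t0 v != 0 ->
  forall t, meval t u = meval t0 u / meval t0 v * meval t v.
Proof.
move=> H v0 t.
pose L := lineX predT t0 (fun i => t i - t0 i); pose ev p := mmap polyC L p.
have evE p s : (ev p).[s] = meval (fun i => t0 i + (t i - t0 i) * s) p.
  by rewrite horner_lineX.
have ev0 p : (ev p).[0] = meval t0 p.
  by rewrite evE; apply: meval_eq => i; rewrite mulr0 addr0.
have ev1 p : (ev p).[1] = meval t p.
  by rewrite evE; apply: meval_eq => i; rewrite mulr1 addrC subrK.
have D p : (ev p)^`() = \sum_i ev (mderiv i p) * (L i)^`().
  exact: (@mmap_chain_rule F {poly F} n polyC L (@deriv F) p
    (fun a b => derivM a b) (fun a => derivC a)).
have : ev u = ((ev u).[0] / (ev v).[0]) *: ev v.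
  apply: wronskian0; first by rewrite ev0.
  rewrite !D mulr_suml mulr_sumr; apply: eq_bigr => i _.
  have : ev (mderiv i u * v) = ev (u * mderiv i v) by rewrite H.
  by rewrite /ev !rmorphM /= => h; rewrite mulrAC h mulrA.
by move/(congr1 (fun p => p.[1])); rewrite hornerZ !ev1 !ev0.
Qed.

Lemma meval_cross (F : fieldType) n z (a b : 'I_3 -> {mpoly F[n]}) i :
  meval z (cross a b i) = cross (fun j => meval z (a j)) (fun j => meval z (b j)) i.
Proof. by rewrite /cross mevalB !mevalM. Qed.

Lemma eq_cross (A : comPzRingType) (a a' b b' : 'I_3 -> A) i :
  a =1 a' -> b =1 b' -> cross a b i = cross a' b' i.
Proof. by move=> ha hb; rewrite /cross !ha !hb. Qed.

Lemma cross_scale (A : comPzRingType) (a b : 'I_3 -> A) x y i :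
  cross (fun j => x * a j) (fun j => y * b j) i = x * y * cross a b i.
Proof. by rewrite /cross; ring. Qed.

Lemma cross_orth (A : comPzRingType) (a b : 'I_3 -> A) :
  \sum_i cross a b i * a i = 0 /\ \sum_i cross a b i * b i = 0.
Proof. by have [e0 e1 e2] := crossE a b; rewrite !sum3E e0 e1 e2; split; ring. Qed.

Lemma meval_dehom (F : fieldType) t (p : {mpoly F[3]}) :
  meval t (dehom p) = meval (vec3 1 (t ord0) (t ord_max)) p.
Proof.
rewrite /dehom comp_mpoly_meval; apply: meval_eq; apply: I3P => /=.
- by rewrite /tnth /= meval1.
- by rewrite /tnth /= mevalXU.
- by rewrite /tnth /= mevalXU.
Qed.

Section Basics.
Variable F : numClosedFieldType.
Variable f : {mpoly F[3]}.
Hypothesis f_irr : mirreducible f.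
Hypothesis himp_nz : exists y, meval y f = 0 /\ meval y (himp f) != 0.
Hypothesis assum2 : ~ exists r : F, r != 0 /\
  forall y, meval y f = 0 <-> \sum_(i < 3) (y i) ^+ 2 = r.
Variables (P0 : {mpoly F[2]}) (Pn : 'I_3 -> {mpoly F[2]}).
Hypothesis P0_nz : P0 != 0.
Hypothesis P_in : forall t, meval t P0 != 0 -> meval (param_at P0 Pn t) f = 0.
Hypothesis P_dense : forall q : {mpoly F[3]},
  (forall t, meval t P0 != 0 -> meval (param_at P0 Pn t) q = 0) ->
  forall y, meval y f = 0 -> meval y q = 0.

Let A := Acomp P0 Pn.

Lemma param_grad t : meval t P0 != 0 -> forall i,
  cross (fun j => meval t (A j)) (fgrad f (param_at P0 Pn t)) i = 0.
Proof.
move=> t0 i; have D l := ratfun_deriv P_in l t0.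
have DV l : \sum_i fgrad f (param_at P0 Pn t) i * meval t (dnum P0 Pn i l) = 0.
  rewrite -[RHS](D l); apply: eq_bigr => j _; rewrite /dnum mevalB !mevalM //.
have := cross_cross0 (DV ord0) (DV ord_max) i.
by rewrite [LHS](@eq_cross _ _ (fun j => meval t (A j)) _ (fgrad f (param_at P0 Pn t))) // => j; rewrite /A /Acomp meval_cross.
Qed.

(** Leave out a coordinate l on which [f] depends. Density in the surface makes the other two
    coordinates of P algebraically independent, so their Jacobian, a component of [A] up to sign, is
    nonzero. *)
Lemma Acomp_neq0 : exists i, A i != 0.
Proof.
apply: contrapT => H.
have A0 i : A i = 0 by apply/eqP; apply: contrapT => /negP h; apply: H; exists i.
have [l fl] := rprime_nonconst_deriv (mirreducible_prime f_irr).
suff ind : forall E : {mpoly F[2]}, E != 0 -> exists t, meval t P0 != 0 /\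
    meval (fun i => meval t (Pn (lift l i)) / meval t P0) E != 0.
  have /eqP := jacobian_neq0 P0_nz ind; apply; rewrite -!/(dnum _ _ _ _).
  exact: (cross_all A0).
move=> E E0.
  have [b' b'E] := ex_comp_mpoly (fun i : 'I_2 => 'X_(lift l i) : {mpoly F[3]}) E.
  have b'0 : b' != 0.
    have [z zE] := mpoly_nonroot E0; apply: contra_neq zE => h.
    have := b'E (pt l (fun=> 0) z 0); rewrite h meval0 => ->; apply: meval_eq => i.
    by rewrite mevalXU /pt liftK mul0r addr0.
  have [x [s [qx fx]]] := line_root b'0 fl.
  apply: contrapT => K; move/eqP: qx; apply.
  rewrite -[RHS](_ : meval (pt l (fun=> 0) (fun j => x (lift l j)) s) b' = 0).
    rewrite !b'E; apply: meval_eq => i; by rewrite !mevalXU /pt liftK mul0r addr0.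
  apply: P_dense fx => t t0; apply/eqP; apply: contrapT => /negP h; apply: K.
  exists t; split=> //; apply: contra_neq h => <-; rewrite b'E; apply: meval_eq => i.
  by rewrite mevalXU.
Qed.

Variables (gA : {mpoly F[2]}) (n : 'I_3 -> {mpoly F[2]}).
Hypothesis n_def : forall j, A j = gA * n j.

Lemma gA_neq0 : gA != 0.
Proof. by have [j] := Acomp_neq0; rewrite n_def; apply: contra_neq => ->; rewrite mul0r. Qed.

Lemma normal_parallel t : meval t P0 != 0 -> meval t gA != 0 ->
  fhimp f (param_at P0 Pn t) != 0 -> exists nu,
  forall i, meval t (n i) = nu * fgrad f (param_at P0 Pn t) i.
Proof.
move=> t0 g0 h0; have [j gj] := fhimp_grad h0.
exists (meval t (n j) / fgrad f (param_at P0 Pn t) j) => i.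
apply: (cross0_parallel (a := fgrad f (param_at P0 Pn t)) (b := fun i => meval t (n i)) gj) => l; have := param_grad t0 l.
rewrite /cross !n_def !mevalM => h; apply: (mulfI g0); rewrite mulr0 -oppr0 -[in RHS]h; ring.
Qed.

Lemma himp_param : exists2 c : {mpoly F[2]}, c != 0 & forall t, meval t P0 != 0 ->
  meval t c != 0 -> fhimp f (param_at P0 Pn t) != 0.
Proof.
have [t [t0 h0]] : exists t, meval t P0 != 0 /\ meval (param_at P0 Pn t) (himp f) != 0.
  apply: contrapT => H; have [y [fy /eqP]] := himp_nz; apply; apply: P_dense fy => t t0.
  by apply/eqP; apply: contrapT => /negP h; apply: H; exists t.
exact: ratfun_nonzero t0 h0.
Qed.

Lemma normal_sq : \sum_i n i ^+ 2 != 0.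
Proof.
have [c c0 cP] := himp_param; have [j Aj] := Acomp_neq0.
have [|t] := @mpoly_nonroot _ _ (P0 * c * A j); first by rewrite !mulf_neq0.
rewrite !mevalM !mulf_eq0 !negb_or -andbA => /and3P[t0 ct At].
have g0 : meval t gA != 0 by apply: contra_neq At; rewrite n_def mevalM => ->; rewrite mul0r.
have n0 : meval t (n j) != 0 by apply: contra_neq At; rewrite n_def mevalM => ->; rewrite mulr0.
have h0 := cP t t0 ct; have [nu nuE] := normal_parallel t0 g0 h0.
have nu0 : nu != 0 by apply: contra_neq n0; rewrite nuE => ->; rewrite mul0r.
apply/eqP => /(congr1 (meval t)); rewrite meval0 raddf_sum /= => /eqP; apply/negP.
rewrite (eq_bigr (fun i => nu ^+ 2 * fgrad f (param_at P0 Pn t) i ^+ 2)); last first.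
  by move=> i _; rewrite rmorphXn /= nuE exprMn.
by rewrite -mulr_sumr -fhimpE mulf_neq0 // expf_neq0.
Qed.

(** If the position were parallel to the normal it would be orthogonal to both tangent vectors, so
    the sum of the squares of the coordinates of P would be a constant c. Then [f] divides, hence is
    up to a constant, the equation of a sphere centered at the origin. *)
Lemma position_normal : exists i, cross Pn n i != 0.
Proof.
apply: contrapT => H.
have PA i : cross Pn A i = 0.
  rewrite (@eq_cross _ Pn (fun j => 1 * Pn j) A (fun j => gA * n j)) ?cross_scale //.
    rewrite mul1r; apply/eqP; rewrite mulf_eq0 (negbTE gA_neq0) /=.
    by apply: contrapT => /negP h; apply: H; exists i.
  by move=> j; rewrite mul1r.
have [j Aj] := Acomp_neq0.
have PV r : \sum_i Pn i * dnum P0 Pn i r = 0.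
  have AV : \sum_i A i * dnum P0 Pn i r = 0.
    have [h0 h1] := cross_orth (dnum P0 Pn ^~ ord0) (dnum P0 Pn ^~ ord_max).
    have [->|->] : r = ord0 \/ r = ord_max; [|exact: h0|exact: h1].
    by case: r => -[|[|//]] ?; [left|right]; apply: val_inj.
  apply: (mulfI Aj); rewrite mulr0 mulr_sumr -[RHS](mulr0 (Pn j)) -[in RHS]AV mulr_sumr.
  by apply: eq_bigr => i _; rewrite !mulrA; congr (_ * _); rewrite mulrC (cross_all PA) mulrC.
have [t0 t00] := mpoly_nonroot P0_nz.
pose u := \sum_i Pn i ^+ 2.
have W := @wronskian_mpoly F 2 u (P0 ^+ 2) t0.
have {}W : forall t, meval t u = meval t0 u / meval t0 (P0 ^+ 2) * meval t (P0 ^+ 2).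
  apply: W; last by rewrite rmorphXn /= expf_neq0.
  move=> r; apply/eqP; rewrite -subr_eq0; apply/eqP.
  rewrite /u (big_morph (mderiv r) (mderivD r) (raddf0 (mderiv r))).
  rewrite -[RHS](mulr0 (P0 * 2%:R)) -[in RHS](PV r) !mulr_suml mulr_sumr -sumrB.
  by apply: eq_bigr => i _; rewrite /dnum !expr2 !mderivM; ring.
set c := meval t0 u / _ in W.
have Pc t : meval t P0 != 0 -> meval (param_at P0 Pn t) (\sum_i 'X_i ^+ 2 - c%:MP) = 0.
  move=> tn; apply/eqP; rewrite mevalB mevalC subr_eq0 raddf_sum /=.
  rewrite -(inj_eq (mulIf (expf_neq0 2 tn))) mulr_suml.
  move: (W t); rewrite rmorphXn /= => <-; rewrite /u raddf_sum /=; apply/eqP.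
  by apply: eq_bigr => i _; rewrite !rmorphXn /= mevalXU /param_at -exprMn divfK.
have [r rE] := rprime_nullstellensatz (mirreducible_prime f_irr) (P_dense Pc).
have [nf _] := f_irr; have /msize1_polyC rC := sphere_factor rE nf.
set rho := r@_0 in rC; rewrite rC in rE.
have val y : \sum_i y i ^+ 2 - c = meval y f * rho.
  rewrite -[rho](mevalC y) -mevalM -rE mevalB mevalC raddf_sum /=; congr (_ - _).
  by apply: eq_bigr => i _; rewrite rmorphXn /= mevalXU.
have rho0 : rho != 0.
  apply/eqP => h; have := val (vec3 (sqrtC (c + 1)) 0 0).
  by rewrite h mulr0 sum3E /vec3 /= sqrtCK expr0n /= !addr0 addrC addKr => /eqP; rewrite oner_eq0.
have fE y : meval y f = 0 <-> \sum_i y i ^+ 2 = c.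
  have vy := val y; split=> h; move: vy; rewrite h.
    by rewrite mul0r => /eqP; rewrite subr_eq0 => /eqP.
  by rewrite subrr => /esym/eqP; rewrite mulf_eq0 (negbTE rho0) orbF => /eqP.
(* For c = 0 the surface is the isotropic cone, which [assum2] does not cover; its gradient is
   proportional to the position, so [himp f] vanishes on it. *)
have [c0|c0] := eqVneq c 0; last by apply: assum2; exists c.
have [y [fy /eqP]] := himp_nz; apply.
have gr i : fgrad f y i * rho = y i *+ 2.
  have := congr1 (fun q => meval y (mderiv i q)) rE.
  rewrite /= mderivM mderivC mulr0 addr0 mevalM mevalC -/(fgrad f y i) => <-.
  rewrite mderivB mderivC subr0 (big_morph (mderiv i) (mderivD i) (raddf0 (mderiv i))).
  rewrite (bigD1 i) //= big1 ?addr0; last first.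
    by move=> l li; rewrite expr2 mderivM mderivX mnm1E (negbTE li) scale0r mul0r mulr0 addr0.
  rewrite expr2 mderivM mderivX mnm1E eqxx scale1r mnm_subxx mpolyX0 mul1r mulr1.
  by rewrite mevalD mevalXU.
apply: (mulIf (expf_neq0 2 rho0)); rewrite mul0r -/(fhimp f y) fhimpE mulr_suml.
rewrite (eq_bigr (fun i => 4 * y i ^+ 2)); last by move=> i _; rewrite -exprMn gr; ring.
by rewrite -mulr_sumr (fE y).1 // c0 mulr0.
Qed.
End Basics.

(** * Contents *)

Section Content.
Variables (F : numClosedFieldType) (n : nat) (S : pred 'I_n.+1).
Implicit Types p q a : {mpoly F[n.+1]}.

Definition agree (w w' : 'I_n.+1 -> F) : Prop := forall j, ~~ S j -> w j = w' j.
Definition sfree q : Prop := forall w w', agree w w' -> meval w q = meval w' q.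

(** Along a direction in the variables [S] the product restricts to a constant; where it is nonzero,
    degrees force each factor to be constant as well. *)
Lemma sfree_factor u v : u * v != 0 -> sfree (u * v) -> sfree u.
Proof.
move=> uv0 fuv w w' ww'; pose d j := w' j - w j.
have dS j : ~~ S j -> d j = 0 by move=> /ww' h; rewrite /d h subrr.
have [D DE] := ex_comp_mpoly (fun j => 'X_j + (d j)%:MP : {mpoly F[n.+1]}) u.
have {}DE z : meval z D = meval (fun j => z j + d j) u.
  by rewrite DE; apply: meval_eq => j; rewrite mevalD mevalXU mevalC.
suff : D - u = 0.
  move/eqP; rewrite subr_eq0 => /eqP h; rewrite -{1}h DE; apply: meval_eq => j.
  by rewrite /d addrC subrK.
apply: (mulIf uv0); rewrite mul0r; apply: mpoly_eq0P => z; rewrite mevalM.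
have [->|z0] := eqVneq (meval z (u * v)) 0; first by rewrite mulr0.
rewrite mevalB DE.
pose L q := mmap polyC (lineX predT z d) q.
have LE q s : (L q).[s] = meval (fun j => z j + d j * s) q by rewrite horner_lineX.
have LC : L u * L v = (meval z (u * v))%:P.
  rewrite -rmorphM; apply/eqP; rewrite -subr_eq0; apply/eqP/poly_eq0P => s.
  rewrite !hornerE LE; apply/eqP; rewrite subr_eq0; apply/eqP.
  by apply: fuv => j /dS ->; rewrite mul0r addr0.
have /size1_polyC uC : (size (L u) <= 1)%N.
  have u0 : L u != 0 by apply: contra_neq z0 => h; move: LC; rewrite h mul0r => /esym/eqP; rewrite polyC_eq0 => /eqP.
  have v0 : L v != 0 by apply: contra_neq z0 => h; move: LC; rewrite h mulr0 => /esym/eqP; rewrite polyC_eq0 => /eqP.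
  have : size (L u * L v) = 1%N by rewrite LC size_polyC z0.
  rewrite size_mul //; move: u0 v0; rewrite -!size_poly_eq0.
  by move: (size (L u)) (size (L v)) => x y; lia.
have e1 : meval (fun j => z j + d j) u = (L u).[1].
  by rewrite LE; apply: meval_eq => j; rewrite mulr1.
have e0 : meval z u = (L u).[0] by rewrite LE; apply: meval_eq => j; rewrite mulr0 addr0.
by rewrite e1 e0 uC !hornerC subrr mul0r.
Qed.

Definition coefm p (m0 : 'X_{1..n.+1}) : {mpoly F[n.+1]} :=
  \sum_(m <- msupp p | mrestr S m == m0) p@_m *: 'X_[mrestr (predC S) m].

Lemma sfree_mono (m : 'X_{1..n.+1}) w w' : agree w w' ->
  \prod_j w j ^+ mrestr (predC S) m j = \prod_j w' j ^+ mrestr (predC S) m j.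
Proof.
move=> ww'; apply: eq_bigr => j _; rewrite mnmE /=.
by case: ifP => // nS; rewrite ww'.
Qed.

Lemma sfree_coefm p m0 : sfree (coefm p m0).
Proof.
move=> w w' ww'; rewrite /coefm [meval w _]raddf_sum [meval w' _]raddf_sum /=; apply: eq_bigr => m _.
by rewrite !mevalZ !mevalX; congr (_ * _); apply: sfree_mono.
Qed.

Lemma mrestr_split (m : 'X_{1..n.+1}) : m = (mrestr (predC S) m + mrestr S m)%MM.
Proof.
by apply/mnmP => j; rewrite mnmDE /mrestr !mnmE /=; case: (S j); rewrite ?addn0.
Qed.

Definition keys p := [seq mrestr S m | m <- msupp p].

Lemma coefm_sum p : p = \sum_(m0 <- undup (keys p)) coefm p m0 * 'X_[m0].
Proof.
rewrite {1}[p]mpolyE /coefm.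
transitivity (\sum_(m0 <- undup (keys p)) \sum_(m <- msupp p) if mrestr S m == m0 then p@_m *: 'X_[m] else 0 : {mpoly F[n.+1]}).
  rewrite exchange_big /= big_seq [RHS]big_seq; apply: eq_bigr => m mp.
  rewrite (bigD1_seq (mrestr S m)) ?undup_uniq //=; last by rewrite mem_undup; apply: map_f.
  by rewrite eqxx big1 ?addr0 // => m0 /negbTE; rewrite eq_sym => ->.
apply: eq_bigr => m0 _; rewrite -big_mkcond /= mulr_suml; apply: eq_bigr => m /eqP <-.
by rewrite -scalerAl -mpolyXD -mrestr_split.
Qed.

Lemma content_sfree p a : p != 0 -> is_gcd (coefs_in S p) a -> a != 0 /\ sfree a.
Proof.
move=> p0 [aD _].
have [m0 m0k c0] : exists2 m0, m0 \in undup (keys p) & coefm p m0 != 0.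
  apply: contrapT => H; move/eqP: p0; apply; rewrite (coefm_sum p) big_seq big1 // => m0 m0k.
  suff -> : coefm p m0 = 0 by rewrite mul0r.
  by apply/eqP; apply: contrapT => /negP h; apply: H; exists m0.
have [|r rE] := aD (coefm p m0); first by apply: map_f; rewrite mem_undup in m0k.
rewrite rE in c0; split; first by apply: contra_neq c0 => ->; rewrite mul0r.
by apply: (sfree_factor c0); rewrite -rE; apply: sfree_coefm.
Qed.

(** The coefficients of [p'] are coprime and free of [S]. Where the eliminated constant is nonzero
    they have no common zero on the line, so at each of its points [p'] is a nonzero polynomial in
    the variables [S]. *)
Lemma content_line p a p' i (eta : 'I_n -> F) : p != 0 -> is_gcd (coefs_in S p) a ->
  p = a * p' -> exists2 psi : {mpoly F[n]}, psi != 0 & forall z, meval z psi != 0 ->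
    forall s, exists2 w, agree w (pt i eta z s) & meval w p' != 0.
Proof.
move=> p0 ga pE; have [a0 fa] := content_sfree p0 ga.
have [aD _] := ga.
have /choice[q qE] : forall m0, exists q, m0 \in keys p -> coefm p m0 = a * q.
  move=> m0; have [m0k|] := boolP (m0 \in keys p); last by exists 0.
  by have [|r ->] := aD (coefm p m0); [apply: map_f|exists r].
have fq m0 : m0 \in keys p -> sfree (q m0).
  move=> m0k; have [q0|q0] := eqVneq (q m0) 0; first by move=> w w' _; rewrite q0 !meval0.
  have h := @sfree_factor (q m0) a; rewrite mulrC -(qE _ m0k) in h; apply: h.
    by rewrite qE // mulf_neq0.
  exact: sfree_coefm.
have p'E : p' = \sum_(m0 <- undup (keys p)) q m0 * 'X_[m0].
  apply: (mulfI a0); rewrite -pE mulr_sumr {1}(coefm_sum p) big_seq [RHS]big_seq.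
  by apply: eq_bigr => m0; rewrite mem_undup => m0k; rewrite qE // mulrA.
have g1 : is_gcd [seq q m0 | m0 <- keys p] 1.
  apply: (is_gcd_cancel a0); rewrite -map_comp.
  suff <- : coefs_in S p = [seq a * q m0 | m0 <- keys p] by [].
  by apply/eq_in_map => m0 m0k; rewrite -qE.
have p'0 : p' != 0 by apply: contra_neq p0; rewrite pE => ->; rewrite mulr0.
have [||psi psi0 psiP] := elim_line i eta (qs := [seq q m0 | m0 <- keys p]).
- apply: contrapT => H; move/eqP: p'0; apply; rewrite p'E big_seq big1 // => m0; rewrite mem_undup => m0k.
  suff -> : q m0 = 0 by rewrite mul0r.
  by apply/eqP; apply: contrapT => /negP h; apply: H; exists (q m0) => //; apply: map_f.
- exact: is_gcd1_nocommon.
exists psi => // z zpsi s; have [_ /mapP[m1 m1k ->] q1] := psiP z zpsi s.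
pose x0 := pt i eta z s.
pose r : {mpoly F[n.+1]} := \sum_(m0 <- undup (keys p)) meval x0 (q m0) *: 'X_[m0].
have [|x xr] := @mpoly_nonroot _ _ r.
  apply: contra_neq q1 => /(congr1 (mcoeff m1)); rewrite mcoeff0 /r [mcoeff m1 _]raddf_sum /=.
  rewrite (bigD1_seq m1) ?undup_uniq ?mem_undup //= mcoeffZ mcoeffX eqxx mulr1.
  rewrite big1 ?addr0 // => m0 m01; by rewrite mcoeffZ mcoeffX (negbTE m01) mulr0.
pose w j := if S j then x j else x0 j.
have wx0 : agree w x0 by move=> j nS; rewrite /w (negbTE nS).
exists w => //; apply: contra_neq xr => <-; rewrite p'E /r [meval w _]raddf_sum [meval x _]raddf_sum /= big_seq [RHS]big_seq.
apply: eq_bigr => m0; rewrite mem_undup => m0k; rewrite mevalM mevalZ !mevalX (fq _ m0k _ _ wx0).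
congr (_ * _); have /mapP[m _ ->] := m0k; apply: eq_bigr => j _.
by rewrite mnmE /w; case: (S j).
Qed.
End Content.

(** * Sections by the planes t2 = ups + eta t1 *)

Section Points.
Variable F : numClosedFieldType.

Definition z10 (s t1 t2 d : F) (k c : 'I_3 -> F) (j : 'I_10) : F :=
  nth 0 [:: s; t1; t2; d; k 0; k 1; k 2; c 0; c 1; c 2] j.

Lemma meval_emb s t1 t2 d k c p :
  meval (z10 s t1 t2 d k c) (emb p) = meval (vec3 s t1 t2) p.
Proof.
rewrite /emb comp_mpoly_meval; apply: meval_eq; apply: I3P => /=;
by rewrite /tnth /= /var mevalXU /z10 inordK.
Qed.

Lemma meval_kvar s t1 t2 d k c i : meval (z10 s t1 t2 d k c) (kvar F i) = k i.
Proof. by rewrite /kvar /var mevalXU /z10; move: i; apply: I3P; rewrite inordK. Qed.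

Lemma meval_cvar s t1 t2 d k c i : meval (z10 s t1 t2 d k c) (cvar F i) = c i.
Proof. by rewrite /cvar /var mevalXU /z10; move: i; apply: I3P; rewrite inordK. Qed.

Lemma meval_dvar s t1 t2 d k c : meval (z10 s t1 t2 d k c) (dvar F) = d.
Proof. by rewrite /dvar /var mevalXU /z10 inordK. Qed.

Lemma z10_all (w : 'I_10 -> F) : exists s t1 t2 d k c, w =1 z10 s t1 t2 d k c.
Proof.
exists (w (inord 0)), (w (inord 1)), (w (inord 2)), (w (inord 3)),
  (fun i => w (inord (4 + i))), (fun i => w (inord (7 + i))) => j; rewrite /z10.
rewrite -{1}[j]inord_val.
by case: j => -[|[|[|[|[|[|[|[|[|[|//]]]]]]]]]] h.
Qed.

Lemma horner_upoly0 n (p : {mpoly F[n.+1]}) z s :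
  (map_poly (meval z) (upoly0 p)).[s] = meval (fun j => if j == ord0 then s else z j) p.
Proof.
rewrite /upoly0 [in RHS](mpolyE p) rmorph_sum /= horner_sum [RHS]raddf_sum /=.
apply: eq_bigr => m _; rewrite rmorphM /= map_polyC map_polyXn /= hornerM hornerC hornerXn.
rewrite !mevalZ !mevalX -mulrA; congr (_ * _).
rewrite (bigD1 ord0) //= [RHS](bigD1 ord0) //= mnmE /= expr0 mul1r mulrC; congr (_ * _).
by apply: eq_bigr => j j0; rewrite mnmE j0 (negbTE j0).
Qed.

Lemma meval_t0 s s' t1 t2 d k c (p : {mpoly F[10]}) :
  meval (fun j => if j == ord0 then s else z10 s' t1 t2 d k c j) p =
  meval (z10 s t1 t2 d k c) p.
Proof. by apply: meval_eq => -[[|j] h]. Qed.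

Lemma upoly0_ext (z z' : 'I_10 -> F) (p : {mpoly F[10]}) : (forall j, j != ord0 -> z j = z' j) ->
  map_poly (meval z) (upoly0 p) = map_poly (meval z') (upoly0 p).
Proof.
move=> zz'; apply/eqP; rewrite -subr_eq0; apply/eqP/poly_eq0P => s.
rewrite hornerD hornerN !horner_upoly0; apply/eqP; rewrite subr_eq0; apply/eqP.
by apply: meval_eq => j; case: eqP => // /eqP/zz'.
Qed.

Lemma cof_slant n (q : {mpoly F[n]}) (i j : 'I_n) eta : i != j -> q != 0 ->
  cof (fun ups => exists z, z j = ups + eta * z i /\ meval z q != 0).
Proof.
move=> ij q0; have [z zq] := mpoly_nonroot q0.
pose a l := if l == j then eta * z i else z l.
have LE s := horner_lineX (pred1 j) a (fun=> 1) q s.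
exists (mmap polyC (lineX (pred1 j) a (fun=> 1)) q).
  apply: contra_neq zq => h; have := LE (z j - eta * z i); rewrite h horner0 => ->.
  by apply: meval_eq => l; rewrite /a /=; case: eqP => // ->; rewrite mul1r addrC subrK.
move=> s; rewrite LE => h; eexists; split; last exact: h.
by rewrite /a /= eqxx (negbTE ij) mul1r addrC.
Qed.

Section Slices.
Variables ups eta : F.
Local Notation pnt := (pnt ups eta).

Definition bsl (p : {mpoly F[3]}) : {poly {poly F}} :=
  mmap (polyC \o polyC) (vec3 'X ('X)%:P (ups%:P + eta *: 'X)%:P) p.
HB.instance Definition _ := GRing.RMorphism.copy bsl
  (mmap (polyC \o polyC) (vec3 'X ('X)%:P (ups%:P + eta *: 'X)%:P)).

Definition sl t (p : {mpoly F[3]}) : {poly F} := (evin t \o bsl) p.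
HB.instance Definition _ t := GRing.RMorphism.copy (sl t) (evin t \o bsl).

Lemma horner_sl t p s : (sl t p).[s] = meval (pnt s t) p.
Proof.
rewrite -[LHS]/((horner_eval s \o sl t) p).
apply: mpoly_rmorph_eq => [c|k] /=; rewrite /horner_eval /sl /= horner_evin /bsl.
  by rewrite mmapC /= !hornerC mevalC.
rewrite mmapX mmap1U mevalXU; move: k; apply: I3P; rewrite /vec3 /=.
- by rewrite hornerX hornerC.
- by rewrite hornerC hornerX.
- by rewrite hornerC !hornerE.
Qed.

Lemma coef_sl t p i : (sl t p)`_i = ((bsl p)`_i).[t].
Proof. by rewrite /sl /= /evin coef_map. Qed.

Lemma sl_eq0 t p : bsl p = 0 -> sl t p = 0.
Proof. by move=> h; rewrite /sl /= h rmorph0. Qed.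

(** The outer variable is d and the inner one t, the order used by [balanced]; t0 is set to 0, these
    slices being meant for polynomials free of it. *)
Definition blX (k c : 'I_3 -> F) (j : 'I_10) : {poly {poly F}} :=
  nth 0 [:: 0; ('X)%:P; (ups%:P + eta *: 'X)%:P; 'X; (k 0)%:P%:P; (k 1)%:P%:P; (k 2)%:P%:P;
    (c 0)%:P%:P; (c 1)%:P%:P; (c 2)%:P%:P] j.

Definition bl k c (q : {mpoly F[10]}) : {poly {poly F}} := mmap (polyC \o polyC) (blX k c) q.
HB.instance Definition _ k c := GRing.RMorphism.copy (bl k c) (mmap (polyC \o polyC) (blX k c)).

Definition zt t d k c := z10 0 t (ups + eta * t) d k c.

Lemma horner_bl k c q d t : (bl k c q).[d%:P].[t] = meval (zt t d k c) q.
Proof.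
rewrite -[LHS]/((horner_eval t \o horner_eval d%:P \o bl k c) q).
apply: mpoly_rmorph_eq => [x|j] /=; rewrite /horner_eval /bl.
  by rewrite mmapC /= !hornerC mevalC.
rewrite mmapX mmap1U mevalXU /blX /zt /z10.
by case: j => -[|[|[|[|[|[|[|[|[|[|//]]]]]]]]]] h /=; rewrite ?hornerX ?hornerC ?horner0 ?hornerX ?hornerD ?hornerC ?hornerZ ?hornerX.
Qed.
End Slices.
End Points.

Section Multiplicities.
Variable F : numClosedFieldType.

Lemma mup_prod (I : Type) (r : seq I) (p : I -> {poly F}) x : (forall i, p i != 0) ->
  mup x (\prod_(i <- r) p i) = (\sum_(i <- r) mup x (p i))%N.
Proof.
move=> p0; elim: r => [|i r IH]; first by rewrite !big_nil mupNroot // rootC oner_eq0.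
by rewrite !big_cons mupM ?IH // prodf_seq_neq0; elim: r {IH} => //= j r ->; rewrite p0.
Qed.

Lemma mup_XsubC (x y : F) : mup x ('X - y%:P) = (x == y).
Proof.
rewrite -[_ - _]expr1 mup_XsubCX.
by rewrite eq_sym; case: (y == x).
Qed.

Lemma deg_mup (p : {poly F}) rs : p != 0 -> uniq rs -> (forall s, root p s -> s \in rs) ->
  (size p).-1 = (\sum_(s <- rs) mup s p)%N.
Proof.
move=> p0 urs rsP; have [r pE] := closed_field_poly_normal p.
have lp : lead_coef p != 0 by rewrite lead_coef_eq0.
have sub z : z \in r -> z \in rs by move=> zr; apply: rsP; rewrite pE rootZ // root_prod_XsubC.
rewrite {1}pE size_scale // size_prod_XsubC /=.
have mE s : mup s p = (\sum_(z <- r) (s == z))%N.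
  rewrite pE -mul_polyC mupMr ?rootC // mup_prod; last by move=> i; rewrite polyXsubC_eq0.
  by apply: eq_bigr => z _; rewrite mup_XsubC.
under eq_bigr do rewrite mE.
rewrite exchange_big /= big_seq (eq_bigr (fun=> 1%N)); last first.
  move=> z /sub zrs; rewrite (bigD1_seq z) //= eqxx big1 // => s /negbTE -> //.
by rewrite -big_seq sum1_size.
Qed.

Lemma mup_pencil (x y d : F) : d != 0 -> ~ (x = 0 /\ y = 0) ->
  x%:P - y *: 'X^2 != 0 :> {poly F} /\ mup d (x%:P - y *: 'X^2) = (x == d ^+ 2 * y).
Proof.
move=> d0 xy; set p := _ - _.
have pd e : p.[e] = x - e ^+ 2 * y by rewrite /p hornerD hornerN hornerC hornerZ hornerXn [y * _]mulrC.
have p0 : p != 0.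
  apply/eqP => h; apply: xy; have := pd 0; have := pd d.
  rewrite h !horner0 expr0n mul0r subr0 => + x0; rewrite -x0 sub0r => /esym/eqP.
  by rewrite oppr_eq0 mulf_eq0 expf_eq0 (negbTE d0) /= => /eqP ->.
split=> //; case: (eqVneq x (d ^+ 2 * y)) => [xE|xn]; last first.
  by rewrite mupNroot // /root pd subr_eq0.
have y0 : y != 0 by apply/eqP => h; apply: xy; rewrite xE h mulr0.
rewrite mup_simple //; first by rewrite /root pd xE subrr.
rewrite /root /p derivD derivC add0r derivN derivZ derivXn hornerN hornerZ hornerMn hornerXn.
by rewrite oppr_eq0 mulf_eq0 (negbTE y0) /= mulrn_eq0 (negbTE d0).
Qed.

Lemma horner_inj (p q : {poly F}) : (forall s, p.[s] = q.[s]) -> p = q.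
Proof.
move=> H; apply/eqP; rewrite -subr_eq0; apply/eqP/poly_eq0P => s.
by rewrite hornerD hornerN H subrr.
Qed.

Lemma horner_pencil (x y : {poly F}) d s : (x - d *: y).[s] = x.[s] - d * y.[s].
Proof. by rewrite hornerD hornerN hornerZ. Qed.

Lemma det_sylv0 (A : comNzRingType) dq (c : A) q : \det (sylv 0 dq c%:P q) = c ^+ dq.
Proof.
have -> : sylv 0 dq c%:P q = c%:M; last by rewrite det_scalar addn0.
apply/matrixP => i j; rewrite /sylv; case: (split_ordP i) => [l ->|[]//].
rewrite col_mxEu !mxE /= rVpoly_delta coefMC coefXn.
by rewrite -val_eqE /= eq_sym; case: eqP => _; rewrite ?mul1r ?mul0r.
Qed.

Lemma gen_linform n (v : 'I_n -> F) i : v i != 0 ->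
  gen (fun k : 'I_n -> F => \sum_j k j * v j != 0).
Proof.
move=> vi; apply: gen_sub (gen_neq0 (linform_neq0 vi)) _ => k; rewrite meval_linform.
by rewrite (eq_bigr (fun j => k j * v j)) // => j _; rewrite mulrC.
Qed.

Lemma cof_pencil (x y : F) : ~ (x = 0 /\ y = 0) -> cof (fun d => x - d ^+ 2 * y != 0).
Proof.
move=> xy; have [p0 _] := @mup_pencil x y 1 (oner_neq0 _) xy.
by apply: cof_sub (cof_neq0 p0) _ => d; rewrite hornerD hornerN hornerC hornerZ hornerXn [y * _]mulrC.
Qed.

Lemma roots_seq (p : {poly F}) : p != 0 ->
  exists2 rs : seq F, uniq rs & forall s, (s \in rs) = root p s.
Proof.
move=> p0; have [r pE] := closed_field_poly_normal p; exists (undup r); first exact: undup_uniq.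
by move=> s; rewrite mem_undup pE rootZ ?lead_coef_eq0 // root_prod_XsubC.
Qed.

Lemma pairs_seq (T : eqType) (rs : seq T) (L : T -> seq T) (P : T -> T -> Prop) :
  uniq rs -> (forall t, t \in rs -> uniq (L t)) ->
  (forall s t, P s t <-> t \in rs /\ s \in L t) ->
  exists l : seq (T * T), [/\ uniq l, size l = (\sum_(t <- rs) size (L t))%N
    & forall s t, (s, t) \in l <-> P s t].
Proof.
move=> urs uL PE; exists (flatten [seq [seq (s, t) | s <- L t] | t <- rs]); split.
- elim: rs urs uL {PE} => //= t rs IH /andP[trs urs] uL.
  rewrite cat_uniq map_inj_uniq ?uL ?mem_head //=; last by move=> x y [].
  rewrite IH ?andbT //; last by move=> t' h; apply: uL; rewrite inE h orbT.
  apply/hasPn => -[s' t'] /flatten_mapP[t2 t2rs /mapP[s2 _ [_ ->]]].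
  by apply/negP => /mapP[s3 _ [_ h]]; move: trs; rewrite -h t2rs.
- rewrite size_flatten /shape -map_comp sumnE big_map.
  by apply: eq_bigr => t _; rewrite /= size_map.
- move=> s t; split.
    by move=> /flatten_mapP[t' trs /mapP[s' sL [-> ->]]]; apply/PE.
  by move/PE => [trs sL]; apply/flatten_mapP; exists t => //; apply/mapP; exists s.
Qed.
End Multiplicities.

Section Slopes.
Variables (F : numClosedFieldType) (ups eta : F) (U : 'I_3 -> {mpoly F[3]}).
Local Notation pn := (pnt ups eta).
Local Notation sl := (sl ups eta).

Definition T0v (k : 'I_3 -> F) z := \sum_i k i * meval z (U i).
Definition T0s (k : 'I_3 -> F) t : {poly F} := \sum_i k i *: sl t (U i).

Definition sqv (p : {mpoly F[3]}) v (k : 'I_3 -> F) z i :=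
  meval z p * cross k (fun j => meval z (v j)) i ^+ 2.
Definition sqs (p : {mpoly F[3]}) v (k : 'I_3 -> F) t i : {poly F} :=
  sl t p * cross (fun j => (k j)%:P) (fun j => sl t (v j)) i ^+ 2.

Lemma horner_T0s k t s : (T0s k t).[s] = T0v k (pn s t).
Proof. by rewrite /T0s horner_sum; apply: eq_bigr => i _; rewrite hornerZ horner_sl. Qed.

Lemma horner_sqs p v k t i s : (sqs p v k t i).[s] = sqv p v k (pn s t) i.
Proof. by rewrite /sqs /sqv /cross hornerM horner_exp hornerD hornerN !hornerM !hornerC !horner_sl. Qed.

Lemma gen_T0v z i : meval z (U i) != 0 -> gen (fun k => T0v k z != 0).
Proof. exact: (@gen_linform F 3 (fun j => meval z (U j)) i). Qed.

Lemma cross_prop (k u v : 'I_3 -> F) : \sum_i k i * u i = 0 -> \sum_i u i * v i = 0 ->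
  forall i j, cross k v j * u i = u j * cross k v i.
Proof.
move=> ku uv i j.
have := @cross_cross0 F k v u; rewrite (eq_bigr (fun i => k i * u i)); last by move=> ? _; rewrite mulrC.
by move=> /(_ ku uv) /cross_all ->; rewrite mulrC.
Qed.

(* On T_0 = 0 the vector k x v is a multiple of U, so the T_j are proportional to U_j^2. *)
Lemma sq_prop p v k z i : \sum_i meval z (U i) * meval z (v i) = 0 ->
  T0v k z = 0 -> meval z (U i) != 0 -> forall j,
  sqv p v k z j = (meval z (U j) / meval z (U i)) ^+ 2 * sqv p v k z i.
Proof.
move=> Uv T0 Ui j; have h := cross_prop T0 Uv i j.
have e : cross k (fun j => meval z (v j)) j = meval z (U j) / meval z (U i) * cross k (fun j => meval z (v j)) i.
  by apply: (mulIf Ui); rewrite h; field.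
by rewrite /sqv e; ring.
Qed.
End Slopes.

(** * Counting the solutions in one plane *)

Section PlaneCount.
Variables (F : numClosedFieldType) (ups eta : F) (U : 'I_3 -> {mpoly F[3]}) (B : {mpoly F[3]}).
Local Notation pn := (pnt ups eta).
Local Notation sl := (sl ups eta).
Local Notation zt := (zt ups eta).
Local Notation bl := (bl ups eta).
Local Notation T0v := (T0v U).
Local Notation T0s := (T0s ups eta U).
Variables (xv yv : ('I_3 -> F) -> ('I_3 -> F) -> 'I_3 -> F).
Variables (xs ys : ('I_3 -> F) -> F -> 'I_3 -> {poly F}).
Hypothesis horner_xs : forall k t i s, (xs k t i).[s] = xv k (pn s t) i.
Hypothesis horner_ys : forall k t i s, (ys k t i).[s] = yv k (pn s t) i.
Hypothesis xy_prop : forall k p i, T0v k p = 0 -> meval p (U i) != 0 -> forall j,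
  xv k p j = (meval p (U j) / meval p (U i)) ^+ 2 * xv k p i /\
  yv k p j = (meval p (U j) / meval p (U i)) ^+ 2 * yv k p i.

Definition Ts (c : 'I_3 -> F) d k t : {poly F} := \sum_i c i *: (xs k t i - d ^+ 2 *: ys k t i).

Lemma horner_Ts c d k t s :
  (Ts c d k t).[s] = \sum_i c i * (xv k (pn s t) i - d ^+ 2 * yv k (pn s t) i).
Proof.
rewrite /Ts horner_sum; apply: eq_bigr => i _.
by rewrite hornerZ horner_pencil horner_xs horner_ys.
Qed.

Variables (a b De : nat) (Th : seq F) (g2 pp R' : {mpoly F[10]}).

(** [a] and [b] are the formal degrees of T_0 and T in t0, and [Th] contains the t where a leading
    coefficient or a coprimality may be lost. The hypotheses [s1] to [s4] control degrees, [n1] to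
    [n5] common zeros, and [h1] to [h4] the factors of the resultant: [g2] is free of (d, k), [R']
    is the cofactor of the content in c, and [De] is the degree of [pp] on the line. *)
Hypothesis s1 : forall t i, (size (sl t (U i)) <= a.+1)%N.
Hypothesis s2 : forall t, t \notin Th -> exists i, (sl t (U i))`_a != 0.
Hypothesis s3 : forall k t i, (size (xs k t i) <= b.+1)%N /\ (size (ys k t i) <= b.+1)%N.
Hypothesis s4 : gen (fun k => forall t, t \notin Th -> exists i,
  (xs k t i)`_b != 0 \/ (ys k t i)`_b != 0).
Hypothesis n1 : forall t, t \notin Th -> forall s, exists i, meval (pn s t) (U i) != 0.
Hypothesis n2 : gen (fun k => forall s t i, t \notin Th -> T0v k (pn s t) = 0 ->
  meval (pn s t) (U i) != 0 -> ~ (xv k (pn s t) i = 0 /\ yv k (pn s t) i = 0)).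
Hypothesis n3 : (0 < a)%N -> gen (fun k => forall t, T0s k t != 0).
Hypothesis n4 : a = 0%N -> forall s t, exists i, meval (pn s t) (U i) != 0.
Hypothesis n5 : forall t, t \notin Th -> sl t B != 0.
Hypothesis B1 : gen (fun k => forall s t, meval (pn s t) B != 0 -> T0v k (pn s t) = 0 ->
  exists2 i, meval (pn s t) (U i) != 0 & ~ (xv k (pn s t) i = 0 /\ yv k (pn s t) i = 0)).
Hypothesis h0 : forall t d k c c', meval (zt t d k c) pp = meval (zt t d k c') pp.
Hypothesis h0' : forall t d k c d' k' c', meval (zt t d k c) g2 = meval (zt t d' k' c') g2.
Hypothesis h1 : forall t, gen (fun k => cof (fun d => meval (zt t d k (fun=> 0)) pp != 0)).
Hypothesis h2 : gen (fun k => cof (fun d => forall t, exists c, meval (zt t d k c) R' != 0)).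
Hypothesis h3 : forall t d k c, meval (zt t d k c) (g2 * pp * R') =
  \det (sylv a b (T0s k t) (Ts c d k t)).
Hypothesis h4 : gen (fun k => cof (fun d => size (bl k (fun=> 0) pp).[d%:P] = De.+1)).

Definition sol k d s t := [/\ meval (pn s t) B != 0, T0v k (pn s t) = 0 &
  forall i, xv k (pn s t) i - d ^+ 2 * yv k (pn s t) i = 0].

Lemma size_Ts c d k t : (size (Ts c d k t) <= b.+1)%N.
Proof.
rewrite /Ts; apply: leq_trans (size_sum _ _ _) _; apply/bigmax_leqP => i _.
apply: leq_trans (size_scale_leq _ _) _; apply: leq_trans (size_polyD _ _) _.
have [hx hy] := s3 k t i; rewrite geq_max hx size_polyN.
exact: leq_trans (size_scale_leq _ _) hy.
Qed.

Lemma size_T0s k t : (size (T0s k t) <= a.+1)%N.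
Proof.
rewrite /T0s; apply: leq_trans (size_sum _ _ _) _; apply/bigmax_leqP => i _.
exact: leq_trans (size_scale_leq _ _) (s1 t i).
Qed.

Lemma bl_pp k c d : (bl k c pp).[d%:P] = (bl k (fun=> 0) pp).[d%:P].
Proof.
by apply: horner_inj => t; rewrite !horner_bl (h0 t d k c (fun=> 0)).
Qed.

Section ConstantCase.
Hypothesis a0 : a = 0%N.

Let V i : {poly F} := (bsl ups eta (U i)).[0%:P].

Lemma const_U s t i : meval (pn s t) (U i) = (V i).[t].
Proof.
rewrite /V -horner_evin -[evin _ _]/(sl t (U i)) !horner_sl -!(horner_sl ups eta).
have := s1 t i; rewrite a0 => /size1_polyC ->; by rewrite !hornerC.
Qed.

Let K (k : 'I_3 -> F) : {poly F} := \sum_i k i *: V i.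

Lemma const_T0v k s t : T0v k (pn s t) = (K k).[t].
Proof. by rewrite /K horner_sum; apply: eq_bigr => i _; rewrite hornerZ const_U. Qed.

Lemma const_T0s k t : T0s k t = ((K k).[t])%:P.
Proof.
have := size_T0s k t; rewrite a0 => /size1_polyC E; rewrite E; congr _%:P.
by rewrite -(const_T0v k 0 t) -horner_T0s E hornerC coefC.
Qed.

Lemma const_h3 k d c : (bl k c g2).[d%:P] * (bl k (fun=> 0) pp).[d%:P] * (bl k c R').[d%:P] = K k ^+ b.
Proof.
apply: horner_inj => t; rewrite -(bl_pp k c) !hornerM horner_exp !horner_bl -!mevalM h3.
by rewrite a0 const_T0s det_sylv0.
Qed.

(** A zero of [g2], which is free of k, would make k.U vanish at t for every k, whereas some
    component of U is nonzero there. *)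
Lemma const_g2 t d k c : meval (zt t d k c) g2 != 0.
Proof.
have [i Ui] := n4 a0 0 t; have [k1 k1U] := gen_ex (gen_T0v Ui).
rewrite (h0' t d k c 0 k1 c); apply: contra_neq k1U => g0.
have := congr1 (fun p => p.[t]) (const_h3 k1 0 c).
rewrite !hornerM !horner_bl g0 !mul0r horner_exp => /esym/eqP; rewrite expf_eq0.
by rewrite -(const_T0v _ 0) => /andP[_ /eqP].
Qed.

(** Here T_0 is a polynomial K(t) and R = K^b. Over each of the simple roots of K the system has b
    solutions in t0, and [pp] has multiplicity b there because neither [g2] nor, for a suitable c,
    [R'] vanishes. *)
Lemma const_count : gen (fun k => cof (fun d => exists l : seq (F * F),
  [/\ uniq l, size l = De & forall s t, (s, t) \in l <-> sol k d s t])).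
Proof.
have [|EK EK0 EKP] := @net_simple F V.
  by move=> t; have [j] := n4 a0 0 t; rewrite const_U; exists j.
have gK : gen (fun k => K k != 0 /\ forall s, root (K k) s -> ~~ root (K k)^`() s).
  by exists EK.
have gTh : gen (fun k => forall t, t \in Th -> (K k).[t] != 0).
  apply: gen_seq => t _; have [i Ui] := n4 a0 0 t.
  by apply: gen_sub (gen_T0v Ui) _ => k; rewrite const_T0v.
have G := gen_and (gen_and gK gTh) (gen_and (gen_and s4 n2) (gen_and h2 h4)).
apply: gen_sub G _ => k [[[K0 Ks] KTh] [[k4 k2] [kh2 kh4]]].
have [rsK [uK sK KE]] := simple_roots K0 Ks.
have KnTh t : t \in rsK -> t \notin Th.
  by rewrite KE => r; apply/negP => /KTh; rewrite -[_ == 0]/(root _ _) r.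
have C t : t \in rsK -> cof (fun d => exists L : seq F, [/\ uniq L, size L = b
    & forall s, s \in L <-> sol k d s t]).
  move=> tK; have tTh := KnTh t tK; have [i Ui] := n1 tTh 0.
  have Uis s : meval (pn s t) (U i) != 0 by rewrite const_U -(const_U 0).
  have T0 s : T0v k (pn s t) = 0.
    by apply/eqP; rewrite const_T0v -[_ == 0]/(root _ _) -KE.
  have xyE j : xs k t j = ((V j).[t] / (V i).[t]) ^+ 2 *: xs k t i /\
               ys k t j = ((V j).[t] / (V i).[t]) ^+ 2 *: ys k t i.
    split; apply: horner_inj => s; have [e1 e2] := xy_prop (T0 s) (Uis s) j.
    - by rewrite hornerZ !horner_xs e1 !const_U.
    - by rewrite hornerZ !horner_ys e2 !const_U.
  have [|e e0 eP] := @pencil_simple F (xs k t i) (ys k t i).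
    move=> s []; rewrite /root horner_xs horner_ys => /eqP x0 /eqP y0.
    exact: (k2 s t i tTh (T0 s) (Uis s)).
  have mx : maxn (size (xs k t i)) (size (ys k t i)) = b.+1.
    have [hx hy] := s3 k t i; apply/eqP; rewrite eqn_leq geq_max hx hy /=.
    have [j] := k4 t tTh; have [-> ->] := xyE j; rewrite !coefZ leq_max.
    case=> /eqP h; apply/orP; [left|right]; rewrite ltnNge; apply/negP => sz; apply: h;
    by rewrite nth_default ?mulr0.
  have [rB _ rBE] := roots_seq (n5 tTh).
  have cB : cof (fun d => forall s, s \in rB -> xv k (pn s t) i - d ^+ 2 * yv k (pn s t) i != 0).
    by apply: cof_seq => s _; apply: cof_pencil; apply: k2.
  apply: cof_sub (cof_and (ex_intro2 _ _ e e0 eP) cB) _ => d [[p0 sp pS] dB].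
  have [L [uL sL LE]] := simple_roots p0 pS; exists L; split=> //; first by rewrite sL sp mx.
  move=> s; rewrite LE /root horner_pencil horner_xs horner_ys; split.
    move/eqP => h; split=> //.
      apply/negP => /eqP Bs; have : s \in rB by rewrite rBE /root horner_sl Bs.
      by move/dB; rewrite h eqxx.
    by move=> j; have [-> ->] := xy_prop (T0 s) (Uis s) j; rewrite [d ^+ 2 * _]mulrCA -mulrBr h mulr0.
  by move=> [_ _ h]; apply/eqP.
apply: cof_sub (cof_and (cof_seq C) (cof_and kh2 kh4)) _ => d [dC [dh2 dh4]].
have /choice[L LP] : forall t, exists L : seq F, t \in rsK -> [/\ uniq L, size L = b
    & forall s, s \in L <-> sol k d s t].
  by move=> t; have [/dC[L ?]|] := boolP (t \in rsK); [exists L|exists [::]].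
have [||l [ul sl lP]] := @pairs_seq F rsK L (sol k d) uK.
- by move=> t /LP[].
- move=> s t; split.
    move=> h; have tK : t \in rsK.
      by case: h => _ + _; rewrite const_T0v => h; rewrite KE /root h.
    by split=> //; have [_ _ ->] := LP t tK.
  by move=> [/LP[_ _ ->]].
exists l; split=> //; rewrite sl.
pose p1 := (bl k (fun=> 0) pp).[d%:P].
have p10 : p1 != 0 by rewrite -size_poly_eq0 dh4.
have mE t : mup t p1 = (b * mup t (K k))%N.
  have [c Rc] := dh2 t; have E := const_h3 k d c.
  have m1 : mup t (K k ^+ b) = (b * mup t (K k))%N.
    have := @mup_prod F 'I_b (index_enum _) (fun=> K k) t (fun=> K0).
    by rewrite prodr_const card_ord => ->; rewrite sum_nat_const card_ord.
  rewrite -m1 -E mupMl; last by rewrite /root horner_bl.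
  by rewrite mupMr // /root horner_bl const_g2.
have -> : De = (size p1).-1 by rewrite dh4.
rewrite (deg_mup p10 uK); last first.
  move=> t r; rewrite KE; apply: contraT => nK; have := XsubC_dvd t p10.
  by rewrite dvdp_XsubCl r mE (mupNroot nK) muln0.
rewrite big_seq [RHS]big_seq; apply: eq_bigr => t tK; have [_ -> _] := LP t tK.
by rewrite mE mup_simple ?muln1 // -?KE // ; apply: Ks; rewrite -KE.
Qed.
End ConstantCase.

Section GenericCase.
Hypothesis apos : (0 < a)%N.
Local Notation bsl := (bsl ups eta).

Definition bT0 (k : 'I_3 -> F) : {poly {poly F}} := \sum_i (k i)%:P%:P * bsl (U i).

Lemma evin_bT0 k t : evin t (bT0 k) = T0s k t.
Proof.
rewrite /bT0 rmorph_sum /=; apply: eq_bigr => i _; rewrite rmorphM /= -[evin t (bsl _)]/(sl t (U i)).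
by rewrite /evin map_polyC /= /horner_eval hornerC mul_polyC.
Qed.

Lemma evin_size (q : {poly {poly F}}) l : (forall t, (size (evin t q) <= l)%N) -> (size q <= l)%N.
Proof.
move=> H; apply/leq_sizeP => j lj; apply: poly_eq0P => t.
by have /leq_sizeP/(_ j lj) := H t; rewrite /evin coef_map.
Qed.

(** A general (c, d) makes T of full degree and nonzero at every root of T_0, which is what
    [sylv_neq0] needs. *)
Lemma sylv_nonzero : gen (fun k => forall t, t \notin Th ->
  exists c d, \det (sylv a b (T0s k t) (Ts c d k t)) != 0).
Proof.
apply: gen_sub (gen_and (n3 apos) (gen_and s4 n2)) _ => k [k3 [k4 k2]] t tTh.
have [rs _ rsE] := roots_seq (k3 t); have [j hj] := k4 t tTh.
have /choice[i iU] := n1 tTh.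
have T0 s : s \in rs -> T0v k (pn s t) = 0.
  by rewrite rsE /root horner_T0s => /eqP.
have c1 : cof (fun d => forall s, s \in rs -> xv k (pn s t) (i s) - d ^+ 2 * yv k (pn s t) (i s) != 0).
  by apply: cof_seq => s srs; apply: cof_pencil; apply: k2 => //; apply: T0.
have c2 : cof (fun d => (xs k t j)`_b - d ^+ 2 * (ys k t j)`_b != 0).
  by apply: cof_pencil => -[x0 y0]; case: hj; rewrite ?x0 ?y0 eqxx.
have [d [d1 d2]] := cof_ex (cof_and c1 c2).
have e1 : gen (fun c : 'I_3 -> F => forall s, s \in rs ->
    \sum_l c l * (xv k (pn s t) l - d ^+ 2 * yv k (pn s t) l) != 0).
  apply: gen_seq => s srs.
  exact: (@gen_linform F 3 (fun l => xv k (pn s t) l - d ^+ 2 * yv k (pn s t) l) (i s) (d1 s srs)).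
have e2 : gen (fun c : 'I_3 -> F => \sum_l c l * ((xs k t l)`_b - d ^+ 2 * (ys k t l)`_b) != 0).
  exact: (@gen_linform F 3 (fun l => (xs k t l)`_b - d ^+ 2 * (ys k t l)`_b) j d2).
have [c [c1' c2']] := gen_ex (gen_and e1 e2).
have cb : (Ts c d k t)`_b != 0.
  apply: contra_neq c2' => h'; rewrite -[RHS]h' /Ts coef_sum; apply: eq_bigr => l _.
  by rewrite coefZ coefB coefZ.
have sT : size (Ts c d k t) = b.+1.
  apply/eqP; rewrite eqn_leq size_Ts ltnNge; apply: contra cb => h.
  by rewrite nth_default.
exists c, d; have := @sylv_neq0 F a (T0s k t) (Ts c d k t) (k3 t); rewrite sT; apply.
- by rewrite -size_poly_eq0 sT.
- exact: size_T0s.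
- apply: Pdiv.ClosedField.root_coprimep => s; rewrite -rsE => srs.
  by rewrite horner_Ts c1'.
Qed.

Lemma off_Th : gen (fun k => forall t, t \notin Th ->
  (exists d, meval (zt t d k (fun=> 0)) pp != 0) /\ forall d c, meval (zt t d k c) g2 != 0).
Proof.
apply: gen_sub sylv_nonzero _ => k H t /H[c [d]].
rewrite -h3 !mevalM !mulf_eq0 !negb_or => /andP[/andP[gn pn] _]; split.
  by exists d; rewrite (h0 t d k _ c).
by move=> d' c'; rewrite (h0' t d' k c' d k c).
Qed.

(** Simple roots and B != 0 on them are obtained at a single [t1]; the nonvanishing of a resultant
    spreads them to all but finitely many t. *)
Lemma simple_fibers : gen (fun k => exists Fin : seq F, forall t, t \notin Fin ->
  t \notin Th /\ exists rs, [/\ uniq rs, size rs = a, T0s k t != 0,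
     forall s, (s \in rs) = root (T0s k t) s & forall s, s \in rs -> meval (pn s t) B != 0]).
Proof.
have [t1 t1Th] := cof_ex (cof_notin Th).
have [|E E0 EP] := @net_simple F (fun i => sl t1 (U i)).
  by move=> s; have [i Ui] := n1 t1Th s; exists i; rewrite horner_sl.
have g1 : gen (fun k => T0s k t1 != 0 /\ forall s, root (T0s k t1) s -> ~~ root (T0s k t1)^`() s).
  by exists E.
have [i0 Ui0] := s2 t1Th.
have g2' : gen (fun k => (T0s k t1)`_a != 0).
  apply: gen_sub (@gen_linform F 3 (fun j => (sl t1 (U j))`_a) i0 Ui0) _ => k h.
  by apply: contra_neq h => h'; rewrite -[RHS]h' /T0s coef_sum; apply: eq_bigr => j _; rewrite coefZ.
have [rB _ rBE] := roots_seq (n5 t1Th).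
have g3 : gen (fun k => forall s, s \in rB -> T0v k (pn s t1) != 0).
  by apply: gen_seq => s _; have [i Ui] := n1 t1Th s; apply: gen_T0v Ui.
apply: gen_sub (gen_and g1 (gen_and g2' g3)) _ => k [[T10 T1s] [lc1 TB]].
have coefE t : (T0s k t)`_a = ((bT0 k)`_a).[t] by rewrite -evin_bT0 /evin coef_map.
have lcA0 : (bT0 k)`_a != 0 by apply: contra_neq lc1 => h; rewrite coefE h horner0.
have sb : size (bT0 k) = a.+1.
  apply/eqP; rewrite eqn_leq evin_size /=; last by move=> t; rewrite evin_bT0 size_T0s.
  by rewrite ltnNge; apply: contra lcA0 => h; rewrite nth_default.
(* The factor T_0 + 1 equals 1 at the roots of T_0; it gives [q] positive degree, as required to
   write the resultant as a combination of T_0 and [q]. *)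
pose q := bsl B * (bT0 k)^`() * (bT0 k + 1).
have qE t s : (evin t q).[s] = meval (pn s t) B * (T0s k t)^`().[s] * (T0v k (pn s t) + 1).
  rewrite /q !rmorphM /= rmorphD rmorph1 /= -deriv_evin evin_bT0 !hornerM hornerD hornerC.
  by rewrite horner_T0s -[evin t (bsl B)]/(sl t B) horner_sl.
have [rs1 [u1 sz1 rs1E]] := simple_roots T10 T1s.
have sT1 : size (T0s k t1) = a.+1.
  by apply/eqP; rewrite eqn_leq size_T0s ltnNge; apply: contra lc1 => h; rewrite nth_default.
have q1 s : s \in rs1 -> (evin t1 q).[s] != 0.
  move=> srs; have := srs; rewrite rs1E => r; have T0 := r; rewrite /root horner_T0s in T0.
  rewrite qE (eqP T0) add0r mulr1 mulf_neq0 //; last by have := T1s s r; rewrite /root.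
  apply/eqP => Bs; have : s \in rB by rewrite rBE /root horner_sl Bs.
  by move/TB; rewrite T0.
have rs1n : exists s, s \in rs1.
  by case: (rs1) sz1 => [|s r] /=; [rewrite sT1 /= => h; have := apos; rewrite -h|exists s; rewrite mem_head].
have q0 : q != 0 by have [s /q1] := rs1n; apply: contra_neq => ->; rewrite rmorph0 horner0.
have sq : (1 < size q)%N.
  rewrite /q; set u := bsl B * _; have u0 : u != 0 by apply: contra_neq q0; rewrite /q -/u => ->; rewrite mul0r.
  have sb1 : size (bT0 k + 1) = a.+1 by rewrite size_polyDl // sb size_poly1 ltnS.
  have v0 : bT0 k + 1 != 0 by rewrite -size_poly_eq0 sb1.
  rewrite size_mul // sb1; move: u0; rewrite -size_poly_eq0 addnS /=.
  by case: (size u) => // z _; rewrite addSn ltnS addn_gt0 apos orbT.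
pose Rho := resultant (bT0 k) q.
have Rho1 : Rho.[t1] != 0.
  rewrite -[Rho.[t1]]/(horner_eval t1 (resultant _ _)) resultant_morph sb /=.
  rewrite -[map_poly _ (bT0 k)]/(evin t1 (bT0 k)) -[map_poly _ q]/(evin t1 q) evin_bT0.
  have [|c c0 cP] := @sylv_prod F a (size q).-1 (T0s k t1) rs1 T10 u1 _ (size_T0s _ _) rs1E.
    by rewrite sz1 sT1.
  rewrite cP; last first.
    apply: leq_trans (leqSpred _); apply/leq_sizeP => j sj.
    by rewrite /evin coef_map /= nth_default // /horner_eval horner0.
  by rewrite mulf_neq0 // prodf_seq_neq0; apply/allP => s srs /=; apply: q1.
have Rho0 : Rho != 0 by apply: contra_neq Rho1 => ->; rewrite horner0.
have [r1 _ r1E] := roots_seq Rho0; have [r2 _ r2E] := roots_seq lcA0.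
exists (Th ++ r1 ++ r2) => t; rewrite !mem_cat !negb_or r1E r2E => /and3P[tTh tR tL]; split=> //.
have Ta : (T0s k t)`_a != 0 by rewrite coefE.
have T0 : T0s k t != 0 by apply: contra_neq Ta => ->; rewrite coef0.
have sT : size (T0s k t) = a.+1.
  by apply/eqP; rewrite eqn_leq size_T0s ltnNge; apply: contra Ta => h; rewrite nth_default.
have sb1 : (1 < size (bT0 k))%N by rewrite sb.
have [[u v] _ RE] := resultant_in_ideal sb1 sq.
have key s : root (T0s k t) s -> meval (pn s t) B * (T0s k t)^`().[s] != 0.
  move=> r; apply: contra tR => /eqP h; rewrite /root.
  have := congr1 (fun p => (evin t p).[s]) RE; rewrite /= rmorphD /= (rmorphM (evin t) u) (rmorphM (evin t) v) /= hornerD !hornerM.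
  rewrite evin_bT0 (rootP r) qE h !mul0r !mulr0 addr0 /evin map_polyC hornerC /= => h'.
  by apply/eqP.
have [//||rs [urs srs rsE]] := @simple_roots F (T0s k t).
  by move=> s /key; rewrite mulf_eq0 negb_or => /andP[].
exists rs; split=> //; first by rewrite srs sT.
by move=> s; rewrite rsE => /key; rewrite mulf_eq0 negb_or => /andP[].
Qed.

(** By [sylv_prod] the resultant at [t] is a nonzero constant times the product of the pencils x(s)
    - d^2 y(s) over the roots s of T_0. Nonzero zeros d of a pencil are simple, so the multiplicity
    of [pp] counts the pencils that vanish. *)
Lemma fiber_count k d t rs : t \notin Th -> d != 0 ->
  (forall s i, T0v k (pn s t) = 0 -> meval (pn s t) (U i) != 0 ->
     ~ (xv k (pn s t) i = 0 /\ yv k (pn s t) i = 0)) ->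
  uniq rs -> size rs = a -> T0s k t != 0 -> (forall s, (s \in rs) = root (T0s k t) s) ->
  (exists c, meval (zt t d k c) R' != 0) -> (forall d c, meval (zt t d k c) g2 != 0) ->
  evin t (bl k (fun=> 0) pp) != 0 ->
  exists L, [/\ uniq L, size L = mup d (evin t (bl k (fun=> 0) pp)) & forall s, s \in L <->
    s \in rs /\ forall i, xv k (pn s t) i - d ^+ 2 * yv k (pn s t) i = 0].
Proof.
move=> tTh d0 NF urs srs T0 rsE [c Rc] gn pn0.
have /choice[i iU] := n1 tTh.
have T0r s : s \in rs -> T0v k (pn s t) = 0 by rewrite rsE /root horner_T0s => /eqP.
(* Off the roots the pencil is the constant 1, so that it is nonzero for every index, as [mup_prod]
   asks. *)
pose x s := if s \in rs then xv k (pn s t) (i s) else 1.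
pose y s := if s \in rs then yv k (pn s t) (i s) else 0.
pose w s j := (meval (pn s t) (U j) / meval (pn s t) (U (i s))) ^+ 2.
have xy0 s : ~ (x s = 0 /\ y s = 0).
  rewrite /x /y; case: ifP => [srs'|_]; last by case=> /eqP; rewrite oner_eq0.
  exact: NF (T0r s srs') (iU s).
have TE s e j : s \in rs -> xv k (pn s t) j - e ^+ 2 * yv k (pn s t) j = w s j * (x s - e ^+ 2 * y s).
  move=> sr; have [-> ->] := xy_prop (T0r s sr) (iU s) j.
  by rewrite /x /y sr /w mulrBr [e ^+ 2 * _]mulrCA.
pose ws s := \sum_j c j * w s j.
pose pen s : {poly F} := (x s)%:P - y s *: 'X^2.
have penE s e : (pen s).[e] = x s - e ^+ 2 * y s.
  by rewrite /pen horner_pencil hornerC hornerXn [y s * _]mulrC.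
have [C C0 CP] := @sylv_prod F a b (T0s k t) rs T0 urs srs (size_T0s _ _) rsE.
have id1 : evin t (bl k c g2) * evin t (bl k (fun=> 0) pp) * evin t (bl k c R') =
    (C * \prod_(s <- rs) ws s) *: \prod_(s <- rs) pen s.
  apply: horner_inj => e; rewrite !hornerM hornerZ horner_prod !horner_evin !horner_bl.
  rewrite (h0 t e k _ c) -!mevalM h3 CP ?size_Ts // -mulrA -big_split /=; congr (_ * _).
  rewrite big_seq [RHS]big_seq; apply: eq_bigr => s sr; rewrite horner_Ts penE /ws mulr_suml.
  by apply: eq_bigr => j _; rewrite TE // mulrA.
have gr : ~~ root (evin t (bl k c g2)) d by rewrite /root horner_evin horner_bl.
have Rr : ~~ root (evin t (bl k c R')) d by rewrite /root horner_evin horner_bl.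
have nz (p : {poly F}) : ~~ root p d -> p != 0 by apply: contraNneq => ->; rewrite root0.
have Cw : C * \prod_(s <- rs) ws s != 0.
  have : evin t (bl k c g2) * evin t (bl k (fun=> 0) pp) * evin t (bl k c R') != 0.
    exact: mulf_neq0 (mulf_neq0 (nz _ gr) pn0) (nz _ Rr).
  by rewrite id1; apply: contra_neq => ->; rewrite scale0r.
have mE : mup d (evin t (bl k (fun=> 0) pp)) = (\sum_(s <- rs) (x s == d ^+ 2 * y s)%R)%N.
  have <- : mup d (\prod_(s <- rs) pen s) = (\sum_(s <- rs) (x s == d ^+ 2 * y s)%R)%N.
    rewrite mup_prod; last by move=> s; have [] := mup_pencil d0 (xy0 s).
    by apply: eq_bigr => s _; have [] := mup_pencil d0 (xy0 s).
  rewrite -[RHS](@mupMr _ d (C * \prod_(s <- rs) ws s)%:P) ?rootC // mul_polyC -id1.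
  by rewrite mupMl // mupMr.
exists [seq s <- rs | x s == d ^+ 2 * y s]; split; first exact: filter_uniq.
  by rewrite mE size_filter -sum1_count big_mkcond.
move=> s; rewrite mem_filter; split.
  by move=> /andP[/eqP h sr]; split=> // j; rewrite TE // h subrr mulr0.
move=> [sr h]; rewrite sr andbT -subr_eq0; have := h (i s); rewrite TE // => /eqP.
by rewrite mulf_eq0 /w divff ?iU // expr1n oner_eq0.
Qed.

(* R is, up to a factor, the product of the T(s) over the zeros s of T_0; this gives the
   multiplicity of pp in d at a generic t, which is also its multiplicity in t at a generic d. *)
Lemma generic_count : gen (fun k => cof (fun d => exists l : seq (F * F),
  [/\ uniq l, size l = De & forall s t, (s, t) \in l <-> sol k d s t])).
Proof.
have hTh := gen_seq (fun t (_ : t \in Th) => h1 t).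
have G := gen_and (gen_and (gen_and (n3 apos) B1) (gen_and h2 h4))
  (gen_and (gen_and off_Th simple_fibers) (gen_and hTh n2)).
apply: gen_sub G _ => k [[[k3 kB] [kh2 kh4]] [[kT [Fin FinP]] [kh1 k2]]].
pose f := bl k (fun=> 0) pp.
have ppnz t : cof (fun d => meval (zt t d k (fun=> 0)) pp != 0).
  have [/kh1//|tTh] := boolP (t \in Th); have [[d hd] _] := kT t tTh.
  have f0 : evin t f != 0 by apply: contra_neq hd => h; rewrite -horner_bl -horner_evin -/f h horner0.
  by apply: cof_sub (cof_neq0 f0) _ => d'; rewrite horner_evin horner_bl.
have evf t : evin t f != 0.
  have [d hd] := cof_ex (ppnz t).
  by apply: contra_neq hd => h; rewrite -horner_bl -horner_evin -/f h horner0.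
have f0 : f != 0 by apply: contra_neq (evf 0) => ->; rewrite rmorph0.
have [r [e [r0 e0 bal]]] := balanced_all f0.
have [rr _ rrE] := roots_seq r0.
(* At these exceptional t the multiplicities are not compared: a general d makes [pp] nonzero and
   leaves no solution there. *)
pose Ex := Fin ++ rr.
have cI : cof (fun d => forall t, t \in Ex -> meval (zt t d k (fun=> 0)) pp != 0).
  by apply: cof_seq => t _; apply: ppnz.
have cII : cof (fun d => forall t, t \in Ex -> forall s, ~ sol k d s t).
  apply: cof_seq => t _; have [rt _ rtE] := roots_seq (k3 t).
  have : cof (fun d => forall s, s \in rt -> ~ sol k d s t).
    apply: cof_seq => s _; have [Bs|Bs] := eqVneq (meval (pn s t) B) 0.
      by apply: cof_all => d []; rewrite Bs eqxx.
    have [T0|T0] := eqVneq (T0v k (pn s t)) 0; last first.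
      by apply: cof_all => d [_ h]; rewrite h eqxx in T0.
    have [i _ xy] := kB s t Bs T0; apply: cof_sub (cof_pencil xy) _ => d h [_ _ H].
    by rewrite H eqxx in h.
  move/cof_sub; apply=> d H s hs; apply: (H s) => //; case: hs => _ T0 _.
  by rewrite rtE /root horner_T0s T0.
have cc := cof_and (cof_and (cof_and kh2 kh4) (cof_and cI cII)) (cof_and (cof_neq0 e0) (cof_notin [:: 0])).
apply: cof_sub cc _ => d [[[dh2 dh4] [dI dII]] [ed]]; rewrite inE => d0.
have p10 : f.[d%:P] != 0 by rewrite -size_poly_eq0 dh4.
have [rsP uP rPE] := roots_seq p10.
have rE t : r.[t] != 0 -> mup d (evin t f) = mup t f.[d%:P].
  by move=> rt; have [_ _] := bal d t rt ed.
have /choice[L LP] : forall t, exists L : seq F, t \notin Ex -> [/\ uniq L,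
    size L = mup t f.[d%:P] & forall s, s \in L <-> sol k d s t].
  move=> t; have [_|] := boolP (t \in Ex); first by exists [::].
  rewrite mem_cat negb_or rrE => /andP[tF rt].
  have [tTh [rs [urs srs T0 rsE rsB]]] := FinP t tF.
  have [_ gn] := kT t tTh.
  have [L [uL sL LE]] := fiber_count tTh d0 (fun s i => k2 s t i tTh) urs srs T0 rsE (dh2 t) gn (evf t).
  exists L => _; split=> //; first by rewrite sL -rE.
  move=> s; split.
    move/LE => [sr h]; split=> //; first exact: rsB.
    by move: sr; rewrite rsE /root horner_T0s => /eqP.
  by move=> [_ T0' h]; apply/LE; split=> //; rewrite rsE /root horner_T0s T0'.
have rsPEx t : t \in rsP -> t \notin Ex.
  rewrite rPE /root horner_bl => h; apply/negP => /dI; by rewrite h.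
have [||l [ul szl lP]] := @pairs_seq F rsP L (sol k d) uP.
- by move=> t /rsPEx/LP[].
- move=> s t; split.
    move=> hs; have tEx : t \notin Ex by apply/negP => /dII/(_ s).
    have [_ sL LE] := LP t tEx; have sL' : s \in L t by apply/LE.
    split=> //; rewrite rPE -dvdp_XsubCl XsubC_dvd // -sL.
    by case: (L t) sL'.
  by move=> [/rsPEx/LP[_ _ LE] /LE].
exists l; split=> //; rewrite szl.
have -> : De = (size f.[d%:P]).-1 by rewrite dh4.
rewrite (deg_mup p10 uP); last by move=> s; rewrite rPE.
by rewrite big_seq [RHS]big_seq; apply: eq_bigr => t /rsPEx/LP[].
Qed.
End GenericCase.

Lemma plane_count : gen (fun k => cof (fun d => exists l : seq (F * F),
  [/\ uniq l, size l = De & forall s t, (s, t) \in l <-> sol k d s t])).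
Proof.
by have [a0|apos] := posnP a; [apply: const_count|apply: generic_count].
Qed.
End PlaneCount.

Lemma cross_anti (A : comPzRingType) (a b : 'I_3 -> A) i : cross b a i = - cross a b i.
Proof. by rewrite /cross; ring. Qed.

Lemma poly_sqr_top (A : comNzRingType) (p q : {poly A}) m n :
  (size p <= m.+1)%N -> (size q <= n.+1)%N ->
  (p * q ^+ 2)`_(m + 2 * n) = p`_m * q`_n ^+ 2 /\ (size (p * q ^+ 2)%R <= (m + 2 * n).+1)%N.
Proof.
have top (u v : {poly A}) i j : (size u <= i.+1)%N -> (size v <= j.+1)%N ->
    (u * v)`_(i + j) = u`_i * v`_j /\ (size (u * v)%R <= (i + j).+1)%N.
  move=> su sv; split; last first.
    apply: leq_trans (size_polyMleq _ _) _; move: su sv; move: (size u) (size v) => x y; lia.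
  rewrite coefM (bigD1 (inord i)) //= inordK ?ltnS ?leq_addr // addKn big1 ?addr0 // => l li.
  have [lti|gti|eqi] := ltngtP l i.
  - rewrite [v`__]nth_default ?mulr0 //; apply: leq_trans sv _; move: lti; lia.
  - by rewrite nth_default ?mul0r //; apply: leq_trans su _.
  - by case/eqP: li; apply: val_inj; rewrite /= inordK ?ltnS ?leq_addr.
move=> sp sq; have [c1 s1] := top q q n n sq sq; rewrite addnn -mul2n in c1 s1.
by rewrite expr2; have [c2 s2] := top p _ m (2 * n)%N sp s1; rewrite c2 c1 expr2.
Qed.

(** * General position of k and of the plane *)

Section PlaneFacts.
Variables (F : numClosedFieldType) (ups eta : F).
Local Notation pn := (pnt ups eta).
Local Notation sl := (sl ups eta).
Local Notation bsl := (bsl ups eta).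

Section Leads.
Variables (p : {mpoly F[3]}) (v : 'I_3 -> {mpoly F[3]}).

Local Notation psq := (sqs ups eta p v).

(** The top coefficient is that of [p] times the squared cross product of k with the top coefficient
    vector of [v]. Off finitely many t fixed beforehand, it vanishes only for k parallel to that
    vector, on a cone over a curve; hence [Th] does not depend on k. *)
Lemma lead_survives b : (forall k t i, (size (psq k t i) <= b.+1)%N) ->
  (exists k t i, (psq k t i)`_b != 0) ->
  exists Th : seq F, gen (fun k => forall t, t \notin Th -> exists i, (psq k t i)`_b != 0).
Proof.
move=> sb [k1 [t1 [i1 nz]]].
pose hd := (size (bsl p)).-1; pose xd := (\max_j (size (bsl (v j))).-1)%N.
have sp t : (size (sl t p) <= hd.+1)%N.
  apply: leq_trans (leqSpred _); apply/leq_sizeP => j h.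
  by rewrite coef_sl nth_default ?horner0.
have sv t j : (size (sl t (v j)) <= xd.+1)%N.
  apply/leq_sizeP => l h; rewrite coef_sl nth_default ?horner0 //.
  apply: leq_trans (leqSpred _) (leq_trans _ h); rewrite ltnS.
  exact: (leq_bigmax (F := fun j => (size (bsl (v j))).-1)).
have cC k t i l : (cross (fun j => (k j)%:P) (fun j => sl t (v j)) i)`_l =
    cross k (fun j => (sl t (v j))`_l) i.
  by rewrite /cross coefB !coefCM.
have sC k t i : (size (cross (fun j => (k j)%:P) (fun j => sl t (v j)) i) <= xd.+1)%N.
  apply/leq_sizeP => l h; rewrite cC /cross !(leq_sizeP _ _ (sv t _) l h).
  by rewrite !mulr0 subrr.
have tp k t i := poly_sqr_top (sp t) (sC k t i).
have p0 : bsl p != 0.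
  apply: contra_neq nz => h; have p10 : sl t1 p = 0 by apply: sl_eq0.
  by rewrite /sqs p10 mul0r coef0.
have lp : (bsl p)`_hd != 0 by rewrite -lead_coefE lead_coef_eq0.
have [j vj] : exists j, (bsl (v j))`_xd != 0.
  have c3 : (0 < #|'I_3|)%N by rewrite card_ord.
  have [j jE] := @bigop.eq_bigmax _ (fun j => (size (bsl (v j))).-1) c3; rewrite -/xd in jE.
  have [v0|v0] := eqVneq (bsl (v j)) 0; last by exists j; rewrite jE -lead_coefE lead_coef_eq0.
  have xd0 : xd = 0%N by rewrite jE v0 size_poly0.
  apply: contrapT => H; move/eqP: nz; apply.
  have H' l : bsl (v l) = 0.
    apply/eqP; apply: contrapT => /negP vl; apply: H; exists l.
    have : ((size (bsl (v l))).-1 <= xd)%N by exact: (leq_bigmax (F := fun j => (size (bsl (v j))).-1)).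
    by rewrite xd0 leqn0 => /eqP h; rewrite -h -lead_coefE lead_coef_eq0.
  have v0' l : sl t1 (v l) = 0 by apply: sl_eq0.
  by rewrite /sqs /cross !v0' !mulr0 subrr expr0n mulr0 coef0.
have [rp _ rpE] := roots_seq lp; have [rv _ rvE] := roots_seq vj.
have [E E0 EP] := thin_curve (fun j => (bsl (v j))`_xd).
have G : gen (fun k => forall t, t \notin rp ++ rv -> exists i, (psq k t i)`_(hd + 2 * xd) != 0).
  exists E => // k Ek t; rewrite mem_cat negb_or rpE rvE => /andP[tp' tv].
  apply: contrapT => H; move/eqP: Ek; apply.
  have C0 i : cross (fun j => ((bsl (v j))`_xd).[t]) k i = 0.
    rewrite cross_anti; apply/eqP; rewrite oppr_eq0; apply: contrapT => /negP h; apply: H.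
    exists i; have [-> _] := tp k t i; rewrite cC mulf_neq0 //; first by rewrite coef_sl.
    rewrite expf_neq0 //; apply: contra_neq h => <-; apply: eq_cross => // l.
    by rewrite coef_sl.
  have kE := cross0_parallel (a := fun j => ((bsl (v j))`_xd).[t]) tv C0.
  by rewrite (meval_eq _ kE) EP.
have -> : b = (hd + 2 * xd)%N.
  apply/eqP; rewrite eqn_leq; apply/andP; split.
    rewrite leqNgt; apply/negP => h; move/eqP: nz; apply; have [_ /leq_sizeP] := tp k1 t1 i1.
    exact.
  have [k Gk] := gen_ex G; have [t tn] := cof_ex (cof_notin (rp ++ rv)).
  have [i ni] := Gk t tn; rewrite leqNgt; apply/negP => h; move/eqP: ni; apply.
  by have /leq_sizeP := sb k t i; apply.
by exists (rp ++ rv).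
Qed.
End Leads.

Variables (X N U : 'I_3 -> {mpoly F[3]}) (Ht Wt Q0 B : {mpoly F[3]}) (Th : seq F).
Hypothesis UX : forall p, \sum_i meval p (U i) * meval p (X i) = 0.
Hypothesis UN : forall p, \sum_i meval p (U i) * meval p (N i) = 0.
Hypothesis QU : forall p i, meval p Q0 * meval p (U i) =
  cross (fun j => meval p (X j)) (fun j => meval p (N j)) i.

Hypothesis nU : forall t, t \notin Th -> forall s, exists i, meval (pn s t) (U i) != 0.
Hypothesis nN : forall t, t \notin Th -> forall s, exists i, meval (pn s t) (N i) != 0.
Hypothesis nX : forall t, t \notin Th -> forall s, meval (pn s t) Wt = 0 ->
  exists i, meval (pn s t) (X i) != 0.
Hypothesis nHW : forall t, t \notin Th -> forall s,
  ~ (meval (pn s t) Ht = 0 /\ meval (pn s t) Wt = 0).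
Hypothesis pH : exists s t, meval (pn s t) Ht != 0.
Hypothesis pW : exists s t, meval (pn s t) Wt != 0.
Hypothesis pQ : exists s t, meval (pn s t) Q0 != 0.

Lemma parallel_of (k v : 'I_3 -> F) : (exists i, v i != 0) -> (forall i, cross k v i = 0) ->
  exists c, k =1 (fun i => c * v i).
Proof.
move=> [j vj] H; exists (k j / v j) => i; apply: (cross0_parallel vj) => l.
by rewrite cross_anti H oppr0.
Qed.

Lemma cross0_all k p (v : 'I_3 -> {mpoly F[3]}) i : (forall p, \sum_i meval p (U i) * meval p (v i) = 0) ->
  T0v U k p = 0 -> meval p (U i) != 0 -> cross k (fun j => meval p (v j)) i = 0 ->
  forall j, cross k (fun j => meval p (v j)) j = 0.
Proof.
move=> Uv T0 Ui h j; have := cross_prop T0 (Uv p) i j; rewrite h mulr0 => /eqP.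
by rewrite mulf_eq0 (negbTE Ui) orbF => /eqP.
Qed.

Lemma gen_nonzero : gen (fun k : 'I_3 -> F => exists i, k i != 0).
Proof.
have X0 : 'X_0 != 0 :> {mpoly F[3]} by rewrite -msize_poly_eq0 msizeX mdeg1.
by apply: gen_sub (gen_neq0 X0) _ => k; rewrite mevalXU; exists 0.
Qed.

(* A common zero of all T_j for every d forces k to be parallel to N on Ht = 0 or on Q0 = 0,
   or to X on Wt = 0: each time k lies on a cone over a curve. *)
Lemma no_fixed : gen (fun k => forall s t i, t \notin Th -> T0v U k (pn s t) = 0 ->
  meval (pn s t) (U i) != 0 ->
  ~ (sqv Ht X k (pn s t) i = 0 /\ sqv Wt N k (pn s t) i = 0)).
Proof.
have [sH [tH HH]] := pH; have [sW [tW WW]] := pW; have [sQ [tQ QQ]] := pQ.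
have [E1 E10 E1P] := thin_cone N HH; have [E2 E20 E2P] := thin_cone X WW.
have [E3 E30 E3P] := thin_cone N QQ.
apply: gen_sub (gen_and (gen_and gen_nonzero (gen_neq0 E10)) (gen_and (gen_neq0 E20) (gen_neq0 E30))) _.
move=> k [[[l0 kl0] k1] [k2 k3]] s t i tTh T0 Ui [/eqP + /eqP].
rewrite /sqv !mulf_eq0 !orbb => hx hy.
have kN : cross k (fun j => meval (pn s t) (N j)) i == 0 ->
    exists c, k =1 (fun l => c * meval (pn s t) (N l)).
  by move=> /eqP h; apply: parallel_of; [exact: nN|exact: cross0_all h].
case/orP: hx => /eqP hx.
  case/orP: hy => hy; first by apply: (nHW tTh (conj hx (eqP hy))).
  by have [c kE] := kN hy; move/eqP: k1; apply; rewrite (meval_eq _ kE) E1P.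
case/orP: hy => hy.
  have [||c kE] := @parallel_of k (fun l => meval (pn s t) (X l)).
  - exact: nX (eqP hy).
  - exact: cross0_all hx.
  by move/eqP: k2; apply; rewrite (meval_eq _ kE) E2P //; apply/eqP.
have [c kE] := kN hy; move/eqP: k3; apply; rewrite (meval_eq _ kE) E3P //.
have c0 : c != 0 by apply: contra_neq kl0 => h; rewrite kE h mul0r.
apply: (mulIf Ui); rewrite mul0r QU; apply: (mulfI c0); rewrite mulr0 -oppr0 -hx.
by rewrite /cross !kE; ring.
Qed.

Hypothesis BH : forall z, meval z B != 0 -> meval z Ht != 0.
Hypothesis BW : forall z, meval z B != 0 -> meval z Wt != 0.
Hypothesis BU : forall z, meval z B != 0 ->
  exists i, cross (fun j => meval z (X j)) (fun j => meval z (N j)) i != 0.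

(** With [Ht] and [Wt] nonzero, the vanishing of both terms makes a nonzero k parallel to X and to
    N, which are not parallel to each other. *)
Lemma sol_nondeg : gen (fun k => forall s t, meval (pn s t) B != 0 -> T0v U k (pn s t) = 0 ->
  exists2 i, meval (pn s t) (U i) != 0 &
    ~ (sqv Ht X k (pn s t) i = 0 /\ sqv Wt N k (pn s t) i = 0)).
Proof.
apply: gen_sub gen_nonzero _ => k kn s t Bst T0; have [i xn] := BU Bst.
have Ui : meval (pn s t) (U i) != 0 by apply: contra_neq xn; rewrite -QU => ->; rewrite mulr0.
exists i => // -[/eqP + /eqP]; rewrite /sqv !mulf_eq0 (negbTE (BH Bst)) (negbTE (BW Bst)).
rewrite !orbb /= => /eqP hX /eqP hN.
have [|cX XE] := @parallel_of (fun l => meval (pn s t) (X l)) k kn.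
  by move=> l; rewrite cross_anti (cross0_all UX T0 Ui hX) oppr0.
have [|cN NE] := @parallel_of (fun l => meval (pn s t) (N l)) k kn.
  by move=> l; rewrite cross_anti (cross0_all UN T0 Ui hN) oppr0.
by move/eqP: xn; apply; rewrite /cross !XE !NE; ring.
Qed.

Variable a : nat.
Hypothesis apos : (0 < a)%N.
Hypothesis s1 : forall t i, (size (sl t (U i)) <= a.+1)%N.
Hypothesis s2 : forall t, t \notin Th -> exists i, (sl t (U i))`_a != 0.
Hypothesis uall : forall t, exists s i, meval (pn s t) (U i) != 0.

(* If k.U(., t) = 0 then k is parallel to the cross product of two coefficient vectors of U;
   these products only sweep out a cone over a curve. *)
Lemma T0s_neq0 : gen (fun k => forall t, T0s ups eta U k t != 0).
Proof.
have coefT k t l : (T0s ups eta U k t)`_l = \sum_j k j * (sl t (U j))`_l.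
  by rewrite /T0s coef_sum; apply: eq_bigr => j _; rewrite coefZ.
pose V l j : {poly F} := (bsl (U j))`_l.
have gTh : gen (fun k => forall t, t \in Th -> T0s ups eta U k t != 0).
  apply: gen_seq => t _; have [s [i Ui]] := uall t; apply: gen_sub (gen_T0v Ui) _ => k.
  by apply: contra_neq => h; rewrite -horner_T0s h horner0.
have gV : gen (fun k => forall l, l \in iota 0 a -> forall c t,
    ~ k =1 (fun j => c * (cross (V l) (V a) j).[t])).
  apply: gen_seq => l _; have [E E0 EP] := thin_curve (cross (V l) (V a)).
  by exists E => // k Ek c t kE; move: Ek; rewrite (meval_eq _ kE) EP eqxx.
apply: gen_sub (gen_and gTh gV) _ => k [kTh kV] t.
have [/kTh//|tTh] := boolP (t \in Th); apply/eqP => T0.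
have k0 l : \sum_j k j * (sl t (U j))`_l = 0 by rewrite -coefT T0 coef0.
have crossV l j : (cross (V l) (V a) j).[t] = cross (fun j => (sl t (U j))`_l) (fun j => (sl t (U j))`_a) j.
  by rewrite /cross hornerD hornerN !hornerM /V -!coef_sl.
have all0 l j : (l < a)%N -> cross (fun j => (sl t (U j))`_l) (fun j => (sl t (U j))`_a) j = 0.
  move=> la; apply/eqP; apply: contrapT => /negP h.
  have [||c kE] := @parallel_of k (cross (fun j => (sl t (U j))`_l) (fun j => (sl t (U j))`_a)).
  - by exists j.
  - by move=> i; rewrite cross_anti cross_cross0 ?oppr0.
  apply: (kV l _ c t); first by rewrite mem_iota.
  by move=> i; rewrite kE crossV.
have [j0 Uj0] := s2 tTh.
(* All coefficient vectors being multiples of the top one, U(., t) is one polynomial times a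
   constant vector; since [a] is positive it has a root, a common zero of the [U j]. *)
have UE j : sl t (U j) = ((sl t (U j))`_a / (sl t (U j0))`_a) *: sl t (U j0).
  apply/polyP => l; rewrite coefZ; apply: (mulIf Uj0); rewrite mulrAC divfK //.
  have [la|al|->] := ltngtP l a; last by rewrite mulrC.
    by rewrite (cross_all (fun i => all0 l i la)) mulrC.
  by rewrite !(leq_sizeP _ _ (s1 t _) l al) mulr0 mul0r.
have /closed_rootP[s1' rs] : size (sl t (U j0)) != 1%N.
  apply: contra Uj0 => /eqP h; rewrite nth_default // h //.
have [j] := nU tTh s1'; rewrite -horner_sl UE hornerZ.
by rewrite (rootP rs) mulr0 eqxx.
Qed.
End PlaneFacts.

Section PlaneElim.
Variables (F : numClosedFieldType) (eta : F).

Lemma plane_point (q : {mpoly F[3]}) : q != 0 ->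
  cof (fun ups => exists s t, meval (pnt ups eta s t) q != 0).
Proof.
move=> q0; have h : (1 : 'I_3) != 2 by [].
apply: cof_sub (cof_slant eta h q0) _ => ups [z [z2 zq]]; exists (z 0), (z 1).
apply: contra_neq zq => <-; apply: meval_eq; apply: I3P; rewrite /pnt /vec3 //=.
Qed.

Lemma plane_roots (psi : {mpoly F[2]}) : psi != 0 ->
  cof (fun ups => exists Th : seq F, forall t, t \notin Th ->
    meval (fun j => if j == 0 then t else ups + eta * t) psi != 0).
Proof.
move=> p0; have h : (0 : 'I_2) != 1 by [].
apply: cof_sub (cof_slant eta h p0) _ => ups [z [z2 zq]].
pose L : {poly F} := mmap polyC (lineX predT (fun j : 'I_2 => if j == 0 then 0 else ups)
  (fun j => if j == 0 then 1 else eta)) psi.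
have LE t : L.[t] = meval (fun j => if j == 0 then t else ups + eta * t) psi.
  rewrite horner_lineX; apply: meval_eq => j /=; case: (j == 0); rewrite ?add0r ?mul1r //.
have L0 : L != 0.
  apply: contra_neq zq => h0; have := LE (z 0); rewrite h0 horner0 => ->; apply: meval_eq => j.
  case: eqP => [->//|/eqP j0]; have -> : j = 1 by apply: val_inj; case: j j0 => -[|[|]].
  by rewrite z2.
have [rs _ rsE] := roots_seq L0; exists rs => t.
by rewrite rsE /root LE.
Qed.

Lemma plane_elim (qs : seq {mpoly F[3]}) : (exists2 q, q \in qs & q != 0) ->
  (forall p, rprime p -> ~ (forall q, q \in qs -> rdvd p q)) ->
  cof (fun ups => exists Th : seq F, forall t, t \notin Th -> forall s,
    exists2 q, q \in qs & meval (pnt ups eta s t) q != 0).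
Proof.
move=> nz nc; have [psi psi0 psiP] := elim_line ord0 (fun=> 0) nz nc.
apply: cof_sub (plane_roots psi0) _ => ups [Th H]; exists Th => t /H /psiP P s.
have [q qqs qn] := P s; exists q => //; apply: contra_neq qn => h'; rewrite -[RHS]h'; apply: meval_eq.
have u1 : unlift ord0 (1 : 'I_3) = Some 0.
  by rewrite (_ : 1 = lift ord0 (0 : 'I_2)) ?liftK //; apply: val_inj.
have u2 : unlift ord0 (2 : 'I_3) = Some 1.
  by rewrite (_ : 2 = lift ord0 (1 : 'I_2)) ?liftK //; apply: val_inj.
have u0 : unlift ord0 (0 : 'I_3) = None by exact: (unlift_none ord0).
by apply: I3P; rewrite /pnt /vec3 /pt ?u0 ?u1 ?u2 /= ?mul0r ?addr0.
Qed.

(** Elimination along (0, 1, eta) instead of t0: one value of t0 serves for every t, including the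
    exceptional ones. *)
Lemma line_elim (qs : seq {mpoly F[3]}) : (exists2 q, q \in qs & q != 0) ->
  (forall p, rprime p -> ~ (forall q, q \in qs -> rdvd p q)) ->
  cof (fun ups => exists s, forall t, exists2 q, q \in qs & meval (pnt ups eta s t) q != 0).
Proof.
move=> nz nc; have [psi psi0 psiP] := elim_line 1 (fun j : 'I_2 => if j == 0 then 0 else eta) nz nc.
have h : (0 : 'I_2) != 1 by [].
apply: cof_sub (cof_slant 0 h psi0) _ => ups [z [z1 /psiP H]]; exists (z 0) => t.
have [q qqs qn] := H t; exists q => //; apply: contra_neq qn => h'; rewrite -[RHS]h'; apply: meval_eq.
have u0 : unlift 1 (0 : 'I_3) = Some 0.
  by rewrite (_ : 0 = lift (1 : 'I_3) (0 : 'I_2)) ?liftK //; apply: val_inj.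
have u2 : unlift 1 (2 : 'I_3) = Some 1.
  by rewrite (_ : 2 = lift (1 : 'I_3) (1 : 'I_2)) ?liftK //; apply: val_inj.
by apply: I3P; rewrite /pnt /vec3 /pt ?unlift_none ?u0 ?u2 /= ?z1 ?mul0r ?addr0.
Qed.
End PlaneElim.

Lemma meval_term (F : fieldType) n (z : 'I_n -> F) (c h m d w g : {mpoly F[n]}) :
  meval z (c * (h * m ^+ 2 - d ^+ 2 * w * g ^+ 2)) =
  meval z c * (meval z h * meval z m ^+ 2 - meval z d ^+ 2 * meval z w * meval z g ^+ 2).
Proof. by rewrite !expr2 mevalM mevalB !mevalM. Qed.

Lemma size_pencil (F : fieldType) (x y : {poly F}) b :
  (forall d, (size (x - d ^+ 2 *: y)%R <= b)%N) -> (size x <= b)%N /\ (size y <= b)%N.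
Proof.
move=> S; have hx : (size x <= b)%N by have := S 0; rewrite expr0n scale0r subr0.
split=> //; have := S 1; rewrite expr1n scale1r => h.
apply/leq_sizeP => l hl; have := leq_sizeP _ _ h l hl.
by rewrite coefB (leq_sizeP _ _ hx l hl) sub0r => /eqP; rewrite oppr_eq0 => /eqP.
Qed.

Section PlaneSetup.
Variable F : numClosedFieldType.
Variables (X N U : 'I_3 -> {mpoly F[3]}) (W Q0 Q Ht Wt : {mpoly F[3]}).
Hypothesis XW_nc : forall p, rprime p ->
  ~ (forall q, q \in [:: X 0; X 1; X 2; W] -> rdvd p q).
Hypothesis N_nc : forall p, rprime p -> ~ (forall q, q \in [:: N 0; N 1; N 2] -> rdvd p q).
Hypothesis U_nc : forall p, rprime p -> ~ (forall q, q \in [:: U 0; U 1; U 2] -> rdvd p q).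
Hypothesis HW_nc : forall p, rprime p -> ~ (forall q, q \in [:: Ht; Wt] -> rdvd p q).
Hypothesis U_def : forall j, cross X N j = Q0 * U j.
Hypothesis Wt_def : W ^+ 2 = Q * Wt.
Hypothesis W0 : W != 0.
Hypothesis Ht0 : Ht != 0.
Hypothesis Q00 : Q0 != 0.
Hypothesis Unz : exists i, U i != 0.
Hypothesis Nnz : exists i, N i != 0.

Definition T0p : {mpoly F[10]} := \sum_(j < 3) kvar F j * emb (U j).
Definition Tp : {mpoly F[10]} := \sum_(j < 3) cvar F j *
  (emb Ht * cross (@kvar F) (fun j => emb (X j)) j ^+ 2
   - dvar F ^+ 2 * emb Wt * cross (@kvar F) (fun j => emb (N j)) j ^+ 2).
Definition ta := (size (upoly0 T0p)).-1.
Definition tb := (size (upoly0 Tp)).-1.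

Lemma Wt0 : Wt != 0.
Proof. by have := expf_neq0 2 W0; rewrite Wt_def; apply: contra_neq => ->; rewrite mulr0. Qed.

Lemma meval_T0p s t1 t2 d k c : meval (z10 s t1 t2 d k c) T0p = T0v U k (vec3 s t1 t2).
Proof.
rewrite /T0p [meval _ _]raddf_sum /=; apply: eq_bigr => j _.
by rewrite mevalM meval_kvar meval_emb.
Qed.

Lemma meval_Tp s t1 t2 d k c : meval (z10 s t1 t2 d k c) Tp =
  \sum_j c j * (sqv Ht X k (vec3 s t1 t2) j - d ^+ 2 * sqv Wt N k (vec3 s t1 t2) j).
Proof.
rewrite /Tp [meval _ _]raddf_sum /=; apply: eq_bigr => j _.
rewrite meval_term meval_cvar meval_dvar !meval_emb.
have E (v : 'I_3 -> {mpoly F[3]}) : meval (z10 s t1 t2 d k c) (cross (@kvar F) (fun j => emb (v j)) j) =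
    cross k (fun j => meval (vec3 s t1 t2) (v j)) j.
  by rewrite /cross mevalB !mevalM !meval_kvar !meval_emb.
by rewrite -mulrA; congr (_ * (_ * _ ^+ 2 - _ * (_ * _ ^+ 2))); [apply: (E X)|apply: (E N)].
Qed.

Section Line.
Variables ups eta : F.
Local Notation zt := (zt ups eta).
Local Notation xs := (sqs ups eta Ht X).
Local Notation ys := (sqs ups eta Wt N).

Lemma slice_T0p t d k c : map_poly (meval (zt t d k c)) (upoly0 T0p) = T0s ups eta U k t.
Proof.
by apply: horner_inj => s; rewrite horner_upoly0 meval_t0 meval_T0p horner_T0s.
Qed.

Lemma slice_Tp t d k c : map_poly (meval (zt t d k c)) (upoly0 Tp) = Ts xs ys c d k t.
Proof.
apply: horner_inj => s; rewrite horner_upoly0 meval_t0 meval_Tp.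
by rewrite (horner_Ts (horner_sqs ups eta Ht X) (horner_sqs ups eta Wt N)).
Qed.

Lemma meval_Rs t d k c : meval (zt t d k c) (resultant (upoly0 T0p) (upoly0 Tp)) =
  \det (sylv ta tb (T0s ups eta U k t) (Ts xs ys c d k t)).
Proof.
rewrite -(slice_T0p t d k c) -(slice_Tp t d k c) /ta /tb.
by move: (upoly0 T0p) (upoly0 Tp) => u v; apply: resultant_morph.
Qed.

Lemma size_slice (p : {poly {mpoly F[10]}}) (z : 'I_10 -> F) :
  (size (map_poly (meval z) p) <= (size p).-1.+1)%N.
Proof.
apply: leq_trans (leqSpred _); apply/leq_sizeP => j sj.
by rewrite coef_map /= nth_default // meval0.
Qed.

Definition unitv (i j : 'I_3) : F := (i == j)%:R.

Lemma sum_unitv (V : lmodType F) i (v : 'I_3 -> V) : \sum_j unitv i j *: v j = v i.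
Proof.
rewrite (bigD1 i) //= /unitv eqxx scale1r big1 ?addr0 // => j /negbTE.
by rewrite eq_sym => ->; rewrite scale0r.
Qed.

Lemma plane_s1 t i : (size (sl ups eta t (U i)) <= ta.+1)%N.
Proof.
have := size_slice (upoly0 T0p) (zt t 0 (unitv i) (unitv i)).
by rewrite slice_T0p /T0s sum_unitv.
Qed.

Lemma plane_s3 k t i : (size (xs k t i) <= tb.+1)%N /\ (size (ys k t i) <= tb.+1)%N.
Proof.
apply: size_pencil => d; have := size_slice (upoly0 Tp) (zt t d k (unitv i)).
by rewrite slice_Tp /Ts sum_unitv.
Qed.
End Line.

Lemma upoly0_neq0 (p : {mpoly F[10]}) z : meval z p != 0 -> upoly0 p != 0.
Proof.
move=> pz; apply: contra_neq pz => h; have := horner_upoly0 p z (z ord0).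
rewrite h rmorph0 horner0 => ->; apply: meval_eq => j; by case: eqP => // ->.
Qed.

Lemma lead_slice (p : {mpoly F[10]}) eta : upoly0 p != 0 -> cof (fun ups => exists t d k c,
  (map_poly (meval (zt ups eta t d k c)) (upoly0 p))`_(size (upoly0 p)).-1 != 0).
Proof.
move=> p0; have l0 : lead_coef (upoly0 p) != 0 by rewrite lead_coef_eq0.
have h : (inord 1 : 'I_10) != inord 2 by rewrite -val_eqE /= !inordK.
apply: cof_sub (cof_slant eta h l0) _ => ups [z [z2 zl]].
have [s [t1 [t2 [d [k [c zE]]]]]] := z10_all z; exists t1, d, k, c.
have t2E : t2 = ups + eta * t1 by move: z2; rewrite !zE /z10 !inordK.
rewrite (@upoly0_ext _ _ z); last first.
  by move=> j j0; rewrite zE /zt t2E; case: j j0 => -[|j].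
by rewrite coef_map -lead_coefE.
Qed.

Lemma in3 (v : 'I_3 -> {mpoly F[3]}) q z : q \in [:: v 0; v 1; v 2] -> meval z q != 0 ->
  exists i, meval z (v i) != 0.
Proof. by rewrite !inE => /or3P[]/eqP-> h; [exists 0|exists 1|exists 2]. Qed.

Lemma nz3 (v : 'I_3 -> {mpoly F[3]}) : (exists i, v i != 0) ->
  exists2 q, q \in [:: v 0; v 1; v 2] & q != 0.
Proof.
move=> [i vi]; exists (v i) => //; rewrite !inE.
by move: i {vi}; apply: I3P; rewrite eqxx ?orbT.
Qed.

Definition plane_ok (eta ups : F) B (Th : seq F) : Prop :=
  [/\ forall t, t \notin Th -> exists i, (sl ups eta t (U i))`_ta != 0,
      gen (fun k => forall t, t \notin Th -> exists i,
        (sqs ups eta Ht X k t i)`_tb != 0 \/ (sqs ups eta Wt N k t i)`_tb != 0),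
      forall t, t \notin Th -> forall s, exists i, meval (pnt ups eta s t) (U i) != 0,
      gen (fun k => forall s t i, t \notin Th -> T0v U k (pnt ups eta s t) = 0 ->
        meval (pnt ups eta s t) (U i) != 0 ->
        ~ (sqv Ht X k (pnt ups eta s t) i = 0 /\ sqv Wt N k (pnt ups eta s t) i = 0))
    & [/\ (0 < ta)%N -> gen (fun k => forall t, T0s ups eta U k t != 0),
          ta = 0%N -> forall s t, exists i, meval (pnt ups eta s t) (U i) != 0
        & forall t, t \notin Th -> sl ups eta t B != 0]].

Lemma UX_orth z : \sum_i meval z (U i) * meval z (X i) = 0.
Proof.
have : \sum_i U i * X i = 0.
  apply: (mulfI Q00); rewrite mulr0 -[RHS](cross_orth X N).1 mulr_sumr.
  by apply: eq_bigr => i _; rewrite U_def mulrA.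
move/(congr1 (meval z)); rewrite meval0 [meval _ _]raddf_sum /= => h; rewrite -[RHS]h.
by apply: eq_bigr => i _; rewrite mevalM.
Qed.

Lemma UN_orth z : \sum_i meval z (U i) * meval z (N i) = 0.
Proof.
have : \sum_i U i * N i = 0.
  apply: (mulfI Q00); rewrite mulr0 -[RHS](cross_orth X N).2 mulr_sumr.
  by apply: eq_bigr => i _; rewrite U_def mulrA.
move/(congr1 (meval z)); rewrite meval0 [meval _ _]raddf_sum /= => h; rewrite -[RHS]h.
by apply: eq_bigr => i _; rewrite mevalM.
Qed.

Lemma QU_cross z i : meval z Q0 * meval z (U i) =
  cross (fun j => meval z (X j)) (fun j => meval z (N j)) i.
Proof. by rewrite -mevalM -U_def meval_cross. Qed.

Lemma vec3E (z : 'I_3 -> F) : vec3 (z 0) (z 1) (z 2) =1 z.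
Proof. by apply: I3P. Qed.

Lemma ex_cross (v : 'I_3 -> F) i : v i != 0 -> exists k j, cross k v j != 0.
Proof.
move: i; apply: I3P => h.
- exists (unitv 1), 2; have [_ _ ->] := crossE (unitv 1) v.
  by rewrite /unitv /= mul0r mul1r sub0r oppr_eq0.
- exists (unitv 2), 0; have [-> _ _] := crossE (unitv 2) v.
  by rewrite /unitv /= mul0r mul1r sub0r oppr_eq0.
- exists (unitv 0), 1; have [_ -> _] := crossE (unitv 0) v.
  by rewrite /unitv /= mul0r mul1r sub0r oppr_eq0.
Qed.

Lemma T0p_upoly : upoly0 T0p != 0.
Proof.
have [i Ui] := Unz; have [z zU] := mpoly_nonroot Ui; have [k kT] := gen_ex (gen_T0v zU).
apply: (@upoly0_neq0 _ (z10 (z 0) (z 1) (z 2) 0 k k)); rewrite meval_T0p.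
apply: contra_neq kT => h; rewrite -[RHS]h; apply: eq_bigr => j _; congr (_ * _).
by apply: meval_eq => l; rewrite vec3E.
Qed.

Lemma Tp_upoly : upoly0 Tp != 0.
Proof.
have [i Ni] := Nnz; have [z] := mpoly_nonroot (mulf_neq0 Wt0 Ni).
rewrite mevalM mulf_eq0 negb_or => /andP[Wz Nz].
have [k [j kN]] := @ex_cross (fun l => meval z (N l)) i Nz.
have y0 : sqv Wt N k (vec3 (z 0) (z 1) (z 2)) j != 0.
  rewrite /sqv mulf_neq0 //; first by rewrite (meval_eq _ (vec3E z)).
  rewrite expf_neq0 //; apply: contra_neq kN => h; rewrite -[RHS]h; apply: eq_cross => // l.
  by rewrite (meval_eq _ (vec3E z)).
have xy : ~ (sqv Ht X k (vec3 (z 0) (z 1) (z 2)) j = 0 /\ sqv Wt N k (vec3 (z 0) (z 1) (z 2)) j = 0).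
  by case=> _ /eqP; rewrite (negbTE y0).
have [d hd] := cof_ex (cof_pencil xy).
apply: (@upoly0_neq0 _ (z10 (z 0) (z 1) (z 2) d k (unitv j))); rewrite meval_Tp.
by rewrite (@sum_unitv F^o).
Qed.

(** Each requirement rests on a coprimality or on a nonzero polynomial and so fails for finitely
    many [ups]; the union of the resulting exceptional sets of t serves as [Th]. *)
Lemma plane_setup eta B : B != 0 -> cof (fun ups => exists Th, plane_ok eta ups B Th).
Proof.
move=> B0.
have cU := plane_elim eta (nz3 Unz) U_nc; have cN := plane_elim eta (nz3 Nnz) N_nc.
have cX : cof (fun ups => exists Th : seq F, forall t, t \notin Th -> forall s,
    exists2 q, q \in [:: X 0; X 1; X 2; W] & meval (pnt ups eta s t) q != 0).
  by apply: plane_elim => //; exists W => //; rewrite !inE eqxx !orbT.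
have cH : cof (fun ups => exists Th : seq F, forall t, t \notin Th -> forall s,
    exists2 q, q \in [:: Ht; Wt] & meval (pnt ups eta s t) q != 0).
  by apply: plane_elim => //; exists Ht => //; rewrite mem_head.
have cL := line_elim eta (nz3 Unz) U_nc.
have cP := cof_and (plane_point eta Ht0) (cof_and (plane_point eta Wt0) (plane_point eta Q00)).
have cc := cof_and (cof_and (cof_and cU cN) (cof_and cX cH)) (cof_and (cof_and cL cP)
  (cof_and (plane_point eta B0) (cof_and (lead_slice eta T0p_upoly) (lead_slice eta Tp_upoly)))).
apply: cof_sub cc _ => ups.
move=> [[[[T1 T1P] [T2 T2P]] [[T3 T3P] [T4 T4P]]] [[[s0 s0P] [pH [pW pQ]]] [[sB [tB BB]] [lT0 lT]]]].
have [i5 [T5 T5P]] : exists i (T5 : seq F), forall t, t \notin T5 -> (sl ups eta t (U i))`_ta != 0.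
  have [t [d [k [c]]]] := lT0; rewrite slice_T0p -/ta => h.
  have [i hi] : exists i, (sl ups eta t (U i))`_ta != 0.
    apply: contrapT => H; move/eqP: h; apply; rewrite /T0s coef_sum big1 // => i _.
    rewrite coefZ (_ : _`_ta = 0) ?mulr0 //; apply/eqP; apply: contrapT => /negP h.
    by apply: H; exists i.
  have b0 : (bsl ups eta (U i))`_ta != 0 by apply: contra_neq hi => h'; rewrite coef_sl h' horner0.
  have [rs _ rsE] := roots_seq b0; exists i, rs => t'; rewrite rsE => h'.
  by rewrite coef_sl.
have [T6 T6P] : exists T6 : seq F, gen (fun k => forall t, t \notin T6 -> exists i,
    (sqs ups eta Ht X k t i)`_tb != 0 \/ (sqs ups eta Wt N k t i)`_tb != 0).
  have [t [d [k [c]]]] := lT; rewrite slice_Tp -/tb => h.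
  have [i hi] : exists i, (sqs ups eta Ht X k t i)`_tb != 0 \/ (sqs ups eta Wt N k t i)`_tb != 0.
    apply: contrapT => H; move/eqP: h; apply; rewrite /Ts coef_sum big1 // => i _.
    rewrite coefZ coefB coefZ.
    have [x0|x0] := eqVneq (sqs ups eta Ht X k t i)`_tb 0; last by case: H; exists i; left.
    have [y0|y0] := eqVneq (sqs ups eta Wt N k t i)`_tb 0; last by case: H; exists i; right.
    by rewrite x0 y0 !mulr0 subrr mulr0.
  case: hi => hi.
    have [|T6 T6P] := @lead_survives F ups eta Ht X tb _ (ex_intro _ k (ex_intro _ t (ex_intro _ i hi))).
      by move=> k' t' i'; have [] := plane_s3 ups eta k' t' i'.
    by exists T6; apply: gen_sub T6P _ => k' H t' /H[i' ?]; exists i'; left.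
  have [|T6 T6P] := @lead_survives F ups eta Wt N tb _ (ex_intro _ k (ex_intro _ t (ex_intro _ i hi))).
    by move=> k' t' i'; have [] := plane_s3 ups eta k' t' i'.
  by exists T6; apply: gen_sub T6P _ => k' H t' /H[i' ?]; exists i'; right.
have [T7 T7P] : exists T7 : seq F, forall t, t \notin T7 -> sl ups eta t B != 0.
  have b0 : bsl ups eta B != 0.
    by apply: contra_neq BB => h; rewrite -horner_sl (sl_eq0 _ h) horner0.
  have [|rs _ rsE] := @roots_seq F (lead_coef (bsl ups eta B)); first by rewrite lead_coef_eq0.
  exists rs => t; rewrite rsE; apply: contraNneq => h.
  by rewrite /root lead_coefE -coef_sl h coef0.
pose Th := T1 ++ T2 ++ T3 ++ T4 ++ T5 ++ T6 ++ T7.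
have sub t : t \notin Th -> [/\ t \notin T1, t \notin T2, t \notin T3, t \notin T4 &
    [/\ t \notin T5, t \notin T6 & t \notin T7]].
  rewrite /Th !mem_cat !negb_or.
  by do 6 (case/andP => ?); move=> ?.
have nU t : t \notin Th -> forall s, exists i, meval (pnt ups eta s t) (U i) != 0.
  by move=> /sub[/T1P H _ _ _ _] s; have [q qi qn] := H s; apply: in3 qi qn.
have s2 t : t \notin Th -> exists i, (sl ups eta t (U i))`_ta != 0.
  by move=> /sub[_ _ _ _ [/T5P h _ _]]; exists i5.
exists Th; split=> //.
- by apply: gen_sub T6P _ => k H t /sub[_ _ _ _ [_ /H h _]].
- apply: (no_fixed (Q0 := Q0)) pH pW pQ => //.
  + exact: UX_orth.
  + exact: UN_orth.
  + exact: QU_cross.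
  + by move=> t /sub[_ /T2P H _ _ _] s; have [q qi qn] := H s; apply: in3 qi qn.
  + move=> t /sub[_ _ /T3P H _ _] s Wz; have [q] := H s.
    have Wz' : meval (pnt ups eta s t) W = 0.
      apply/eqP; rewrite -[_ == 0](expf_eq0 _ 2) -rmorphXn /= Wt_def mevalM Wz mulr0 //.
    rewrite !inE => /or4P[]/eqP-> h; [by exists 0|by exists 1|by exists 2|].
    by rewrite Wz' eqxx in h.
  + move=> t /sub[_ _ _ /T4P H _] s [h1 h2]; have [q] := H s.
    by rewrite !inE => /orP[]/eqP->; rewrite ?h1 ?h2 eqxx.
- have ua t : exists i, meval (pnt ups eta s0 t) (U i) != 0.
    by have [q qi qn] := s0P t; apply: in3 qi qn.
  split.
  + move=> apos; apply: (T0s_neq0 nU apos (plane_s1 ups eta) s2) => t.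
    by exists s0; apply: ua.
  + move=> a0 s t; have [i Ui] := ua t; exists i; move: Ui; rewrite -!horner_sl.
    by have := plane_s1 ups eta t i; rewrite a0 => /size1_polyC ->; rewrite !hornerC.
  + by move=> t /sub[_ _ _ _ [_ _ /T7P]].
Qed.

Lemma Rs_neq0 : resultant (upoly0 T0p) (upoly0 Tp) != 0.
Proof.
have [ups [Th [s2 s4 n1 n2 [n3 n4 n5]]]] := cof_ex (plane_setup 0 (oner_neq0 {mpoly F[3]})).
suff [t [d [k [c h]]]] : exists t d k c,
    \det (sylv ta tb (T0s ups 0 U k t) (Ts (sqs ups 0 Ht X) (sqs ups 0 Wt N) c d k t)) != 0.
  by apply: contra_neq h => h; rewrite -meval_Rs h meval0.
have [t tTh] := cof_ex (cof_notin Th).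
have [a0|apos] := posnP ta.
  have [i Ui] := n1 t tTh 0; have [k kT] := gen_ex (gen_T0v Ui).
  exists t, 0, k, k; rewrite a0.
  have := plane_s1 ups 0 t; rewrite a0 => sz.
  have : (size (T0s ups 0 U k t) <= 1)%N.
    rewrite /T0s; apply: leq_trans (size_sum _ _ _) _; apply/bigmax_leqP => j _.
    exact: leq_trans (size_scale_leq _ _) (sz j).
  move/size1_polyC => E; rewrite E det_sylv0 expf_neq0 //.
  by move: kT; rewrite -horner_T0s {1}E hornerC.
have [k kP] := gen_ex (sylv_nonzero (horner_sqs ups 0 Ht X) (horner_sqs ups 0 Wt N)
  (plane_s1 ups 0) (plane_s3 ups 0) s4 n1 n2 n3 apos).
by have [c [d h]] := kP t tTh; exists t, d, k, c.
Qed.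
End PlaneSetup.

Lemma content_dvd (F : numClosedFieldType) n (S : pred 'I_n.+1) (p a : {mpoly F[n.+1]}) :
  is_gcd (coefs_in S p) a -> exists p', p = a * p'.
Proof.
move=> [aD _]; rewrite (coefm_sum S p); elim/big_rec: _ => [|m q mk [r ->]].
  by exists 0; rewrite mulr0.
have [m0|m0] := boolP (m \in keys S p); last first.
  rewrite /coefm big1_seq ?mul0r ?add0r; first by exists r.
  move=> m' /andP[/eqP m'E m'p]; move: m0; rewrite -m'E.
  by rewrite /keys map_f.
have [|r' ->] := aD (coefm S p m); first exact: map_f.
by exists (r' * 'X_[m] + r); rewrite mulrDr mulrA.
Qed.

(** * Contents and primitive parts on the line t2 = ups + eta t1 *)

Section GenericDk.
Variable F : numClosedFieldType.

Lemma gen_sub4 n (q : {mpoly F[n]}) (h : 'I_n -> {mpoly F[4]}) :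
  (exists d k, meval (fun j => meval (at4 d k) (h j)) q != 0) ->
  gen (fun k => cof (fun d => meval (fun j => meval (at4 d k) (h j)) q != 0)).
Proof.
move=> [d [k nz]]; have [E EE] := ex_comp_mpoly h q.
have E0 : E != 0 by apply: contra_neq nz => e0; rewrite -EE e0 meval0.
by apply: gen_sub (gen_at4 (gen_neq0 E0)) _ => k' /cof_sub; apply=> d'; rewrite EE.
Qed.

Let X4 (i : 'I_4) : {mpoly F[4]} := 'X_i.

Lemma gen_z10 (q : {mpoly F[10]}) s t1 t2 c :
  (exists d k, meval (z10 s t1 t2 d k c) q != 0) ->
  gen (fun k => cof (fun d => meval (z10 s t1 t2 d k c) q != 0)).
Proof.
pose h (j : 'I_10) : {mpoly F[4]} := nth 0 [:: s%:MP; t1%:MP; t2%:MP; X4 ord0;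
  X4 (lift ord0 0); X4 (lift ord0 1); X4 (lift ord0 2); (c 0)%:MP; (c 1)%:MP; (c 2)%:MP] j.
have hE d k : (fun j => meval (at4 d k) (h j)) =1 z10 s t1 t2 d k c.
  move=> j; rewrite /h /z10 /X4.
  by case: j => -[|[|[|[|[|[|[|[|[|[|//]]]]]]]]]] ? /=; rewrite ?mevalC ?mevalXU ?at40 ?at4l.
move=> [d [k nz]]; apply: gen_sub (gen_sub4 (q := q) (h := h) _) _.
  by exists d, k; rewrite (meval_eq _ (hE d k)).
by move=> k' /cof_sub; apply=> d'; rewrite (meval_eq _ (hE d' k')).
Qed.

(* The coordinates t0, t2, d, k, c, in this order (all those of z10 except t1). *)
Definition z9 (s t2 d : F) (k c : 'I_3 -> F) (j : 'I_9) : F :=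
  nth 0 [:: s; t2; d; k 0; k 1; k 2; c 0; c 1; c 2] j.

Lemma z9_all (w : 'I_9 -> F) : exists s t2 d k c, w =1 z9 s t2 d k c.
Proof.
exists (w (inord 0)), (w (inord 1)), (w (inord 2)),
  (fun i => w (inord (3 + i))), (fun i => w (inord (6 + i))) => j; rewrite /z9.
rewrite -{1}[j]inord_val.
by case: j => -[|[|[|[|[|[|[|[|[|//]]]]]]]]] h.
Qed.

Lemma gen_z9 (q : {mpoly F[9]}) s t2 c :
  (exists d k, meval (z9 s t2 d k c) q != 0) ->
  gen (fun k => cof (fun d => meval (z9 s t2 d k c) q != 0)).
Proof.
pose h (j : 'I_9) : {mpoly F[4]} := nth 0 [:: s%:MP; t2%:MP; X4 ord0;
  X4 (lift ord0 0); X4 (lift ord0 1); X4 (lift ord0 2); (c 0)%:MP; (c 1)%:MP; (c 2)%:MP] j.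
have hE d k : (fun j => meval (at4 d k) (h j)) =1 z9 s t2 d k c.
  move=> j; rewrite /h /z9 /X4.
  by case: j => -[|[|[|[|[|[|[|[|[|//]]]]]]]]] ? /=; rewrite ?mevalC ?mevalXU ?at40 ?at4l.
move=> [d [k nz]]; apply: gen_sub (gen_sub4 (q := q) (h := h) _) _.
  by exists d, k; rewrite (meval_eq _ (hE d k)).
by move=> k' /cof_sub; apply=> d'; rewrite (meval_eq _ (hE d' k')).
Qed.

Definition i1 : 'I_10 := Ordinal (isT : (1 < 10)%N).
Definition eta9 (eta : F) (j : 'I_9) : F := if (j : nat) == 1%N then eta else 0.

Lemma pt_z9 eta s t2 d k c t :
  pt i1 (eta9 eta) (z9 s t2 d k c) t =1 z10 s t (t2 + eta * t) d k c.
Proof.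
move=> j; rewrite /pt; case: (unliftP i1 j) => [j' ->|->]; rewrite /z10 //=.
rewrite /z9 /eta9.
by case: j' => -[|[|[|[|[|[|[|[|[|//]]]]]]]]] ? /=; rewrite ?mul0r ?addr0.
Qed.

Lemma cof_z9 (psi : {mpoly F[9]}) : psi != 0 -> cof (fun ups => exists s d k c,
  meval (z9 s ups d k c) psi != 0).
Proof.
move=> p0; have h : (inord 0 : 'I_9) != inord 1 by rewrite -val_eqE /= !inordK.
apply: cof_sub (cof_slant 0 h p0) _ => ups [z [z1 zp]].
have [s [t2 [d [k [c zE]]]]] := z9_all z; exists s, d, k, c.
have t2E : t2 = ups by move: z1; rewrite !zE /z9 !inordK //= mul0r addr0.
by apply: contra_neq zp => h'; rewrite -[RHS]h'; apply: meval_eq => j; rewrite zE t2E.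
Qed.

Lemma z10_inj (s t1 t2 d : F) (k c : 'I_3 -> F) (s' t1' t2' d' : F) (k' c' : 'I_3 -> F) (S : pred 'I_10) :
  agree S (z10 s t1 t2 d k c) (z10 s' t1' t2' d' k' c') ->
  [/\ ~~ S (inord 0) -> s = s', ~~ S (inord 1) -> t1 = t1', ~~ S (inord 2) -> t2 = t2',
      ~~ S (inord 3) -> d = d' &
      (forall i : 'I_3, ~~ S (inord (4 + i))) -> k =1 k'].
Proof.
move=> H; split; [move=> h|move=> h|move=> h|move=> h|].
- by have := H _ h; rewrite /z10 !inordK.
- by have := H _ h; rewrite /z10 !inordK.
- by have := H _ h; rewrite /z10 !inordK.
- by have := H _ h; rewrite /z10 !inordK.
- by move=> h; apply: I3P; [have := H _ (h 0)|have := H _ (h 1)|have := H _ (h 2)]; rewrite /z10 !inordK.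
Qed.
End GenericDk.

Section ContentFacts.
Variable F : numClosedFieldType.
Variables (Rs cc g2 pp : {mpoly F[10]}).
Hypothesis Rs0 : Rs != 0.
Hypothesis Rs_t0 : sfree (pred1 ord0) Rs.
Hypothesis cc_gcd : is_gcd (coefs_in cvars Rs) cc.
Hypothesis g2_gcd : is_gcd (coefs_in dkvars cc) g2.
Hypothesis pp_def : cc = g2 * pp.

Lemma cc0 : cc != 0. Proof. by have [] := content_sfree Rs0 cc_gcd. Qed.

Lemma pp_neq0 : pp != 0.
Proof. by have := cc0; rewrite pp_def; apply: contra_neq => ->; rewrite mulr0. Qed.

Lemma cc_t0 : sfree (pred1 ord0) cc.
Proof.
have [R' RE] := content_dvd cc_gcd; apply: (@sfree_factor _ _ _ cc R'); by rewrite -RE.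
Qed.

Lemma pp_sfree (S : pred 'I_10) : sfree S cc -> sfree S pp.
Proof. by move=> h; apply: (@sfree_factor _ _ _ pp g2); rewrite mulrC -pp_def ?cc0. Qed.

Lemma g2_sfree (S : pred 'I_10) : sfree S cc -> sfree S g2.
Proof. by move=> h; apply: (@sfree_factor _ _ _ g2 pp); rewrite -pp_def ?cc0. Qed.

Lemma cc_c : sfree cvars cc. Proof. by have [] := content_sfree Rs0 cc_gcd. Qed.

Lemma pp_free s s' t1 t2 d k c c' :
  meval (z10 s t1 t2 d k c) pp = meval (z10 s' t1 t2 d k c') pp.
Proof.
rewrite (pp_sfree cc_c (w' := z10 s t1 t2 d k c')); last by case=> -[|[|[|[|[|[|[|]]]]]]].
by apply: (pp_sfree cc_t0); case=> -[|].
Qed.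

Lemma g2_free s t1 t2 d d' k k' c c' :
  meval (z10 s t1 t2 d k c) g2 = meval (z10 s t1 t2 d' k' c') g2.
Proof.
rewrite (g2_sfree cc_c (w' := z10 s t1 t2 d k c')); last by case=> -[|[|[|[|[|[|[|]]]]]]].
have [_ fg] := content_sfree cc0 g2_gcd.
by apply: fg; case=> -[|[|[|[|[|[|[|[|[|[|]]]]]]]]]].
Qed.

(** Primitivity in (d, k) enters here: on a line with general intercept, no t makes [pp] vanish
    identically in (d, k). *)
Lemma pp_line eta : cof (fun ups => forall t,
  gen (fun k => cof (fun d => meval (zt ups eta t d k (fun=> 0)) pp != 0))).
Proof.
have [psi psi0 psiP] := content_line i1 (eta9 eta) cc0 g2_gcd pp_def.
apply: cof_sub (cof_z9 psi0) _ => ups [s [d [k [c /psiP H]]]] t; have [w wA wp] := H t.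
have [s' [t1 [t2 [d' [k' [c' wE]]]]]] := z10_all w.
have [_ h1 h2 _ _] : [/\ ~~ dkvars (inord 0) -> s' = s, ~~ dkvars (inord 1) -> t1 = t,
    ~~ dkvars (inord 2) -> t2 = ups + eta * t, ~~ dkvars (inord 3) -> d' = d &
    (forall i : 'I_3, ~~ dkvars (inord (4 + i))) -> k' =1 k].
  apply: (@z10_inj F s' t1 t2 d' k' c' s t (ups + eta * t) d k c) => j jS.
  by rewrite -wE wA // pt_z9.
rewrite (meval_eq _ wE) in wp.
rewrite h1 ?h2 in wp; try by rewrite /dkvars inordK.
by apply: gen_z10; exists d', k'; rewrite (pp_free _ s' _ _ _ _ _ c').
Qed.

Lemma R'_line eta R' : Rs = cc * R' -> cof (fun ups =>
  gen (fun k => cof (fun d => forall t, exists c, meval (zt ups eta t d k c) R' != 0))).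
Proof.
move=> RE; have R't0 : sfree (pred1 ord0) R'.
  by apply: (@sfree_factor _ _ _ R' cc); rewrite mulrC -RE.
have [psi psi0 psiP] := content_line i1 (eta9 eta) Rs0 cc_gcd RE.
apply: cof_sub (cof_z9 psi0) _ => ups [s [d0 [k0 [c0 H]]]].
apply: gen_sub (gen_z9 (ex_intro _ d0 (ex_intro _ k0 H))) _ => k /cof_sub; apply=> d /psiP P t.
have [w wA wp] := P t; have [s' [t1 [t2 [d' [k' [c' wE]]]]]] := z10_all w.
have [_ h1 h2 h3 h4] : [/\ ~~ cvars (inord 0) -> s' = s, ~~ cvars (inord 1) -> t1 = t,
    ~~ cvars (inord 2) -> t2 = ups + eta * t, ~~ cvars (inord 3) -> d' = d &
    (forall i : 'I_3, ~~ cvars (inord (4 + i))) -> k' =1 k].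
  apply: (@z10_inj F s' t1 t2 d' k' c' s t (ups + eta * t) d k c0) => j jS.
  by rewrite -wE wA // pt_z9.
exists c'; apply: contra_neq wp => h; rewrite -[RHS]h; apply: R't0 => j j0; rewrite wE.
rewrite h1 ?h2 ?h3; try by rewrite /cvars inordK.
have kE : k' =1 k by apply: h4; apply: I3P; rewrite /cvars inordK.
by rewrite /zt /z10 !kE; case: j j0 => -[|].
Qed.

(** The slope comes from a point with t1 != 0 where the top form of [pp] in (t1, t2) is nonzero.
    That form at (1, eta) is the top coefficient on the line, whatever the intercept. *)
Lemma pp_top : exists eta, forall ups, gen (fun k => cof (fun d =>
  size (bl ups eta k (fun=> 0) pp).[d%:P] = (deg_in t12vars pp).+1)).
Proof.
have X1 : 'X_i1 != 0 :> {mpoly F[10]} by rewrite -msize_poly_eq0 msizeX mdeg1.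
have [z] := mpoly_nonroot (mulf_neq0 (topS_neq0 t12vars pp_neq0) X1).
rewrite mevalM mulf_eq0 negb_or mevalXU => /andP[zt z1n].
have [s [z1 [z2 [d0 [k0 [c0 zE]]]]]] := z10_all z.
rewrite zE /z10 /= in z1n; rewrite (meval_eq _ zE) in zt.
exists (z2 / z1) => ups; set eta := z2 / z1.
pose L d k v1 v2 : {poly F} :=
  mmap polyC (lineX t12vars (z10 s 0 ups d k c0) (z10 0 v1 v2 0 (fun=> 0) (fun=> 0))) pp.
have LE d k v1 v2 x : (L d k v1 v2).[x] = meval (z10 s (v1 * x) (ups + v2 * x) d k c0) pp.
  rewrite horner_lineX; apply: meval_eq; rewrite /z10 /t12vars.
  by case=> -[|[|[|[|[|[|[|[|[|[|]]]]]]]]]] //= h; rewrite add0r.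
have topE d k v1 v2 : (size (L d k v1 v2) <= (deg_in t12vars pp).+1)%N /\
    (L d k v1 v2)`_(deg_in t12vars pp) = meval (z10 s v1 v2 d k c0) (topS t12vars pp).
  have [h1 h2] := line_top t12vars (z10 s 0 ups d k c0) (z10 0 v1 v2 0 (fun=> 0) (fun=> 0)) pp.
  split=> //; rewrite /L h2; apply: meval_eq; rewrite /z10 /t12vars.
  by case=> -[|[|[|[|[|[|[|[|[|[|]]]]]]]]]].
have szE d k v1 v2 : meval (z10 s v1 v2 d k c0) (topS t12vars pp) != 0 ->
    size (L d k v1 v2) = (deg_in t12vars pp).+1.
  have [h1 <-] := topE d k v1 v2 => h; apply/eqP; rewrite eqn_leq h1 ltnNge.
  by apply: contra h => h; rewrite nth_default.
have nz : meval (z10 s 1 eta d0 k0 c0) (topS t12vars pp) != 0.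
  have [h1 h2] := topE d0 k0 1 eta; rewrite -h2.
  (* Homogeneity of the top form, obtained by rescaling the parameter of the line. *)
  have E : L d0 k0 z1 z2 = L d0 k0 1 eta \Po (z1 *: 'X).
    apply: horner_inj => x; rewrite horner_comp hornerZ hornerX !LE; apply: meval_eq => j.
    by rewrite /z10 mul1r /eta mulrA divfK.
  have s2 : size (z1 *: 'X : {poly F}) = 2%N by rewrite size_scale // size_polyX.
  have := szE _ _ _ _ zt; rewrite E size_comp_poly2 // => sz.
  by have := lead_coef_eq0 (L d0 k0 1 eta); rewrite lead_coefE sz /= => ->; rewrite -size_poly_eq0 sz.
apply: gen_sub (gen_z10 (ex_intro _ d0 (ex_intro _ k0 nz))) _ => k /cof_sub; apply=> d /szE <-.
have -> : (bl ups eta k (fun=> 0) pp).[d%:P] = L d k 1 eta; last by [].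
by apply: horner_inj => x; rewrite horner_bl LE mul1r; apply: pp_free.
Qed.
End ContentFacts.

Lemma meval_homog (F : fieldType) n e (p : {mpoly F[n]}) (c : F) (z : 'I_n -> F) :
  mhomog e p -> meval (fun i => c * z i) p = c ^+ e * meval z p.
Proof.
move=> /dhomogP H; rewrite (mpolyE p) ![meval _ (\sum_(m <- _) _)]raddf_sum /= mulr_sumr.
rewrite big_seq [RHS]big_seq; apply: eq_bigr => m mp.
rewrite !mevalZ !mevalX mulrCA; congr (_ * _).
under eq_bigr do rewrite exprMn.
by rewrite big_split /= prodrXr -mdegE (H m mp).
Qed.

(** * From the parameters of P to the points of the plane *)

Section RaySystem.
Variable F : numClosedFieldType.

Lemma on_ray_scale (k x v x' v' : 'I_3 -> F) d c : c != 0 -> x =1 x' ->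
  (forall i, v i = c * v' i) -> on_ray k d x v <-> on_ray k d x' v'.
Proof.
move=> c0 xE vE; split=> -[e [l [h1 h2]]].
  exists (e * c), l; split; first by move=> i; rewrite -mulrA -vE -xE.
  rewrite -h2 !mulr_sumr; apply: eq_bigr => i _; rewrite vE; ring.
exists (e / c), l; split; first by move=> i; rewrite vE xE mulrA divfK.
rewrite -h2 !mulr_sumr; apply: eq_bigr => i _; rewrite vE; field.
by rewrite c0.
Qed.

(** If k.U = 0, then [cross k x] and [cross k v] are multiples of U. Minus their ratio, divided by
    w, is the parameter e of a point of the normal line on the span of k, and T_i = 0 fixes its
    distance. If [cross k v] were zero, so would be [cross k x], making x and v parallel. *)
Lemma ray_system (k x v U : 'I_3 -> F) (w d Q Q0 Ht Wt : F) :
  (exists i, k i != 0) -> w != 0 -> \sum_i v i ^+ 2 != 0 ->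
  (forall i, Q0 * U i = cross x v i) -> (exists i, cross x v i != 0) ->
  \sum_i v i ^+ 2 = Q * Ht -> w ^+ 2 = Q * Wt ->
  (\sum_i k i * U i = 0 /\
   forall i, Ht * cross k x i ^+ 2 - d ^+ 2 * (Wt * cross k v i ^+ 2) = 0) <->
  on_ray k d (fun i => x i / w) v.
Proof.
move=> kn w0 v0 QU [i0 xv0] vE wE.
have Q0n : Q0 != 0 by apply: contra_neq xv0 => h; rewrite -QU h mul0r.
have Qn : Q != 0 by have := expf_neq0 2 w0; rewrite wE; apply: contra_neq => ->; rewrite mul0r.
have Hn : Ht != 0 by move: v0; rewrite vE; apply: contra_neq => ->; rewrite mulr0.
have Un : U i0 != 0 by apply: contra_neq xv0 => h; rewrite -QU h mulr0.
have [ox ov] := cross_orth x v.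
have UX : \sum_i U i * x i = 0.
  apply: (mulfI Q0n); rewrite mulr0 -[RHS]ox mulr_sumr; apply: eq_bigr => i _.
  by rewrite mulrA QU.
have UV : \sum_i U i * v i = 0.
  apply: (mulfI Q0n); rewrite mulr0 -[RHS]ov mulr_sumr; apply: eq_bigr => i _.
  by rewrite mulrA QU.
split.
  move=> [kU T].
  have pX j : cross k x j = U j / U i0 * cross k x i0.
    by apply: (mulIf Un); rewrite (cross_prop kU UX i0 j); field.
  have pV j : cross k v j = U j / U i0 * cross k v i0.
    by apply: (mulIf Un); rewrite (cross_prop kU UV i0 j); field.
  have G0 : cross k v i0 != 0.
    apply/eqP => G0; have := T i0; rewrite G0 expr0n /= !mulr0 subr0 => /eqP.
    rewrite mulf_eq0 (negbTE Hn) expf_eq0 /= => /eqP M0.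
    have [|cx xE] := parallel_of (k := x) kn; first by move=> i; rewrite cross_anti pX M0 mulr0 oppr0.
    have [|cv vE'] := parallel_of (k := v) kn; first by move=> i; rewrite cross_anti pV G0 mulr0 oppr0.
    by move/eqP: xv0; apply; rewrite /cross !xE !vE'; ring.
  pose e := - (cross k x i0 / (w * cross k v i0)).
  have [|l lE] := parallel_of (k := fun i => x i / w + e * v i) kn.
    move=> i; rewrite cross_anti; apply/eqP; rewrite oppr_eq0; apply/eqP.
    have -> : cross k (fun i => x i / w + e * v i) i = cross k x i / w + e * cross k v i.
      by rewrite /cross; ring.
    by rewrite (pX i) (pV i) /e; field; rewrite Un w0 G0.
  exists e, l; split=> //.
  have E : Ht * cross k x i0 ^+ 2 = d ^+ 2 * (Wt * cross k v i0 ^+ 2).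
    by apply/eqP; rewrite -subr_eq0 T.
  have n0 : w ^+ 2 * cross k v i0 ^+ 2 != 0 by rewrite mulf_neq0 // expf_neq0.
  apply: (mulIf n0).
  have -> : e ^+ 2 * (\sum_i v i ^+ 2) * (w ^+ 2 * cross k v i0 ^+ 2) =
    (\sum_i v i ^+ 2) * cross k x i0 ^+ 2.
    by rewrite /e; field; rewrite w0 G0.
  by rewrite vE -mulrA E wE; ring.
move=> [e [l [h1 h2]]].
have xE i : x i = w * (l * k i) - w * e * v i.
  by rewrite -h1; field.
split.
  apply: (mulfI Q0n); rewrite mulr0 mulr_sumr.
  rewrite (eq_bigr (fun i => k i * cross x v i)); last by move=> i _; rewrite mulrCA QU.
  have [e0 e1 e2] := crossE x v; rewrite sum3E e0 e1 e2 !xE; ring.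
move=> i; have -> : cross k x i = - (w * e) * cross k v i by rewrite /cross !xE; ring.
apply: (mulfI Qn); rewrite mulr0.
have -> : Q * (Ht * (- (w * e) * cross k v i) ^+ 2 - d ^+ 2 * (Wt * cross k v i ^+ 2)) =
  (Q * Ht * e ^+ 2 * w ^+ 2 - d ^+ 2 * (Q * Wt)) * cross k v i ^+ 2 by ring.
by rewrite -vE -wE -h2; ring.
Qed.
End RaySystem.

Section Main.
Variable F : numClosedFieldType.
Variable f : {mpoly F[3]}.
Hypothesis f_irr : mirreducible f.
Hypothesis himp_nz : exists y, meval y f = 0 /\ meval y (himp f) != 0.
Variable g : {mpoly F[4]}.
Hypothesis g_sqfree : msqfree g.
Hypothesis g_def : forall z, meval z g = 0 <-> gen_offset f z.
Hypothesis assum1 : exists Delta1 : seq F, forall d0 : F, d0 != 0 -> d0 \notin Delta1 ->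
  ~ offset_at f d0 (fun _ => 0).
Hypothesis assum2 : ~ exists r : F, r != 0 /\
  forall y, meval y f = 0 <-> \sum_(i < 3) (y i) ^+ 2 = r.
Variables (P0 : {mpoly F[2]}) (Pn : 'I_3 -> {mpoly F[2]}).
Hypothesis P0_nz : P0 != 0.
Hypothesis P_in : forall t, meval t P0 != 0 -> meval (param_at P0 Pn t) f = 0.
Hypothesis P_dense : forall q : {mpoly F[3]},
  (forall t, meval t P0 != 0 -> meval (param_at P0 Pn t) q = 0) ->
  forall y, meval y f = 0 -> meval y q = 0.
Variable m : nat.
Hypothesis m_ti : tracing_index f P0 Pn m.
Variables (X : 'I_3 -> {mpoly F[3]}) (W : {mpoly F[3]}).
Hypothesis XW_homog : exists e, (forall i, mhomog e (X i)) /\ mhomog e W.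
Hypothesis XW_gcd : is_gcd [:: X 0; X 1; X 2; W] 1.
Hypothesis W_dehom : dehom W != 0.
Hypothesis X_dehom : forall i, dehom (X i) * P0 = dehom W * Pn i.
Variables (gA : {mpoly F[2]}) (n : 'I_3 -> {mpoly F[2]}).
Hypothesis n_def : forall j, Acomp P0 Pn j = gA * n j.
Variable N : 'I_3 -> {mpoly F[3]}.
Hypothesis N_homog : exists e, forall j, mhomog e (N j).
Hypothesis N_gcd : is_gcd [:: N 0; N 1; N 2] 1.
Hypothesis N_dehom : forall j, dehom (N j) = n j.
Variables (Q0 : {mpoly F[3]}) (U : 'I_3 -> {mpoly F[3]}).
Hypothesis Q0_gcd : is_gcd [:: cross X N 0; cross X N 1; cross X N 2] Q0.
Hypothesis U_def : forall j, cross X N j = Q0 * U j.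
Variables (Q Ht Wt : {mpoly F[3]}).
Hypothesis Q_gcd : is_gcd [:: \sum_(j < 3) N j ^+ 2; W ^+ 2] Q.
Hypothesis Ht_def : \sum_(j < 3) N j ^+ 2 = Q * Ht.
Hypothesis Wt_def : W ^+ 2 = Q * Wt.

Let one (t : 'I_2 -> F) := vec3 1 (t ord0) (t ord_max).

Lemma dehom_neq0 p : dehom p != 0 -> p != 0 :> {mpoly F[3]}.
Proof.
move=> h; have [t th] := mpoly_nonroot h; apply: contra_neq th => ->.
by rewrite meval_dehom meval0.
Qed.

Lemma W_nz : W != 0. Proof. exact: dehom_neq0. Qed.

Lemma X_one t i : meval (one t) (X i) * meval t P0 = meval (one t) W * meval t (Pn i).
Proof. by rewrite -!meval_dehom -!mevalM X_dehom. Qed.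

Lemma N_one t j : meval (one t) (N j) = meval t (n j).
Proof. by rewrite -meval_dehom N_dehom. Qed.

Lemma cross_one t i : meval (one t) W * cross (fun j => meval t (Pn j)) (fun j => meval t (n j)) i =
  meval t P0 * cross (fun j => meval (one t) (X j)) (fun j => meval (one t) (N j)) i.
Proof.
rewrite -[_ W]mulr1 -[meval t P0]mulr1 -!cross_scale; apply: eq_cross => j.
  by rewrite -X_one mulrC.
by rewrite N_one.
Qed.

Lemma cross_nz : exists i, cross X N i != 0.
Proof.
have [i ci] := position_normal f_irr himp_nz assum2 P0_nz P_dense n_def.
exists i; apply: contra_neq ci => h; apply: (mulfI W_dehom); rewrite mulr0.
apply: mpoly_eq0P => t; rewrite mevalM meval_dehom meval_cross cross_one -meval_cross h.
by rewrite meval0 mulr0.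
Qed.

Lemma Q0_nz : Q0 != 0.
Proof. by have [j] := cross_nz; rewrite U_def; apply: contra_neq => ->; rewrite mul0r. Qed.

Lemma U_nz : exists i, U i != 0.
Proof. by have [j] := cross_nz; rewrite U_def => h; exists j; apply: contra_neq h => ->; rewrite mulr0. Qed.

Lemma N_nz : exists i, N i != 0.
Proof.
have [j] := cross_nz => h; apply: contrapT => H; move/eqP: h; apply; rewrite /cross.
have N0 l : N l = 0 by apply/eqP; apply: contrapT => /negP h; apply: H; exists l.
by rewrite !N0 !mulr0 subrr.
Qed.

Lemma Q_nz : Q != 0.
Proof. by have := expf_neq0 2 W_nz; rewrite Wt_def; apply: contra_neq => ->; rewrite mul0r. Qed.

Lemma NN_one t : meval (one t) (\sum_j N j ^+ 2) = meval t (\sum_j n j ^+ 2).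
Proof.
rewrite ![meval _ (\sum_j _)]raddf_sum /=; apply: eq_bigr => j _.
by rewrite !rmorphXn /= N_one.
Qed.

Lemma Ht_nz : Ht != 0.
Proof.
have h := normal_sq f_irr himp_nz P0_nz P_in P_dense n_def.
have [t th] := mpoly_nonroot h; apply: contra_neq th => H0.
by rewrite -NN_one Ht_def H0 mulr0 meval0.
Qed.

Lemma U_nc p : rprime p -> ~ (forall q, q \in [:: U 0; U 1; U 2] -> rdvd p q).
Proof.
apply: is_gcd1_nocommon; apply: (is_gcd_cancel Q0_nz).
by rewrite /= -!U_def.
Qed.

Lemma HW_nc p : rprime p -> ~ (forall q, q \in [:: Ht; Wt] -> rdvd p q).
Proof.
apply: is_gcd1_nocommon; apply: (is_gcd_cancel Q_nz).
by rewrite /= -Ht_def -Wt_def.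
Qed.

Local Notation Rs := (resultant (upoly0 (T0p U)) (upoly0 (Tp X N Ht Wt))).

Lemma Rs_nz : Rs != 0.
Proof.
apply: (Rs_neq0 (W := W) (Q := Q) (Q0 := Q0)) => //.
- exact: (is_gcd1_nocommon XW_gcd).
- exact: (is_gcd1_nocommon N_gcd).
- exact: U_nc.
- exact: HW_nc.
- exact: W_nz.
- exact: Ht_nz.
- exact: Q0_nz.
- exact: U_nz.
- exact: N_nz.
Qed.

Lemma Rs_t0 : sfree (pred1 ord0) Rs.
Proof.
move=> w w' ww'.
have H (u v : {poly {mpoly F[10]}}) : map_poly (meval w) u = map_poly (meval w') u ->
    map_poly (meval w) v = map_poly (meval w') v -> meval w (resultant u v) = meval w' (resultant u v).
  by move=> hu hv; rewrite (resultant_morph (meval w)) (resultant_morph (meval w')) hu hv.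
exact: H (upoly0_ext _ ww') (upoly0_ext _ ww').
Qed.

Section Chart.
Variable eta : F.

(* Outside b = 0 the affine parameters t correspond to the points (s, t1, t2) of the plane
   t2 = ups + eta t1, and the system T_0 = T_1 = T_2 = T_3 = 0 says that the normal line at
   P(t) meets the line spanned by k at distance d from P(t). *)
Lemma chart : exists (b : {mpoly F[2]}) (B : {mpoly F[3]}),
  [/\ b != 0, B != 0,
     forall t, meval t b != 0 -> [/\ meval t P0 != 0, fhimp f (param_at P0 Pn t) != 0,
        (exists2 nu, nu != 0 & forall i, meval t (n i) = nu * fgrad f (param_at P0 Pn t) i),
        (exists i, cross (param_at P0 Pn t) (fun j => meval t (n j)) i != 0)
        & t ord_max - eta * t ord0 != 0],
     forall z, meval z B != 0 <->
        z 0 != 0 /\ meval (fun i : 'I_2 => z (lift ord0 i) / z 0) b != 0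
   & forall z, meval z B != 0 -> [/\ meval z Ht != 0, meval z Wt != 0,
        (exists i, cross (fun j => meval z (X j)) (fun j => meval z (N j)) i != 0)
      & forall k d, (exists i, k i != 0) ->
        ((T0v U k z = 0 /\ forall i, sqv Ht X k z i - d ^+ 2 * sqv Wt N k z i = 0) <->
         on_ray k d (param_at P0 Pn (fun i : 'I_2 => z (lift ord0 i) / z 0))
           (fun i => meval (fun i : 'I_2 => z (lift ord0 i) / z 0) (n i)))]].
Proof.
have [hc hc0 hcP] := himp_param himp_nz P_dense.
have [i0 ci0] := position_normal f_irr himp_nz assum2 P0_nz P_dense n_def.
have nsq := normal_sq f_irr himp_nz P0_nz P_in P_dense n_def.
have gA0 := gA_neq0 f_irr P0_nz P_dense n_def.
pose lin : {mpoly F[2]} := 'X_ord_max - eta%:MP * 'X_ord0.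
have lin0 : lin != 0.
  apply/eqP => /(congr1 (meval (fun i : 'I_2 => if i == ord_max then 1 else 0))) /eqP.
  by rewrite meval0 mevalB mevalM mevalC !mevalXU /= mulr0 subr0 oner_eq0.
(* In turn the factors make the line through (1, t) meet the plane, keep P and its homogenization
   defined, make n proportional to the gradient, keep the gradient and n non-isotropic, and keep
   position and normal independent. *)
pose b := lin * P0 * dehom W * gA * hc * (\sum_j n j ^+ 2) * cross Pn n i0.
have b0 : b != 0 by rewrite /b !mulf_neq0.
have bP t : meval t b != 0 -> [/\ meval t lin != 0, meval t P0 != 0, meval t (dehom W) != 0,
    meval t gA != 0 & [/\ meval t hc != 0, meval t (\sum_j n j ^+ 2) != 0 & meval t (cross Pn n i0) != 0]].
  by rewrite /b !mevalM !mulf_eq0 !negb_or => /andP[/andP[/andP[/andP[/andP[/andP[]]]]]].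
have [NN [qh qhE]] := clear_denom b (fun i : 'I_2 => 'X_(lift ord0 i) : {mpoly F[3]}) 'X_ord0.
have {}qhE z : z 0 != 0 -> meval z qh = z 0 ^+ NN * meval (fun i : 'I_2 => z (lift ord0 i) / z 0) b.
  move=> z0; have [|-> _] := qhE z; first by rewrite mevalXU.
  by rewrite mevalXU; congr (_ * _); apply: meval_eq => i; rewrite !mevalXU.
(* [qh] is [b] with its denominators t0 cleared; the factor t0 removes the points at infinity. *)
pose B : {mpoly F[3]} := 'X_ord0 * qh.
have BE z : meval z B != 0 <-> z 0 != 0 /\ meval (fun i : 'I_2 => z (lift ord0 i) / z 0) b != 0.
  rewrite /B mevalM mevalXU mulf_eq0 negb_or; split.
    move=> /andP[z0]; rewrite qhE // mulf_eq0 negb_or => /andP[_ h]; split=> //.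
  by move=> [z0 h]; rewrite qhE // z0 mulf_neq0 // expf_neq0.
have [ex [Xh Wh]] := XW_homog; have [en Nh] := N_homog.
exists b, B; split=> //.
- have [t tb] := mpoly_nonroot b0; apply/eqP => B0.
  have : meval (one t) B != 0.
    apply/BE; rewrite /one /vec3 /= oner_neq0; split=> //.
    apply: contra_neq tb => h; rewrite -[RHS]h; apply: meval_eq => i; rewrite divr1.
    by case: i => -[|[|]] //= ?; congr (t _); apply: val_inj.
  by rewrite B0 meval0 eqxx.
- move=> t /bP[lt t0 Wt0 gt [ht nt ct]]; have fh := hcP t t0 ht.
  have [nu nuE] := normal_parallel P_in n_def t0 gt fh; split=> //.
  + exists nu => //; apply: contra_neq nt => nu0; rewrite [meval _ _]raddf_sum /= big1 // => j _.
    by rewrite rmorphXn /= nuE nu0 mul0r expr0n.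
  + exists i0; apply: contra_neq ct => h; rewrite meval_cross.
    apply: (mulfI (invr_neq0 t0)); rewrite mulr0 -[RHS]h -[(meval t P0)^-1]mulr1 -cross_scale.
    by apply: eq_cross => j; rewrite ?mul1r // mulrC.
  + by move: lt; rewrite /lin mevalB mevalM mevalC !mevalXU.
move=> z Bz; have [z0 bz] := (BE z).1 Bz.
set t := fun i : 'I_2 => z (lift ord0 i) / z 0 in bz *.
have [lt t0 Wn gt [ht nt ct]] := bP _ bz.
have zE : z =1 (fun i => z 0 * one t i).
  apply: I3P; rewrite /one /vec3 /= /t ?mulr1 // mulrC divfK //;
  by congr (z _); apply: val_inj.
have hom e p : mhomog e p -> meval z p = z 0 ^+ e * meval (one t) p.
  by move=> h; rewrite (meval_eq _ zE) (meval_homog _ _ h).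
have XE i := hom ex _ (Xh i); have WE := hom ex _ Wh; have NE i := hom en _ (Nh i).
have ze := expf_neq0 ex z0; have zn := expf_neq0 en z0.
rewrite meval_dehom -/(one t) in Wn.
have Wz : meval z W != 0 by rewrite WE mulf_neq0.
have NNz : \sum_i meval z (N i) ^+ 2 != 0.
  rewrite (eq_bigr (fun i => (z 0 ^+ en) ^+ 2 * meval t (n i) ^+ 2)); last first.
    by move=> i _; rewrite NE N_one exprMn.
  rewrite -mulr_sumr mulf_neq0 ?expf_neq0 //; apply: contra_neq nt => h; rewrite -[RHS]h.
  by rewrite [meval _ _]raddf_sum /=; apply: eq_bigr => i _; rewrite rmorphXn.
have cz : cross (fun j => meval z (X j)) (fun j => meval z (N j)) i0 != 0.
  rewrite (eq_cross _ XE NE) cross_scale !mulf_neq0 //; apply: contra_neq ct => h.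
  by apply: (mulfI Wn); rewrite mulr0 meval_cross cross_one h mulr0.
have HE : \sum_i meval z (N i) ^+ 2 = meval z Q * meval z Ht.
  rewrite -mevalM -Ht_def [meval z _]raddf_sum /=; apply: eq_bigr => i _; by rewrite rmorphXn.
have WWE : meval z W ^+ 2 = meval z Q * meval z Wt by rewrite -mevalM -Wt_def rmorphXn.
split.
- by apply: contra_neq NNz => h; rewrite HE h mulr0.
- by have := expf_neq0 2 Wz; rewrite WWE; apply: contra_neq => ->; rewrite mulr0.
- by exists i0.
move=> k d kn.
have := ray_system (k := k) (x := fun i => meval z (X i)) (v := fun i => meval z (N i))
  (U := fun i => meval z (U i)) d kn Wz NNz (QU_cross U_def z) (ex_intro _ i0 cz) HE WWE.
move=> RS; apply: (iff_trans RS); apply: (on_ray_scale k d zn) => i.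
  rewrite /param_at XE WE; apply: (mulIf Wn); apply: (mulIf t0).
  transitivity (meval (one t) (X i) * meval t P0); first by field; rewrite ze Wn.
  by rewrite X_one; field.
by rewrite NE N_one.
Qed.
End Chart.

Variables (cc g2 pp : {mpoly F[10]}).
Hypothesis cc_gcd : is_gcd (coefs_in cvars Rs) cc.
Hypothesis g2_gcd : is_gcd (coefs_in dkvars cc) g2.
Hypothesis pp_def : cc = g2 * pp.

(** The two counts are taken at one common (k, d) and matched by sending the point (s, t) of the
    plane to the parameters (t / s, (ups + eta t) / s). *)
Lemma degree_formula : (m * deg_in (fun j : 'I_4 => j != ord0) g)%N = deg_in t12vars pp.
Proof.
have [R' RE] := content_dvd cc_gcd.
have [eta etaP] := pp_top Rs_nz Rs_t0 cc_gcd pp_def.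
have [b [B [b0 B0 bP BE BP]]] := chart eta.
have cS := plane_setup (is_gcd1_nocommon XW_gcd) (is_gcd1_nocommon N_gcd) U_nc HW_nc U_def Wt_def
  W_nz Ht_nz Q0_nz U_nz N_nz eta B0.
have cA := cof_and (cof_and cS (cof_notin [:: 0])) (cof_and
  (pp_line Rs_nz Rs_t0 cc_gcd g2_gcd pp_def eta) (R'_line Rs_nz Rs_t0 cc_gcd eta RE)).
have [ups [[[Th [s2 s4 n1 n2 [n3 n4 n5]]]]]] := cof_ex cA; rewrite inE => ups0 [h1 h2].
have UXo := UX_orth U_def Q0_nz; have UNo := UN_orth U_def Q0_nz.
have B1 : gen (fun k => forall s t, meval (pnt ups eta s t) B != 0 -> T0v U k (pnt ups eta s t) = 0 ->
    exists2 i, meval (pnt ups eta s t) (U i) != 0 &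
      ~ (sqv Ht X k (pnt ups eta s t) i = 0 /\ sqv Wt N k (pnt ups eta s t) i = 0)).
  apply: (sol_nondeg ups eta UXo UNo (QU_cross U_def)) => z /BP[] //.
have PC := plane_count (horner_sqs ups eta Ht X) (horner_sqs ups eta Wt N)
  (fun k p i T0 Ui j => conj (sq_prop Ht (UXo p) T0 Ui j) (sq_prop Wt (UNo p) T0 Ui j))
  (plane_s1 U ups eta) s2 (plane_s3 X N Ht Wt ups eta) s4 n1 n2 n3 n4 n5 B1
  (fun t d k c c' => pp_free Rs_nz Rs_t0 cc_gcd pp_def 0 0 t (ups + eta * t) d k c c')
  (fun t d k c d' k' c' => g2_free Rs_nz cc_gcd g2_gcd pp_def 0 t (ups + eta * t) d d' k k' c c')
  h1 h2 _ (etaP ups).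
have {}PC := PC (fun t d k c => etrans (congr1 (meval _) (esym (etrans RE (congr1 ( *%R^~ R') pp_def))))
   (meval_Rs X N U Ht Wt ups eta t d k c)).
have CP := count_params f_irr himp_nz g_sqfree g_def assum1 P_in m_ti (n := n) b0.
have {}CP : gen (fun k => cof (fun d => exists s : seq {ffun 'I_2 -> F},
  [/\ uniq s, size s = (m * deg_in (fun j : 'I_4 => j != ord0) g)%N &
     forall t : {ffun 'I_2 -> F}, t \in s <-> meval t b != 0 /\
       on_ray k d (param_at P0 Pn t) (fun i => meval t (n i))])).
  by apply: CP => t /bP[].
have [k [kn [PCk CPk]]] := gen_ex (gen_and (gen_nonzero F) (gen_and PC CP)).
have [d [[l [ul szl lP]] [s [us ss sP]]]] := cof_ex (cof_and PCk CPk).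
pose tz (p : F * F) (i : 'I_2) := pnt ups eta p.1 p.2 (lift ord0 i) / p.1.
pose tt (p : F * F) : {ffun 'I_2 -> F} := [ffun i => tz p i].
have ttE p : (tt p : 'I_2 -> F) = tz p by apply: funext => i; rewrite ffunE.
have inl p : p \in l -> [/\ p.1 != 0, meval (tz p) b != 0 &
    on_ray k d (param_at P0 Pn (tz p)) (fun i => meval (tz p) (n i))].
  case: p => s' t' /lP[Bz T0 T]; have [z0 bz] := (BE _).1 Bz; split=> //.
  by have [_ _ _ H] := BP _ Bz; apply/(H k d kn).
rewrite -ss -szl -(size_map tt l); apply: perm_size; apply: uniq_perm => //.
  rewrite map_inj_in_uniq // => -[s1 t1] [s2' t2] /inl[/= s10 _ _] /inl[/= s20 _ _] E.
  have e0 := congr1 (fun h : {ffun 'I_2 -> F} => h ord0) E.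
  have e1 := congr1 (fun h : {ffun 'I_2 -> F} => h ord_max) E.
  rewrite /= !ffunE /tz /pnt /vec3 /= in e0 e1.
  have e2 : ups / s1 = ups / s2'.
    have -> : ups / s1 = (ups + eta * t1) / s1 - eta * (t1 / s1) by ring.
    by rewrite e1 e0; ring.
  have e3 : s1 = s2' by apply: invr_inj; apply: (mulfI ups0).
  congr (_, _) => //; move: e0; rewrite e3 => /(congr1 ( *%R^~ s2')).
  by rewrite !divfK.
move=> t; apply/idP/idP.
  move/sP => [bt ray]; have [t0 _ _ _ lin] := bP _ bt.
  set u := t ord_max - eta * t ord0 in lin.
  (* The inverse map: the line through (1, t1, t2) meets the plane at t0 = ups / (t2 - eta t1). *)
  have s0 : ups / u != 0 by rewrite mulf_neq0 // invr_eq0.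
  have tE : tz (ups / u, t ord0 * (ups / u)) = t.
    apply: funext => i; rewrite /tz /pnt /vec3.
    have [->|->] : i = ord0 \/ i = ord_max.
    + by case: i => -[|[|//]] ?; [left|right]; apply: val_inj.
    + by rewrite /= mulfK.
    + rewrite /= mulrDl mulrA mulfK // invf_div mulrCA divff // mulr1 /u; ring.
  apply/mapP; exists (ups / u, t ord0 * (ups / u)); last by apply/ffunP => i; rewrite ffunE tE.
  apply/lP; have Bz : meval (pnt ups eta (ups / u) (t ord0 * (ups / u))) B != 0.
    by apply/BE; split=> //; rewrite -/(tz (ups / u, t ord0 * (ups / u))) tE.
  have [_ _ _ H] := BP _ Bz.
  have [|T0 T] := (H k d kn).2; last by split.
  by rewrite -/(tz (ups / u, t ord0 * (ups / u))) tE.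
move=> /mapP[p /inl[_ bp ray] ->]; apply/sP; rewrite ttE.
by split.
Qed.
End Main.

(* The field of complex numbers is R[i] for R : realType (any realType is
   isomorphic to the real numbers). *)
Theorem mainTheorem1 (R : realType)
  (* the surface Sigma = V(f) *)
  (f : {mpoly R[i][3]})
  (f_irr : mirreducible f)
  (himp_nz : exists y, meval y f = 0 /\ meval y (himp f) != 0)
  (* the generic offset polynomial g(d, x1, x2, x3) and delta = deg_x g *)
  (g : {mpoly R[i][4]})
  (g_sqfree : msqfree g)
  (g_def : forall z, meval z g = 0 <-> gen_offset f z)
  (* Assumption (1) *)
  (assum1 : exists Delta1 : seq R[i], forall d0 : R[i], d0 != 0 -> d0 \notin Delta1 ->
              ~ offset_at f d0 (fun _ => 0))
  (* Assumption (2): Sigma is not a sphere centered at the origin *)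
  (assum2 : ~ exists r : R[i], r != 0 /\
              forall y, meval y f = 0 <-> \sum_(i < 3) (y i) ^+ 2 = r)
  (* the rational parametrization P = (Pn 0 / P0, Pn 1 / P0, Pn 2 / P0) *)
  (P0 : {mpoly R[i][2]}) (Pn : 'I_3 -> {mpoly R[i][2]})
  (P0_nz : P0 != 0)
  (P_gcd : is_gcd [:: P0; Pn 0; Pn 1; Pn 2] 1)
  (P_in : forall t, meval t P0 != 0 -> meval (param_at P0 Pn t) f = 0)
  (P_dense : forall q : {mpoly R[i][3]},
     (forall t, meval t P0 != 0 -> meval (param_at P0 Pn t) q = 0) ->
     forall y, meval y f = 0 -> meval y q = 0)
  (* the tracing index *)
  (m : nat) (m_ti : tracing_index f P0 Pn m)
  (* X, Y, Z, W homogeneous in (t0, t1, t2) *)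
  (X Y Z W : {mpoly R[i][3]})
  (XYZW_homog : exists e, [/\ mhomog e X, mhomog e Y, mhomog e Z & mhomog e W])
  (XYZW_gcd : is_gcd [:: X; Y; Z; W] 1)
  (W_dehom : dehom W != 0)
  (X_dehom : dehom X * P0 = dehom W * Pn 0)
  (Y_dehom : dehom Y * P0 = dehom W * Pn 1)
  (Z_dehom : dehom Z * P0 = dehom W * Pn 2)
  (* n_i = A_i / gcd(A_1, A_2, A_3) *)
  (gA : {mpoly R[i][2]}) (gA_gcd : is_gcd [:: Acomp P0 Pn 0; Acomp P0 Pn 1; Acomp P0 Pn 2] gA)
  (n : 'I_3 -> {mpoly R[i][2]}) (n_def : forall j, Acomp P0 Pn j = gA * n j)
  (* N_1, N_2, N_3 homogeneous in (t0, t1, t2) *)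
  (N : 'I_3 -> {mpoly R[i][3]})
  (N_homog : exists e, forall j, mhomog e (N j))
  (N_gcd : is_gcd [:: N 0; N 1; N 2] 1)
  (N_dehom : forall j, dehom (N j) = n j)
  (* Q0 and U_i *)
  (Q0 : {mpoly R[i][3]})
  (Q0_gcd : is_gcd [:: cross (vec3 X Y Z) N 0;
                       cross (vec3 X Y Z) N 1;
                       cross (vec3 X Y Z) N 2] Q0)
  (U : 'I_3 -> {mpoly R[i][3]})
  (U_def : forall j, cross (vec3 X Y Z) N j = Q0 * U j)
  (* Q = gcd(H, W^2), H~ = H / Q, W~ = W^2 / Q *)
  (Q Ht Wt : {mpoly R[i][3]})
  (Q_gcd : is_gcd [:: \sum_(j < 3) N j ^+ 2; W ^+ 2] Q)
  (Ht_def : \sum_(j < 3) N j ^+ 2 = Q * Ht)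
  (Wt_def : W ^+ 2 = Q * Wt)
  (* Con_c(R) and its primitive part w.r.t. (d, k) *)
  (cc : {mpoly R[i][10]})
  (cc_gcd :
     let T0 := \sum_(j < 3) kvar _ j * emb (U j) in
     let Mh := cross (@kvar _) (fun j => emb (vec3 X Y Z j)) in
     let Gh := cross (@kvar _) (fun j => emb (N j)) in
     let T := \sum_(j < 3) cvar _ j *
                (emb Ht * Mh j ^+ 2 - dvar _ ^+ 2 * emb Wt * Gh j ^+ 2) in
     let Rs := resultant (upoly0 T0) (upoly0 T) in
     is_gcd (coefs_in cvars Rs) cc)
  (g2 pp : {mpoly R[i][10]})
  (g2_gcd : is_gcd (coefs_in dkvars cc) g2)
  (pp_def : cc = g2 * pp) :
  (m * deg_in (fun j : 'I_4 => j != ord0) g)%N = deg_in t12vars pp.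
Proof.
apply: (@degree_formula _ f f_irr himp_nz g g_sqfree g_def assum1 assum2 P0 Pn P0_nz P_in P_dense
  m m_ti (vec3 X Y Z) W _ XYZW_gcd W_dehom _ gA n n_def N N_homog N_gcd N_dehom Q0 U Q0_gcd U_def
  Q Ht Wt Q_gcd Ht_def Wt_def cc g2 pp cc_gcd g2_gcd pp_def).
- by have [e [hX hY hZ hW]] := XYZW_homog; exists e; split=> //; apply: I3P.
- exact: (I3P X_dehom Y_dehom Z_dehom).
Qed.
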